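(* Let $\alpha>0$ and let $(Y_n)_{n\ge 1}$ be a stationary, strongly mixing sequence of nonnegative random variables whose common marginal distribution is regularly varying with tail index $\alpha$, with normalizing sequence $(d_n)$ and with $\widetilde d$ an asymptotic inverse of $d(t)=d_{\lfloor t\rfloor}$. For $t>0$ let $$N_t=\sum_{i\ge 1}\delta_{\left(\frac{i}{\widetilde d(t)},\,\frac{Y_i}{t}\right)},$$ and let $N$ be a Poisson random measure on $[0,\infty)\times(0,\infty]$ with intensity measure $\mathrm{Leb}\times\mu$, where $\mu((x,\infty])=x^{-\alpha}$ for $x>0$. Then $$N_t \stackrel{d}{\longrightarrow} N\qquad\text{as } t\to\infty$$ if and only if $(Y_n)$ has extremal index equal to $1$.
   Context: Regular variation: a nonnegative random variable $Y$ is regularly varying with (tail) index $\alpha>0$ if there is a sequence $(d_n)_{n\ge1}$ of nonnegative real numbers such that $nP(Y\in d_n\,\cdot\,)\to\mu(\cdot)$ vaguely on $(0,\infty]$ as $n\to\infty$, where $\mu((x,\infty])=x^{-\alpha}$, i.e. $nP(Y>d_nx)\to x^{-\alpha}$ for every $x>0$. Here $Y$ has the common law of the $Y_n$. Extend $(d_n)$ to a function on $[0,\infty)$ by $d(t)=d_{\lfloor t\rfloor}$ with $d_0=1$. The function $\widetilde d$ is an asymptotic inverse of $d$: $d(\widetilde d(t))\sim\widetilde d(d(t))\sim t$ as $t\to\infty$ (it exists and is regularly varying with index $\alpha$). Strong mixing: $\sup\{|P(A\cap B)-P(A)P(B)|: A\in\sigma(Y_j,\,j\le k),\ B\in\sigma(Y_j,\,j\ge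 k+n),\ k\ge1\}\to0$ as $n\to\infty$. Extremal index equal to $1$: with $M_n=\max\{Y_1,\dots,Y_n\}$, one has $P(M_n\le d_nx)\to\exp(-x^{-\alpha})$ as $n\to\infty$ for every $x>0$ (the same limit as for an iid sequence with the same marginal law). Point processes: $M_p=M_p([0,\infty)\times(0,\infty])$ is the space of Radon point measures on $[0,\infty)\times(0,\infty]$ with the vague topology ($m_t\to m$ iff $\int f\,dm_t\to\int f\,dm$ for every nonnegative continuous $f$ with compact support in $[0,\infty)\times(0,\infty]$). $\stackrel{d}{\longrightarrow}$ is convergence in distribution of random elements of $M_p$. $\mathrm{Leb}$ is Lebesgue measure on $[0,\infty)$. Points with second coordinate $0$ lie outside the state space and are disregarded. *)

(* Defs.v *)
From HB Require Import structures.
From mathcomp Require Import all_boot all_order all_algebra.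
From mathcomp Require Import all_classical all_reals all_analysis measurable_realfun.

Set Implicit Arguments.
Unset Strict Implicit.
Unset Printing Implicit Defensive.

Import Order.TTheory GRing.Theory Num.Theory.
Import numFieldNormedType.Exports.

Local Open Scope classical_set_scope.
Local Open Scope ring_scope.

(** ** Radon point measures on [0, oo) x (0, oo], with the vague topology *)

(* The state space is the subset [state_space] of the ambient space
   R x \bar R; measures live on the ambient space and charge only
   [state_space]. *)
Notation ambient R := (R * \bar R)%type.

Definition state_space (R : realType) : set (ambient R) :=
  [set z | 0 <= z.1 /\ (0 < z.2)%E].

(* The formula for [mp_meas] is required on all subsets, not only on the
   measurable ones, so that equal measures are equal elements of [Mp]. *)
Record Mp (R : realType) : Type := MkMp {
  mp_meas :> {measure set (ambient R) -> \bar R} ;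
  mp_point : exists (b : pred nat) (x : nat -> ambient R),
    (forall i, b i -> state_space (x i)) /\
    (forall A : set (ambient R),
       mp_meas A = (\sum_(0 <= i <oo | b i) \d_(x i) A)%E) ;
  mp_radon : forall K : set (ambient R), compact K -> K `<=` @state_space R ->
    (mp_meas K < +oo)%E }.

(* Nonnegative continuous functions with compact support on the state space;
   their values off [state_space] are irrelevant, and the support is the
   closure relative to [state_space]. *)
Definition CKplus (R : realType) : set (ambient R -> R) :=
  [set f : ambient R -> R | [/\ forall z, state_space z -> 0 <= f z,
    {within @state_space R, continuous f} &
    compact (@state_space R `&`
             closure (@state_space R `&` [set z | f z != 0]))]].

Definition vague_eval (R : realType) (m : Mp R) :
    prod_topology (fun _ : set_type (@CKplus R) => \bar R) :=
  fun f => (\int[m]_(z in @state_space R) (set_val f z)%:E)%E.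

HB.instance Definition _ (R : realType) := gen_eqMixin (Mp R).
HB.instance Definition _ (R : realType) := gen_choiceMixin (Mp R).
HB.instance Definition _ (R : realType) :=
  Topological.copy (Mp R) (initial_topology (@vague_eval R)).

(** ** The point processes [N_t] *)

Section scaled_point_measure.
Variables (R : realType) (u t : R) (y : nat -> R).

Definition scaled_point (i : nat) : ambient R := (i%:R / u, (y i / t)%:E).

(* Points off the state space (second coordinate 0) are dropped.  The test
   [0 < u] only serves to obtain an element of [Mp] for every [u]. *)
Definition scaled_index : pred nat :=
  [pred i | [&& (0 < i)%N, 0 < u & `[< state_space (scaled_point i) >]]].

Definition scaled_term (i : nat) : {measure set (ambient R) -> \bar R} :=
  if scaled_index i then (\d_(scaled_point i) : {measure set _ -> \bar R})
  else (mzero : {measure set _ -> \bar R}).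

Definition scaled_measure : {measure set (ambient R) -> \bar R} :=
  mseries scaled_term 0.

Lemma scaled_measureE (A : set (ambient R)) :
  scaled_measure A =
  (\sum_(0 <= i <oo | scaled_index i) \d_(scaled_point i) A)%E.
Proof.
rewrite [RHS]eseries_mkcond; apply: eq_eseriesr => i _.
by rewrite /scaled_term; case: ifP.
Qed.

Lemma scaled_measure_point : exists (b : pred nat) (x : nat -> ambient R),
  (forall i, b i -> state_space (x i)) /\
  (forall A : set (ambient R),
     scaled_measure A = (\sum_(0 <= i <oo | b i) \d_(x i) A)%E).
Proof.
exists scaled_index, scaled_point; split; last exact: scaled_measureE.
by move=> i /and3P[_ _ /asboolP].
Qed.

Lemma scaled_measure_radon (K : set (ambient R)) :
  compact K -> K `<=` @state_space R -> (scaled_measure K < +oo)%E.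
Proof.
move=> cK _; rewrite scaled_measureE.
have cfst : {within K, continuous (fst : ambient R -> R)}.
  by apply: continuous_subspaceT => -[r s]; exact: cvg_fst.
have /compact_bounded[M [_ KM]] := continuous_compact cfst cK.
have {}KM z : K z -> `|z.1| <= M + 1.
  by move=> Kz; apply: (KM (M + 1)); [rewrite ltrDl|exists z].
pose n := (Num.truncn ((M + 1) * u)).+1.
have nK i : (n <= i)%N -> scaled_index i -> (\d_(scaled_point i) K = 0 :> \bar R)%E.
  move=> ni /and3P[_ u0 _]; rewrite diracE; case: (boolP (_ \in _)) => // iK.
  have := KM _ (set_mem iK); rewrite /= ger0_norm ?divr_ge0 ?ler0n ?(ltW u0)//.
  rewrite ler_pdivrMr// => iM.
  have : n%:R <= (M + 1) * u by apply: le_trans iM; rewrite ler_nat.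
  by rewrite leNgt truncnS_gt.
rewrite (@nneseries_split_cond _ _ 0 n)//.
rewrite eseries0 ?adde0; last by move=> i; rewrite add0n; exact: nK.
by rewrite ltey_eq; apply/orP; left; apply/sum_fin_numP => i _ _.
Qed.

Definition scaled_Mp : Mp R := MkMp scaled_measure_point scaled_measure_radon.

End scaled_point_measure.

(** ** Convergence in distribution and Poisson random measures *)

(* No sigma-algebra on [S] appears: [F \o X t] and [F \o Z] have to be measurable
   for the expectations to be meaningful.  For [S := Mp R] this holds as soon as
   all the masses [X t w A] and [Z w A] are, because the vague topology is
   separable and metrizable with Borel sets generated by the maps m |-> m A. *)
Definition cvg_in_distribution (R : realType) (S : topologicalType)
    (d : measure_display) (T : measurableType d) (P : probability T R)
    (X : R -> T -> S)
    (d' : measure_display) (T' : measurableType d') (Q : probability T' R)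
    (Z : T' -> S) : Prop :=
  forall F : S -> R, continuous F -> (exists M : R, forall s, `|F s| <= M) ->
    ('E_P[F \o X t])%E @[t --> +oo] --> ('E_Q[F \o Z])%E.

(* [nu] is only evaluated on measurable subsets of [state_space]. *)
Definition poisson_random_measure (R : realType)
    (d : measure_display) (T : measurableType d) (Q : probability T R)
    (N : T -> Mp R) (nu : set (ambient R) -> \bar R) : Prop :=
  [/\ forall A, measurable A -> A `<=` @state_space R ->
        measurable_fun setT (fun w => N w A),
      forall A, measurable A -> A `<=` @state_space R -> (nu A < +oo)%E ->
        forall k : nat, Q [set w | N w A = k%:R%:E] =
          (expR (- fine (nu A)) * fine (nu A) ^+ k / k`!%:R)%:E,
      forall A, measurable A -> A `<=` @state_space R -> nu A = +oo%E ->
        Q [set w | N w A = +oo%E] = 1%E &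
      forall (n : nat) (A : 'I_n -> set (ambient R)),
        (forall i, measurable (A i) /\ A i `<=` @state_space R) ->
        trivIset setT A ->
        forall B : 'I_n -> set (\bar R), (forall i, measurable (B i)) ->
        Q (\bigcap_i [set w | B i (N w (A i))]) =
          (\prod_(i < n) Q [set w | B i (N w (A i))])%E].

(** ** The sequence [(Y_n)_(n >= 1)]; the value at index [0] is never used *)

Section sequence.
Variables (R : realType) (dT : measure_display) (T : measurableType dT).
Variables (P : probability T R) (Y : nat -> {RV P >-> R}).

Definition stationary : Prop :=
  forall (k n : nat) (B : set (n.-tuple R)), measurable B ->
    pushforward P (fun w => [tuple Y (k + i).+1 w | i < n]) B =
    pushforward P (fun w => [tuple Y i.+1 w | i < n]) B.

Definition sigma_gen (J : set nat) : set (set T) :=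
  <<s \bigcup_(j in J) g_sigma_algebra_preimage (Y j) >>.

Definition mixing_coef (n : nat) : \bar R :=
  ereal_sup [set r : \bar R | exists (k : nat) (A B : set T),
    [/\ (1 <= k)%N, sigma_gen [set j | (1 <= j <= k)%N] A,
        sigma_gen [set j | (k + n <= j)%N] B &
        r = `|P (A `&` B) - P A * P B|%E]].

Definition strongly_mixing : Prop := mixing_coef n @[n --> \oo] --> 0%E.

Definition regularly_varying (alpha : R) (d : nat -> R) : Prop :=
  (forall n, (1 <= n)%N -> 0 <= d n) /\
  forall x : R, 0 < x ->
    (n%:R%:E * P [set w | d n * x < Y 1 w]%R)%E @[n --> \oo]
      --> (x `^ (- alpha))%:E.

Definition partial_max (n : nat) (w : T) : R :=
  \big[Num.max/Y 1 w]_(1 <= i < n.+1) Y i w.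

Definition extremal_index_one (alpha : R) (d : nat -> R) : Prop :=
  forall x : R, 0 < x ->
    P [set w | partial_max n w <= d n * x] @[n --> \oo]
      --> (expR (- x `^ (- alpha)))%:E.

End sequence.

(* The value [d 0] is replaced by [1]; negative reals are sent to it too. *)
Definition step_extension (R : realType) (d : nat -> R) (t : R) : R :=
  if Num.truncn t is n.+1 then d n.+1 else 1.

Definition asymptotic_inverse (R : realType) (f g : R -> R) : Prop :=
  (f (g t) / t @[t --> +oo] --> (1 : R)) /\
  (g (f t) / t @[t --> +oo] --> (1 : R)).

(* Main.v *)
Require Import Defs.
From mathcomp Require Import all_boot all_order all_algebra.
From mathcomp Require Import all_classical all_reals all_analysis measurable_realfun.
From mathcomp Require Import ring lra.

(** The proof rests on two facts.

    First, a description of weak convergence on the space of point measures by counts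
    on finite grids.  Cut [0, n] x (0, oo] into a finite grid of cells, fine in time and
    in the coordinate [contract] of the extended line.  If [m'] gives the same mass as
    [m] to the cells of finer and finer grids, the integrals of a given test function
    become close ([integral_close]); so a vaguely continuous functional [F] is, at every
    [m], the limit of its infima over the measures with the counts of [m] on the grid
    ([lower_cvg]).  These infima depend on finitely many integers and bound [F] from
    below, and the same holds for [- F].  Convergence in law of the counts on each grid
    therefore implies weak convergence, and a lower bound for the expectation of
    nonnegative functions of the counts is already enough
    ([cvg_in_distribution_counts]).

    Second, the comparison of the counts of [N_t] and [N] on one grid.  Cut the time
    cells into short blocks of length [dl]; a block of [N_t] has about [dl * dtilde t]
    indices.  If [k] is the number of exceedances of the lowest level in a block, then
    [E k] tends to [dl * lam] by regular variation, and extremal index 1 says that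
    [P (k = 0)] tends to [exp (- dl * lam)]; hence [E (k - 1)^+] is of order [dl ^ 2]:
    blocks with several points are negligible, and a block has exactly one point, in a
    given space cell, with probability [dl] times the mass of this cell up to
    [O(dl ^ 2)] ([block_state_Some], [block_prob_ge]).  The same is true of the Poisson
    measure ([poisson_config]).  Strong mixing makes the blocks asymptotically
    independent, once a gap of fixed length has been removed from each of them
    ([mixing_prod], [config_cut]).  So every configuration of states of the blocks has,
    under both laws, at least a common product as asymptotic probability, and what
    these products miss of the total mass is the number of blocks, of order [1 / dl],
    times [O(dl ^ 2)], which is as small as desired ([counts_limit]).

    Conversely, if [N_t] converges to [N], a continuous functional lying between the
    indicators of the events that a larger and a smaller rectangle contain no point
    shows that [P (M_m <= t x)] tends to [exp (- c x ^ (- alpha))] when [m] is the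
    integer part of [c * dtilde t] ([max_cdf_cvg]); with [t = d n] and [c] close to 1
    this is the extremal index statement ([extremal_index_of_cvg]).

    Regular variation is given along the levels [d n * x], and is transferred to the
    levels [t * x] by monotonicity ([tail_scaling], [max_scaling]). *)

Set Implicit Arguments.
Unset Strict Implicit.
Unset Printing Implicit Defensive.

Import Order.TTheory GRing.Theory Num.Theory.
Import numFieldNormedType.Exports.

Local Open Scope classical_set_scope.
Local Open Scope ring_scope.

(** * The grid *)

Section cells.
Variable R : realType.
Implicit Types (dl : R) (h k n : nat).

(** Time 0 belongs to the first cell; otherwise cells are open on the left.  Then an
    index [i >= 1] satisfies [time_cell dl h (i / u)] exactly when it lies between
    the integer parts of [h * dl * u] (excluded) and [h.+1 * dl * u] (included). *)
Definition time_cell dl h : set R :=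
  [set s | [/\ 0 <= s, s <= h.+1%:R * dl & (0 < h)%N -> h%:R * dl < s]].

(** Levels are measured by [contract], which maps the extended line onto [-1, 1]:
    equal steps of this coordinate refine neighbourhoods of [+oo] too, and the top
    slab contains [+oo]. *)
Definition slab (a b : R) : set (\bar R) := [set y | a < contract y <= b].

Definition space_cell n k : set (\bar R) := slab (k.+1%:R / n%:R) (k.+2%:R / n%:R).

Definition cell dl n h k : set (ambient R) := time_cell dl h `*` space_cell n k.

Lemma time_cell_inj dl h h' s : 0 <= dl ->
  time_cell dl h s -> time_cell dl h' s -> h = h'.
Proof.
move=> dl0; suff H a b : (a < b)%N -> time_cell dl a s -> ~ time_cell dl b s.
  by move=> hs h's; case: (ltngtP h h') => // /H => [/(_ hs)|/(_ h's)].
move=> ab [_ sa _] [_ _ bs].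
have := bs (leq_ltn_trans (leq0n _) ab); rewrite ltNge => /negP; apply.
by apply: (le_trans sa); rewrite ler_wpM2r// ler_nat.
Qed.

Lemma time_cell_cover dl s L : 0 <= s -> (0 < L)%N -> s <= L%:R * dl ->
  exists2 h, (h < L)%N & time_cell dl h s.
Proof.
move=> s0 L0 sL; have ex : exists h, s <= h.+1%:R * dl.
  by exists L.-1; rewrite prednK.
case: (ex_minnP ex) => h sh hmin; exists h.
  by rewrite -(prednK L0) ltnS; apply: hmin; rewrite prednK.
split=> // h0; rewrite ltNge; apply/negP => shd.
by have := hmin h.-1; rewrite prednK// => /(_ shd); rewrite leqNgt prednK// leqnn.
Qed.

Lemma space_cell_inj n k k' y : (0 < n)%N ->
  space_cell n k y -> space_cell n k' y -> k = k'.
Proof.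
move=> n0; suff H a b : (a < b)%N -> space_cell n a y -> ~ space_cell n b y.
  by move=> hs h's; case: (ltngtP k k') => // /H => [/(_ hs)|/(_ h's)].
move=> ab /andP[_ ya] /andP[by_ _].
have := lt_le_trans by_ ya; rewrite ltNge => /negP; apply.
by rewrite ler_wpM2r ?invr_ge0// ler_nat.
Qed.

Lemma space_cell_cover n y : (1 < n)%N -> n%:R^-1 < contract y ->
  exists2 k, (k < n.-1)%N & space_cell n k y.
Proof.
move=> n1 yn; have n0 : (0 < n%:R :> R) by rewrite ltr0n (ltn_trans _ n1).
have y1 : contract y <= 1 := le_trans (ler_norm _) (contract_le1 y).
have n2 : n = n.-2.+2 by case: n n1 {yn n0} => [|[]].
have ex : exists k, contract y <= k.+2%:R / n%:R.
  by exists n.-2; rewrite -n2 divff ?gt_eqF.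
case: (ex_minnP ex) => k yk kmin; exists k.
  by rewrite n2 ltnS; apply: kmin; rewrite -n2 divff ?gt_eqF.
apply/andP; split=> //; rewrite ltNge; apply/negP; case: k yk kmin => [|k] yk kmin.
  by rewrite div1r leNgt yn.
by move=> /kmin; rewrite ltnn.
Qed.

Lemma time_cell_corner dl h : 0 < dl -> time_cell dl h (h.+1%:R * dl).
Proof.
by move=> dl0; split=> // [|_]; [rewrite mulr_ge0// ltW | rewrite ltr_pM2r// ltr_nat].
Qed.

Lemma grid_pos n k : (1 < n)%N -> 0 < k.+1%:R / n%:R :> R.
Proof. by move=> n1; rewrite divr_gt0// ltr0n// (ltn_trans _ n1). Qed.

Lemma grid_le1 n k : (1 < n)%N -> (k < n)%N -> k.+1%:R / n%:R <= 1 :> R.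
Proof.
by move=> n1 kn; rewrite ler_pdivrMr ?mul1r ?ler_nat// ltr0n (ltn_trans _ n1).
Qed.

Lemma space_cell_corner n k : (k < n.-1)%N ->
  space_cell n k (expand (k.+2%:R / n%:R)).
Proof.
move=> kn; have n1 : (1 < n)%N by case: n kn => [|[]].
rewrite /space_cell /slab /= expandK.
  rewrite lexx andbT ltr_pM2r ?ltr_nat// invr_gt0 ltr0n; exact: ltn_trans n1.
rewrite inE ger0_norm; last exact/ltW/grid_pos.
by apply: grid_le1 => //; case: n kn n1 => [|[]].
Qed.

Lemma contract_gt0 (y : \bar R) : (0 < contract y) = (0 < y)%E.
Proof. by rewrite -lt_contract contract0. Qed.

Lemma cell_state dl n h k : (1 < n)%N -> cell dl n h k `<=` @state_space R.
Proof.
move=> n1 [s y] [[s0 _ _] /andP[yk _]]; split => //=.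
by rewrite -contract_gt0 (lt_trans _ yk)//= grid_pos.
Qed.

Lemma contract_gtE (a : R) : -1 <= a <= 1 ->
  [set y : \bar R | a < contract y] = [set` `]expand a, +oo%E]].
Proof.
move=> a1; apply/seteqP; split=> y /=; rewrite in_itv/= leey andbT;
  by rewrite -lt_expandLR// inE ler_norml.
Qed.

Lemma measurable_contract_gt (a : R) : measurable [set y : \bar R | a < contract y].
Proof.
case: (ltP a (-1)) => [aN1|aN1].
  rewrite (_ : mkset _ = setT)//; apply/seteqP; split=> // y _ /=.
  by rewrite (lt_le_trans aN1)//; have := contract_le1 y; rewrite ler_norml => /andP[].
case: (ltP 1 a) => [a1|a1].
  rewrite (_ : mkset _ = set0)//; apply/seteqP; split=> // y /=.
  have := contract_le1 y; rewrite ler_norml => /andP[_ y1] /lt_le_trans/(_ y1).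
  by move=> /(lt_trans a1); rewrite ltxx.
by rewrite contract_gtE ?aN1//; exact: emeasurable_itv.
Qed.

Lemma measurable_contract_ge (a : R) : measurable [set y : \bar R | a <= contract y].
Proof.
rewrite (_ : mkset _ = ~` [set y | (- a)%R < contract (- y)%E]).
  apply: measurableC; rewrite (_ : mkset _ =
      -%E @^-1` [set y | (- a)%R < contract y]) //.
  rewrite -[X in measurable X]setTI; apply: oppe_measurable => //.
  exact: measurable_contract_gt.
by apply/seteqP; split=> y /=; rewrite contractN ltrN2 leNgt => /negP.
Qed.

Lemma slabE (a b : R) :
  slab a b = [set y | a < contract y] `\` [set y | b < contract y].
Proof.
apply/seteqP; split=> y /=; first by move=> /andP[-> yb]; rewrite ltNge yb.
by rewrite /slab/= => -[-> /negP]; rewrite -leNgt.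
Qed.

Lemma measurable_slab a b : measurable (slab a b).
Proof. by rewrite slabE; apply: measurableD; exact: measurable_contract_gt. Qed.

Lemma time_cellE dl h : 0 <= dl -> time_cell dl h =
  [set` (if h is 0%N then `[0, dl] else `]h%:R * dl, h.+1%:R * dl])].
Proof.
move=> dl0; apply/seteqP; split => s /=; case: h => [|h]/=; rewrite in_itv/=.
- by move=> [s0 +  _]; rewrite mul1r s0.
- by move=> [s0 + /(_ isT)] => -> ->.
- by move=> /andP[s0 s1]; split => //; rewrite mul1r.
- move=> /andP[s0 s1]; split => //; rewrite (le_trans _ (ltW s0))//.
  by rewrite mulr_ge0.
Qed.

Lemma measurable_time_cell dl h : 0 <= dl -> measurable (time_cell dl h).
Proof. by move=> dl0; rewrite time_cellE//; exact: measurable_itv. Qed.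

Lemma measurable_cell dl n h k : 0 <= dl -> measurable (cell dl n h k).
Proof.
move=> dl0; apply: measurableX; first exact: measurable_time_cell.
exact: measurable_slab.
Qed.

Lemma lebesgue_time_cell dl h : 0 <= dl ->
  lebesgue_measure (time_cell dl h) = dl%:E.
Proof.
move=> dl0; rewrite time_cellE// lebesgue_measure_itv; case: h => [|h] /=.
  case: ltP => [_|]; first by rewrite oppr0 adde0.
  by rewrite lee_fin => dl0'; congr EFin; apply/eqP; rewrite eq_le dl0 dl0'.
rewrite lte_fin; case: ltP => [_|].
  by rewrite -EFinD; congr EFin; rewrite -mulrBl -natrB// subSnn mul1r.
rewrite -subr_le0 -mulrBl -natrB// subSnn mul1r => dl0'.
by congr EFin; apply/eqP; rewrite eq_le dl0 dl0'.
Qed.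

End cells.

(** * Point measures and test functions *)

Section point_measures.
Variable R : realType.
Implicit Types (m : Mp R) (A B : set (ambient R)) (f : ambient R -> R).

(** The atomic formula for the mass holds on all sets, hence so does monotonicity. *)
Lemma mass_mono m A B : A `<=` B -> (m A <= m B)%E.
Proof.
move=> AB; have [b [x [_ mE]]] := mp_point m; rewrite !mE.
apply: lee_nneseries => [i _ _|i _]; first by rewrite diracE.
by rewrite !diracE lee_fin ler_nat; case: (boolP (x i \in A)) => // /set_mem/AB/mem_set ->.
Qed.

(** The partial sums over the atoms are nondecreasing integers, so they are
    eventually constant as soon as they are bounded. *)
Lemma mass_nat m A : (m A < +oo)%E -> exists k : nat, m A = k%:R%:E.
Proof.
have [b [x [_ mE]]] := mp_point m; rewrite mE => mfin.
pose u i := (b i && (x i \in A) : nat).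
have sE k : (\sum_(0 <= i < k | b i) \d_(x i) A)%E = (nseries u k)%:R%:E :> \bar R.
  rewrite /nseries natr_sum -sumEFin big_mkcond; apply: eq_bigr => i _.
  by rewrite /u diracE; case: (b i).
have [|/dvg_nseries uoo] := pselect (cvgn (nseries u)).
  move=> /cvg_nseries_near[N _ uN]; exists (nseries u N).
  apply/cvg_lim => //; apply: cvg_near_cst; exists N => // k /= Nk.
  rewrite sE; congr (_%:R%:E).
  rewrite /nseries (big_cat_nat (leq0n N) Nk)/= [X in (_ + X)%N]big_nat_cond [X in (_ + X)%N]big1 ?addn0//.
  by move=> i /andP[/andP[Ni _] _]; exact: uN.
move: mfin; rewrite (_ : limn _ = +oo%E)// ?ltxx//.
apply/cvg_lim => //; under eq_fun do rewrite sE.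
apply/cvgeryP/cvgryPge => r.
have : \forall k \near \oo, ((Num.truncn r).+1 <= nseries u k)%N by move/cvgnyPge : uoo.
apply: filterS => k rk; apply: (le_trans _ (_ : (Num.truncn r).+1%:R <= _)).
  exact/ltW/truncnS_gt.
by rewrite ler_nat.
Qed.

Lemma mass_eq0Vge1 m A : m A = 0%E \/ (1 <= m A)%E.
Proof.
have [->|mA] := eqVneq (m A) +oo%E; first by right; rewrite leey.
have [|[|k] ->] := @mass_nat m A; [by rewrite ltey|by left|right].
by rewrite lee_fin ler1n.
Qed.

Definition npoints m A : nat := Num.truncn (fine (m A)).

Lemma npointsE m A : (m A < +oo)%E -> m A = (npoints m A)%:R%:E.
Proof. by move=> /mass_nat[k mk]; rewrite /npoints mk/= natrK. Qed.

Definition box (J th : R) : set (ambient R) :=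
  [set s | 0 <= s <= J] `*` [set y | th <= contract y].

Lemma box_state J th : 0 < th -> box J th `<=` @state_space R.
Proof.
move=> th0 [s y] [/= /andP[s0 _] yth]; split => //=.
by rewrite -contract_gt0 (lt_le_trans th0).
Qed.

Lemma measurable_box J th : measurable (box J th).
Proof.
apply: measurableX; last exact: measurable_contract_ge.
rewrite (_ : mkset _ = `[0, J]%classic); first exact: measurable_itv.
by apply/seteqP; split=> s /=; rewrite in_itv.
Qed.

Lemma contract_continuous : continuous (@contract R).
Proof.
move=> y; apply/cvg_ballP => e e0; have := nbhsx_ballx y _ e0; apply: filterS => z.
by rewrite /ball/=.
Qed.

Lemma compact_box J th : 0 < th -> compact (box J th).
Proof.
move=> th0; apply: compact_setX.
  rewrite (_ : mkset _ = `[0, J]%classic); first exact: segment_compact.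
  by apply/seteqP; split=> s /=; rewrite in_itv.
rewrite (_ : mkset _ = @expand R @` `[th, 1]%classic); last first.
  apply/seteqP; split=> [y /= yth|_ [r /= + <-]]; last first.
    rewrite in_itv/= => /andP[thr r1]; rewrite expandK// inE ger0_norm//.
    exact: le_trans (ltW th0) thr.
  exists (contract y); last exact: contractK.
  by rewrite /= in_itv/= yth (le_trans (ler_norm _) (contract_le1 y)).
apply: continuous_compact; last exact: segment_compact.
apply/subspace_continuousP => r /=; rewrite in_itv/= => /andP[thr r1].
apply/cvg_ballP => e e0; rewrite near_withinE; near=> s; move=> /=.
rewrite in_itv/= => /andP[ths s1]; rewrite /ball/= /ereal_ball.
have s0 := le_trans (ltW th0) ths; have r0 := le_trans (ltW th0) thr.
rewrite !expandK ?inE ?(ger0_norm s0) ?(ger0_norm r0)//.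
Unshelve. all: by end_near. Qed.

Lemma mass_box m J th : 0 < th -> (m (box J th) < +oo)%E.
Proof. by move=> th0; apply: mp_radon; [exact: compact_box|exact: box_state]. Qed.

Lemma cell_box dl n h k : cell dl n h k `<=` box (h.+1%:R * dl) n%:R^-1.
Proof.
move=> [s y] [[/= s0 s1 _] /andP[yk _]]; split => /=; first by rewrite s0.
apply: le_trans (ltW yk); rewrite ler_peMl ?invr_ge0//.
by rewrite ler1n.
Qed.

Lemma mass_cell_lty m dl n h k : (1 < n)%N -> (m (cell dl n h k) < +oo)%E.
Proof.
move=> n1; apply: (le_lt_trans (mass_mono m (@cell_box dl n h k))).
by apply: mass_box; rewrite invr_gt0 ltr0n (ltn_trans _ n1).
Qed.

Lemma mass_cell m dl n h k : (1 < n)%N ->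
  m (cell dl n h k) = (npoints m (cell dl n h k))%:R%:E.
Proof. by move=> n1; apply/npointsE/mass_cell_lty. Qed.

Lemma CKplus_support f : CKplus f -> exists J th : R, [/\ 0 <= J, 0 < th &
  forall z, state_space z -> f z != 0 -> box J th z].
Proof.
move=> [_ _]; set K := _ `&` _ => cK.
have : \forall th \near (0:R)^'+, K `<=` [set z | th <= contract z.2 /\ z.1 <= th^-1].
  apply: ((iffLR (compact_near_coveringP K)) cK) => -[s y] [[/= s0 y0] _].
  have cy0 : 0 < contract y by rewrite contract_gt0.
  near=> z th => /=; split.
    apply: (@le_trans _ _ (contract y / 2)).
      near: th; apply: nbhs_right_le; rewrite divr_gt0//.
    have : ball y (contract y / 2) z.2.
      near: z; apply: (@cvg_snd _ _ (nbhs s) (nbhs y)); apply: nbhsx_ballx.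
      by rewrite divr_gt0.
    rewrite /ball/= /ereal_ball => /(le_lt_trans (ler_norm _)).
    lra.
  apply: (@le_trans _ _ (s + 1)).
    have : ball s 1 z.1.
      near: z; apply: (@cvg_fst _ _ (nbhs s) (nbhs y)); exact: nbhsx_ballx.
    rewrite /ball/= distrC => /(le_lt_trans (ler_norm _)); lra.
  rewrite -[leLHS]invrK lef_pV2 ?posrE ?invr_gt0//; [|lra].
  by near: th; apply: nbhs_right_le; rewrite invr_gt0; lra.
move=> /(filterI (nbhs_right_gt 0))/filter_ex[th [th0 Kth]].
exists th^-1, th; split => //; first by rewrite invr_ge0 ltW.
move=> z zs fz; have [|c1 c2] := Kth z.
  by split=> //; apply: subset_closure.
by split => //=; rewrite c2 andbT; case: zs.
Unshelve. all: by end_near. Qed.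

(** The local moduli of continuity are made uniform on the compact support; two
    points outside the support cause no oscillation. *)
Lemma CKplus_unif f (e : R) : CKplus f -> 0 < e -> exists2 eta : R, 0 < eta &
  forall z z', state_space z -> state_space z' ->
    `|z.1 - z'.1| < eta -> `|contract z.2 - contract z'.2| < eta ->
    `|f z - f z'| < e.
Proof.
move=> [_ /subspace_continuousP cf]; set K := _ `&` _ => cK e0.
have : \forall eta \near (0:R)^'+, K `<=` [set z | forall z', state_space z ->
    state_space z' -> `|z.1 - z'.1| < eta ->
    `|contract z.2 - contract z'.2| < eta -> `|f z - f z'| < e].
  apply: ((iffLR (compact_near_coveringP K)) cK) => x [xs _].
  have /cvgr_dist_lt/(_ (e / 2)) := cf _ xs; rewrite divr_gt0// => /(_ isT).
  rewrite near_withinE => /nbhs_ballP[r /= r0 rP].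
  near=> z eta => z' /= zs z's d1 d2.
  have etar : eta < r / 2 by near: eta; apply: nbhs_right_lt; rewrite divr_gt0.
  have [b1 b2] : ball x (r / 2) z by near: z; apply: nbhsx_ballx; rewrite divr_gt0.
  have bz : ball x r z.
    by split; [apply: le_ball b1|apply: le_ball b2]; lra.
  have bz' : ball x r z'.
    split; rewrite [r]splitr.
      by apply: ball_triangle b1 _; exact: lt_trans etar.
    by apply: ball_triangle b2 _; exact: lt_trans etar.
  have := rP _ bz zs; have := rP _ bz' z's; rewrite -!/(`|_| < _) => h1 h2.
  rewrite [e]splitr (_ : f z - f z' = (f x - f z') - (f x - f z)); last by ring.
  by rewrite (le_lt_trans (ler_normB _ _))// ltrD.
move=> /(filterI (nbhs_right_gt 0))/filter_ex[eta [eta0 Keta]].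
exists eta => // z z' zs z's d1 d2.
have inK y : state_space y -> f y != 0 -> K y.
  by move=> ys fy; split => //; exact: subset_closure.
have [fz|/(inK _ zs)/Keta] := eqVneq (f z) 0; last exact.
have [fz'|/(inK _ z's)/Keta] := eqVneq (f z') 0; first by rewrite fz fz' subrr normr0.
by rewrite distrC; apply => //; rewrite distrC.
Unshelve. all: by end_near. Qed.

End point_measures.

(** * Approximation of test functions by step functions *)

Notation grid n := ('I_(n ^ 2) * 'I_n.-1)%type.

Section step_approximation.
Variable R : realType.
Implicit Types (m : Mp R) (f : ambient R -> R).

Lemma measurable_state_space : measurable (@state_space R).
Proof.
rewrite (_ : @state_space R = [set` `[0, +oo[] `*` [set` `]0%E, +oo%E]]).
  by apply: measurableX; [exact: measurable_itv|exact: emeasurable_itv].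
apply/seteqP; split=> -[s y]; rewrite /state_space /= !in_itv/= ?leey ?andbT//.
Qed.

Definition gcell n (p : grid n) : set (ambient R) := cell n%:R^-1 n p.1 p.2.

Definition corner n (p : grid n) : ambient R :=
  (p.1.+1%:R * n%:R^-1, expand (p.2.+2%:R / n%:R)).

Lemma gcell_corner n (p : grid n) : (1 < n)%N -> gcell p (corner p).
Proof.
move=> n1; split; last exact: space_cell_corner.
by apply: time_cell_corner; rewrite invr_gt0 ltr0n (ltn_trans _ n1).
Qed.

Lemma gcell_inj n (p q : grid n) z : (1 < n)%N -> gcell p z -> gcell q z -> p = q.
Proof.
move=> n1 [zp1 zp2] [zq1 zq2]; case: p q zp1 zp2 zq1 zq2 => [a b] [c d] /= ac bd ca db.
congr (_, _); apply: val_inj => /=.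
  by apply: time_cell_inj ac ca; rewrite invr_ge0.
by apply: space_cell_inj bd db; rewrite (ltn_trans _ n1).
Qed.

Lemma measurable_gcell n (p : grid n) : measurable (gcell p).
Proof. by apply: measurable_cell; rewrite invr_ge0. Qed.

Lemma gcell_state n (p : grid n) : (1 < n)%N -> gcell p `<=` @state_space R.
Proof. by move=> n1; exact: cell_state. Qed.

Lemma gcell_cover n z : (1 < n)%N -> box n%:R n%:R^-1 z -> contract z.2 != n%:R^-1 ->
  exists p : grid n, gcell p z.
Proof.
move=> n1 [/= /andP[z0 zn] cz] cz'.
have n0 : (0 < n)%N := ltn_trans (ltnSn 0) n1.
have nR : n%:R != 0 :> R by rewrite pnatr_eq0 -lt0n.
have n20 : (0 < n ^ 2)%N by rewrite expn_gt0 n0.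
have zn2 : z.1 <= (n ^ 2)%:R * n%:R^-1 by rewrite natrX expr2 mulfK.
have [h hn hz] := time_cell_cover z0 n20 zn2.
have [|k kn kz] := @space_cell_cover R n z.2 n1; first by rewrite lt_neqAle eq_sym cz'.
by exists (Ordinal hn, Ordinal kn).
Qed.

Lemma gcell_dist n (p : grid n) z z' : gcell p z -> gcell p z' ->
  `|z.1 - z'.1| <= n%:R^-1 /\ `|contract z.2 - contract z'.2| <= n%:R^-1.
Proof.
have time_le a b h : time_cell n%:R^-1 h a -> time_cell n%:R^-1 h b ->
    a - b <= n%:R^-1 :> R.
  move=> [a0 ah _] [b0 _]; case: h ah => [|h] ah hb.
    by move: ah; rewrite mul1r; lra.
  have := hb isT; move: ah; rewrite -[h.+2]addn1 natrD mulrDl mul1r; lra.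
have space_le a b k : space_cell n k a -> space_cell n k b ->
    contract a - contract b <= n%:R^-1 :> R.
  move=> /andP[_ ak] /andP[bk _]; move: ak bk.
  rewrite -[k.+2]addn1 natrD mulrDl mul1r; lra.
move=> [z1 z2] [z'1 z'2].
by split; rewrite ler_norml lerNl opprB; apply/andP; split;
  (exact: (time_le _ _ p.1) || exact: (space_le _ _ p.2)).
Qed.

Definition step f n (z : ambient R) : R :=
  \sum_(p : grid n) f (corner p) * \1_(gcell p) z.

Lemma step_in f n (p : grid n) z : (1 < n)%N -> gcell p z ->
  step f n z = f (corner p).
Proof.
move=> n1 pz; rewrite /step (bigD1 p)//= indicE mem_set// mulr1 big1 ?addr0//.
move=> q qp; rewrite indicE memNset ?mulr0// => qz.
by move/eqP: qp; apply; exact: gcell_inj qz pz.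
Qed.

Lemma step_out f n z : (forall p : grid n, ~ gcell p z) -> step f n z = 0.
Proof. by move=> zp; rewrite /step big1// => p _; rewrite indicE memNset ?mulr0. Qed.

Lemma measurable_step f n D : measurable_fun D (step f n).
Proof.
apply: measurable_sum => p; apply: measurable_funM => //.
by apply: measurable_indic; exact: measurable_gcell.
Qed.

Lemma step_ge0 f n z : (1 < n)%N -> CKplus f -> 0 <= step f n z.
Proof.
move=> n1 [f0 _ _]; apply: sumr_ge0 => p _; rewrite mulr_ge0//.
by apply: f0; apply: gcell_state n1 _ (gcell_corner _ n1).
Qed.

Lemma integral_step f n m : (1 < n)%N -> CKplus f ->
  (\int[m]_(z in @state_space R) (step f n z)%:E)%E =
  (\sum_(p : grid n) (f (corner p))%:E * m (gcell p))%E.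
Proof.
move=> n1 [f0 _ _].
have c0 p : 0 <= f (@corner n p).
  by apply: f0; apply: gcell_state n1 _ (gcell_corner _ n1).
rewrite /step; under eq_integral do rewrite -sumEFin.
rewrite ge0_integral_sum//; first last.
- by move=> p z _; rewrite lee_fin mulr_ge0.
- move=> p; apply/measurable_EFinP; apply: measurable_funM => //.
  by apply: measurable_indic; exact: measurable_gcell.
- exact: measurable_state_space.
apply: eq_bigr => p _; under eq_integral do rewrite EFinM.
rewrite ge0_integralZl//.
- rewrite integral_indic//; first last.
  + exact: measurable_gcell.
  + exact: measurable_state_space.
  by rewrite setIidl//; exact: gcell_state.
- exact: measurable_state_space.
- apply/measurable_EFinP; apply: measurable_indic; exact: measurable_gcell.
- exact: c0.
Qed.

(** Cells on which [f] is not identically 0.  Only they contribute to the error of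
    the step approximation, and they stay in a compact box when the grid is
    refined, so that their total mass stays bounded. *)
Definition touched f n : pred (grid n) :=
  fun p => `[< exists2 x, gcell p x & f x != 0 >].

Definition touch f n (z : ambient R) : R :=
  \sum_(p : grid n) (touched f p)%:R * \1_(gcell p) z.

Lemma touch_in f n (p : grid n) z : (1 < n)%N -> gcell p z ->
  touch f n z = (touched f p)%:R.
Proof.
move=> n1 pz; rewrite /touch (bigD1 p)//= indicE mem_set// mulr1 big1 ?addr0//.
move=> q qp; rewrite indicE memNset ?mulr0// => qz.
by move/eqP: qp; apply; exact: gcell_inj qz pz.
Qed.

Lemma touch_out f n z : (forall p : grid n, ~ gcell p z) -> touch f n z = 0.
Proof. by move=> zp; rewrite /touch big1// => p _; rewrite indicE memNset ?mulr0. Qed.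

Lemma measurable_touch f n D : measurable_fun D (touch f n).
Proof.
apply: measurable_sum => p; apply: measurable_funM => //.
by apply: measurable_indic; exact: measurable_gcell.
Qed.

Lemma touch_ge0 f n z : 0 <= touch f n z.
Proof. by apply: sumr_ge0 => p _; rewrite mulr_ge0. Qed.

Lemma integral_touch f n m : (1 < n)%N ->
  (\int[m]_(z in @state_space R) (touch f n z)%:E)%E =
  (\sum_(p : grid n) (touched f p)%:R%:E * m (gcell p))%E.
Proof.
move=> n1.
rewrite /touch; under eq_integral do rewrite -sumEFin.
rewrite ge0_integral_sum//; first last.
- move=> p; apply/measurable_EFinP; apply: measurable_funM => //.
  by apply: measurable_indic; exact: measurable_gcell.
- exact: measurable_state_space.
apply: eq_bigr => p _; under eq_integral do rewrite EFinM.
rewrite ge0_integralZl//.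
- rewrite integral_indic//; first last.
  + exact: measurable_gcell.
  + exact: measurable_state_space.
  by rewrite setIidl//; exact: gcell_state.
- exact: measurable_state_space.
- apply/measurable_EFinP; apply: measurable_indic; exact: measurable_gcell.
Qed.

(** On a fine grid [f] oscillates by less than [e] inside each cell, and the points
    of the state space outside all cells are off the support. *)
Lemma step_approx f : CKplus f -> exists J th : R, 0 < th /\
  forall e : R, 0 < e -> \forall n \near \oo, (1 < n)%N /\
  forall z, state_space z ->
  [/\ f z <= step f n z + e * touch f n z,
      step f n z <= f z + e * touch f n z &
      touch f n z <= \1_(box J th) z].
Proof.
move=> fK; have [J [th [J0 th0 supp]]] := CKplus_support fK.
exists (J + 1), (th / 2); split=> [|e e0]; first by rewrite divr_gt0.
have [eta eta0 unif] := CKplus_unif fK e0.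
near=> n.
have n1 : (1 < n)%N by near: n; exact: nbhs_infty_gt.
have nR : 0 < n%:R :> R by rewrite ltr0n (ltn_trans _ n1).
have nJ : J <= n%:R by near: n; exact: nbhs_infty_ger.
have small (r : R) : 0 < r -> r^-1 < n%:R -> n%:R^-1 < r.
  by move=> r0 rn; rewrite -[ltRHS]invrK ltf_pV2 ?posrE ?invr_gt0.
have neta : n%:R^-1 < eta by apply: small => //; near: n; exact: nbhs_infty_gtr.
have nth : n%:R^-1 < th / 2.
  by apply: small; rewrite ?divr_gt0//; near: n; exact: nbhs_infty_gtr.
have n_lt1 : n%:R^-1 < 1 :> R by rewrite invf_lt1// ltr1n.
split=> // z zs.
have [[p pz]|nz] := pselect (exists p : grid n, gcell p z); last first.
  have {}nz (p : grid n) : ~ gcell p z by move=> pz; apply: nz; exists p.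
  rewrite step_out// touch_out// mulr0 !addr0.
  have fz : f z = 0.
    have [//|/(supp _ zs)[/= /andP[z0 zJ] cz]] := eqVneq (f z) 0.
    have zb : box n%:R n%:R^-1 z.
      by split => /=; [rewrite z0 (le_trans zJ)|rewrite (le_trans _ cz)//; lra].
    have [|p /nz//] := gcell_cover n1 zb.
    by rewrite gt_eqF// (lt_le_trans _ cz)//; lra.
  by rewrite fz.
rewrite (step_in _ n1 pz) (touch_in _ n1 pz).
have cs := gcell_state n1 (gcell_corner p n1).
have close z' : gcell p z' -> `|z.1 - z'.1| < eta /\ `|contract z.2 - contract z'.2| < eta.
  by move=> /(gcell_dist pz)[/le_lt_trans d1 /le_lt_trans d2]; rewrite d1// d2.
have [[x px fx]|nt] := pselect (exists2 x, gcell p x & f x != 0).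
  have -> : touched f p by apply/asboolP; exists x.
  have [d1 d2] := close _ (gcell_corner p n1).
  have := unif _ _ zs cs d1 d2; rewrite ltr_norml => /andP[u1 u2].
  rewrite mulr1; split; [lra|lra|].
  rewrite indicE mem_set//.
  have [/= /andP[x0 xJ] cx] := supp _ (gcell_state n1 px) fx.
  have [] := gcell_dist pz px; rewrite !ler_norml => /andP[g1 g2] /andP[g3 g4].
  case: (zs) => z0 _; split => /=; first by rewrite z0/=; lra.
  by lra.
have f0 x : gcell p x -> f x = 0.
  by move=> px; have [//|fx] := eqVneq (f x) 0; exfalso; apply: nt; exists x.
rewrite (f0 _ pz) (f0 _ (gcell_corner p n1)).
have -> : touched f p = false by apply/asboolP.
by rewrite mulr0 addr0; split.
Unshelve. all: by end_near. Qed.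

Lemma CKplus_measurable f : CKplus f -> measurable_fun (@state_space R) f.
Proof.
move=> fK; apply: (@measurable_fun_cvg _ _ _ _ (step f)).
  by move=> n; exact: measurable_step.
move=> z zs; apply/cvgrPdist_le => e e0.
have [J [th [_ /(_ _ e0)approx]]] := step_approx fK.
near=> n; have /(_ n)[//|n1 /(_ _ zs)[a b]] := near approx.
rewrite indicE => c.
have : e * touch f n z <= e * 1.
  by rewrite ler_wpM2l ?(ltW e0)// (le_trans c)//; case: (_ \in _).
by move=> c'; rewrite ler_norml; lra.
Unshelve. all: by end_near. Qed.

(** The integral of the step function only involves the masses of the cells, and the
    error is at most [e'] times the mass of the touched cells, which is bounded by
    the mass of a compact box. *)
Lemma integral_close m f (e : R) : CKplus f -> 0 < e ->
  \forall n \near \oo, forall m', (forall p : grid n, m' (gcell p) = m (gcell p)) ->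
  (\int[m']_(z in @state_space R) (f z)%:E <=
     \int[m]_(z in @state_space R) (f z)%:E + e%:E)%E /\
  (\int[m]_(z in @state_space R) (f z)%:E <=
     \int[m']_(z in @state_space R) (f z)%:E + e%:E)%E.
Proof.
move=> fK e0; have [f0 _ _] := fK.
have [J [th [th0 approx]]] := step_approx fK.
have mJfin : m (box J th) \is a fin_num.
  by rewrite ge0_fin_numE ?measure_ge0//; exact: mass_box.
pose M := fine (m (box J th)).
have M0 : 0 <= M by exact: fine_ge0.
have MJ : m (box J th) = M%:E by rewrite fineK.
(* [M + 1] rather than [M], which may be 0. *)
pose e' := e / (2 * (M + 1)).
have e'0 : 0 < e' by rewrite divr_gt0// mulr_gt0//; lra.
have := approx _ e'0; apply: filterS => n [n1 {}approx] m' m'E.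
pose S := (\sum_(p : grid n) (f (corner p))%:E * m (gcell p))%E.
pose G := (\sum_(p : grid n) (touched f p)%:R%:E * m (gcell p))%E.
have GM : (G <= M%:E)%E.
  rewrite -MJ -(setIidl (@box_state R J _ th0)) -(integral_indic _ measurable_state_space).
    rewrite /G -integral_touch//; apply: ge0_le_integral => //.
    - exact: measurable_state_space.
    - by move=> z _; rewrite lee_fin touch_ge0.
    - by apply/measurable_EFinP; exact: measurable_touch.
    - by apply/measurable_EFinP; apply: measurable_indic; exact: measurable_box.
    - by move=> z /approx[_ _]; rewrite lee_fin.
  exact: measurable_box.
have G0 : (0 <= G)%E by apply: sume_ge0 => p _; rewrite mule_ge0// lee_fin.
have bounds m0 : (forall p : grid n, m0 (gcell p) = m (gcell p)) ->
    (\int[m0]_(z in @state_space R) (f z)%:E <= S + (e / 2)%:E)%E /\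
    (S <= \int[m0]_(z in @state_space R) (f z)%:E + (e / 2)%:E)%E.
  move=> m0E.
  have mf : measurable_fun (@state_space R) (EFin \o f).
    by apply/measurable_EFinP; exact: CKplus_measurable.
  have mt0 : measurable_fun (@state_space R) (EFin \o touch f n).
    by apply/measurable_EFinP; exact: measurable_touch.
  have mt : measurable_fun (@state_space R) (fun z => (e' * touch f n z)%:E).
    by apply/measurable_EFinP; apply: measurable_funM => //; exact: measurable_touch.
  have ms : measurable_fun (@state_space R) (EFin \o step f n).
    by apply/measurable_EFinP; exact: measurable_step.
  have mS := measurable_state_space.
  have SE : S = (\int[m0]_(z in @state_space R) (step f n z)%:E)%E.
    by rewrite integral_step//; apply: eq_bigr => p _; rewrite m0E.
  have GE : (\int[m0]_(z in @state_space R) (e' * touch f n z)%:E <= (e / 2)%:E)%E.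
    under eq_integral do rewrite EFinM.
    rewrite ge0_integralZl_EFin ?(ltW e'0)//; last first.
      by move=> z _; rewrite lee_fin touch_ge0.
    rewrite integral_touch// (eq_bigr (fun p => (touched f p)%:R%:E * m (gcell p)))%E.
      rewrite -/G (@le_trans _ _ (e'%:E * M%:E)%E)//.
        by rewrite lee_wpmul2l// lee_fin ltW.
      rewrite -EFinM lee_fin /e' -mulrA (_ : _^-1 * M = (M / (M + 1)) / 2); last first.
        by field; rewrite gt_eqF//; lra.
      rewrite ler_wpM2l ?(ltW e0)// ler_pdivrMr// mulVf// ler_pdivrMr; lra.
    by move=> p _; rewrite m0E.
  split.
    apply: (@le_trans _ _ (\int[m0]_(z in @state_space R)
       ((step f n z)%:E + (e' * touch f n z)%:E))%E).
      apply: ge0_le_integral => //.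
      - exact: emeasurable_funD.
      - by move=> z /approx[+ _ _]; rewrite -EFinD lee_fin.
    rewrite ge0_integralD// -?SE ?leeD2l//.
    - by move=> z _; rewrite lee_fin step_ge0.
    by move=> z _; rewrite lee_fin mulr_ge0// ?touch_ge0// ltW.
  rewrite SE; apply: (@le_trans _ _ (\int[m0]_(z in @state_space R)
       ((f z)%:E + (e' * touch f n z)%:E))%E).
    apply: ge0_le_integral => //.
    - by move=> z _; rewrite lee_fin step_ge0.
    - exact: emeasurable_funD.
    - by move=> z /approx[_ + _]; rewrite -EFinD lee_fin.
  rewrite ge0_integralD// ?leeD2l//.
  by move=> z _; rewrite lee_fin mulr_ge0// ?touch_ge0// ltW.
have [a b] := bounds _ m'E; have [c d] := bounds _ (fun=> erefl).
rewrite [e]splitr EFinD !addeA; split.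
  by rewrite (le_trans a)// leeD2r.
by rewrite (le_trans c)// leeD2r.
Qed.

End step_approximation.

(** * Continuous functionals and counts on a grid *)

Section continuous_functionals.
Variable R : realType.
Implicit Types (m : Mp R) (F : Mp R -> R).

Definition same_counts n m m' := forall p : grid n, m' (gcell p) = m (gcell p).

(** The vague topology is coarser than the topology for which a base of
    neighbourhoods of [m] is given by agreement with [m] on the grids: a countable
    base, as a metric on [Mp R] would give. *)
Lemma nbhs_Mp m (A : set (Mp R)) : nbhs m A ->
  \forall n \near \oo, same_counts n m `<=` A.
Proof.
move=> [_ [[C oC <-] Cm CA]].
pose G : set_system (prod_topology (fun _ : set_type (@CKplus R) => \bar R)) :=
  [set V | \forall n \near \oo, forall m', same_counts n m m' -> V (vague_eval m')].
have FG : Filter G.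
  split=> [|U V|U V UV]; first exact: nearW.
    move=> [a _ Ua] [b _ Vb]; exists (maxn a b) => // n /=.
    rewrite geq_max => /andP[/Ua Un /Vb Vn] m' mm'; split; [exact: Un|exact: Vn].
  by move=> [a _ Ua]; exists a => // n /Ua Un m' mm'; apply: UV; exact: Un.
suff : G --> vague_eval m.
  move=> /(_ C); have : nbhs (vague_eval m) C by exact: open_nbhs_nbhs.
  move=> nC /(_ nC)[a _ GC]; exists a => // n /GC Hn m' mm'; apply: CA; exact: Hn.
apply/cvg_sup => f B [_ [[D oD <-] Dm DB]].
have fK := set_valP f.
suff [a _ aD] : \forall n \near \oo, forall m', same_counts n m m' ->
    D (vague_eval m' f).
  by exists a => // n /aD Hn m' mm'; apply: DB; exact: Hn.
have : nbhs (vague_eval m f) D by apply: open_nbhs_nbhs; split.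
have [f0 _ _] := fK.
have I0 m0 : (0 <= vague_eval m0 f)%E.
  by apply: integral_ge0 => z zs; rewrite lee_fin; exact: f0.
have := I0 m; case E : (vague_eval m f) => [r||]// r0 nD.
- have {nD} : \forall s \near r, D s%:E by exact: nD.
  move=> /nbhs_ballP[e /= e0 eD].
  have e20 : 0 < e / 2 by rewrite divr_gt0.
  have := integral_close m fK e20; apply: filterS => n H m' mm'.
  have [] := H _ mm'; rewrite -/(vague_eval m' f) -/(vague_eval m f) E.
  case: (vague_eval m' f) (I0 m') => [s||]//.
  rewrite !lee_fin => _ a b.
  by apply: eD; rewrite /ball/= ltr_norml; apply/andP; split; lra.
- have := @integral_close R m _ 1 fK ltr01; apply: filterS => n H m' mm'.
  have [_] := H _ mm'; rewrite -/(vague_eval m' f) -/(vague_eval m f) E.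
  by move: Dm; rewrite /= E; case: (vague_eval m' f).
Qed.

Lemma continuous_same_counts F m (e : R) : continuous F -> 0 < e ->
  \forall n \near \oo, forall m', same_counts n m m' -> `|F m - F m'| < e.
Proof.
move=> cF e0; apply: (@nbhs_Mp m [set m' | `|F m - F m'| < e]).
by have /cvgr_dist_lt/(_ _ e0) := cF m.
Qed.

Definition counts n m : {ffun grid n -> nat} := [ffun p => npoints m (gcell p)].

Lemma counts_same n m m' : (1 < n)%N -> counts n m' = counts n m -> same_counts n m m'.
Proof.
by move=> n1 /ffunP cmm' p; have := cmm' p; rewrite !ffunE /gcell !mass_cell// => ->.
Qed.

(** Infima over the fibres of [counts n], rather than values at representatives:
    they bound [F] from below everywhere and still converge to it pointwise. *)
Definition lower F n (v : {ffun grid n -> nat}) : R :=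
  inf [set F m | m in [set m | counts n m = v]].

Lemma lower_le F n m (M : R) : (forall m, `|F m| <= M) -> lower F (counts n m) <= F m.
Proof.
move=> FM; apply: ge_inf; last by exists m.
by exists (- M) => _ [m' _ <-]; have := FM m'; rewrite ler_norml => /andP[].
Qed.

Lemma lower_ge F n m (c : R) : (forall m', counts n m' = counts n m -> c <= F m') ->
  c <= lower F (counts n m).
Proof.
move=> cF; apply: lb_le_inf; first by exists (F m), m.
by move=> _ [m' mm' <-]; exact: cF.
Qed.

Lemma lower_bounds F n (v : {ffun grid n -> nat}) (M : R) :
  (forall m, 0 <= F m <= M) -> 0 <= lower F v <= M.
Proof.
move=> FM; have M0 : 0 <= M.
  by have /andP[/le_trans] := FM (scaled_Mp (0 : R) 0 (fun=> 0)); apply.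
(* Count vectors that no measure attains give the infimum of the empty set, 0. *)
have [[m mv]|nov] := pselect (exists m, counts n m = v); last first.
  rewrite /lower (_ : [set F m | m in _] = set0) ?inf0 ?lexx//.
  by apply/seteqP; split=> [r [m mv _]|//]; apply: nov; exists m.
rewrite -mv; apply/andP; split.
  by apply: lower_ge => m1 _; have /andP[] := FM m1.
have FM' m' : `|F m'| <= M by have /andP[F0 F1] := FM m'; rewrite ger0_norm.
by apply: (le_trans (lower_le n m FM')); case/andP: (FM m).
Qed.

Lemma lower_cvg F m (M : R) : continuous F -> (forall m, `|F m| <= M) ->
  lower F (counts n m) @[n --> \oo] --> F m.
Proof.
move=> cF FM; apply/cvgrPdist_le => e e0.
have := continuous_same_counts m cF e0; apply: filterS2 (nbhs_infty_gt 1) => n n1 H.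
rewrite ler_norml; apply/andP; split; last first.
  rewrite lerBlDl -lerBlDr; apply: lower_ge => m' /(counts_same n1)/H.
  by rewrite ltr_norml => /andP[_]; lra.
by have := lower_le n m FM; lra.
Qed.

End continuous_functionals.

(** * Bounded random variables *)

Section bounded_mean.
Context {R : realType} {d : measure_display} {T : measurableType d}.
Variable P : probability T R.
Implicit Types (f g : T -> R) (A B : set T).

Definition prob A : R := fine (P A).
Definition mean f : R := fine ('E_P[f])%E.

Definition bounded_measurable f :=
  measurable_fun setT f /\ exists M : R, forall x, `|f x| <= M.

Lemma bounded_integrable f : bounded_measurable f -> P.-integrable setT (EFin \o f).
Proof.
move=> [mf [M fM]]; apply: measurable_bounded_integrable => //.
  by rewrite ltey_eq fin_num_measure.
exists M; split; first exact: num_real.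
by move=> x Mx t _ /=; rewrite (le_trans (fM t))// ltW.
Qed.

Lemma meanE f : bounded_measurable f -> ('E_P[f])%E = (mean f)%:E.
Proof.
move=> bf; rewrite /mean fineK// unlock; apply: integrable_fin_num => //.
exact: bounded_integrable.
Qed.

Lemma meanRE f : mean f = (\int[P]_w f w)%R.
Proof. by rewrite /mean unlock. Qed.

Lemma mean_le f g : bounded_measurable f -> bounded_measurable g ->
  (forall x, f x <= g x) -> mean f <= mean g.
Proof.
by move=> bf bg fg; rewrite !meanRE; apply: le_Rintegral => //; exact: bounded_integrable.
Qed.

Lemma meanD f g : bounded_measurable f -> bounded_measurable g ->
  mean (fun x => f x + g x) = mean f + mean g.
Proof.
by move=> bf bg; rewrite !meanRE RintegralD//; exact: bounded_integrable.
Qed.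

Lemma meanB f g : bounded_measurable f -> bounded_measurable g ->
  mean (fun x => f x - g x) = mean f - mean g.
Proof.
by move=> bf bg; rewrite !meanRE RintegralB//; exact: bounded_integrable.
Qed.

Lemma meanZ k f : bounded_measurable f -> mean (fun x => k * f x) = k * mean f.
Proof.
by move=> bf; rewrite !meanRE RintegralZl//; exact: bounded_integrable.
Qed.

Lemma mean_cst k : mean (fun=> k) = k.
Proof. by rewrite /mean expectation_cst. Qed.

Lemma mean_indic A : measurable A -> mean \1_A = prob A.
Proof. by move=> mA; rewrite /mean expectation_indic. Qed.

Lemma bounded_measurable_cst k : bounded_measurable (fun=> k).
Proof. by split; [exact: measurable_cst|exists `|k|]. Qed.

Lemma bounded_measurable_indic A : measurable A -> bounded_measurable \1_A.
Proof.
move=> mA; split; first exact: measurable_indic.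
by exists 1 => x; rewrite indicE; case: (_ \in _); rewrite ?normr1 ?normr0.
Qed.

Lemma bounded_measurableD f g : bounded_measurable f -> bounded_measurable g ->
  bounded_measurable (fun x => f x + g x).
Proof.
move=> [mf [M fM]] [mg [K gK]]; split; first exact: measurable_funD.
by exists (M + K) => x; rewrite (le_trans (ler_normD _ _))// lerD.
Qed.

Lemma bounded_measurableB f g : bounded_measurable f -> bounded_measurable g ->
  bounded_measurable (fun x => f x - g x).
Proof.
move=> [mf [M fM]] [mg [K gK]]; split; first exact: measurable_funB.
by exists (M + K) => x; rewrite (le_trans (ler_normB _ _))// lerD.
Qed.

Lemma bounded_measurableZ k f : bounded_measurable f -> bounded_measurable (fun x => k * f x).
Proof.
move=> [mf [M fM]]; split; first exact: measurable_funM.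
by exists (`|k| * M) => x; rewrite normrM ler_wpM2l.
Qed.

Lemma bounded_measurable_sum (I : Type) (s : seq I) (f_ : I -> T -> R) :
  (forall i, bounded_measurable (f_ i)) ->
  bounded_measurable (fun x => \sum_(i <- s) f_ i x).
Proof.
move=> bf; elim: s => [|i s IH].
  by under eq_fun do rewrite big_nil; exact: bounded_measurable_cst.
by under eq_fun do rewrite big_cons; exact: bounded_measurableD.
Qed.

Lemma mean_sum (I : Type) (s : seq I) (f_ : I -> T -> R) :
  (forall i, bounded_measurable (f_ i)) ->
  mean (fun x => \sum_(i <- s) f_ i x) = \sum_(i <- s) mean (f_ i).
Proof.
move=> bf; elim: s => [|i s IH].
  by under eq_fun do rewrite big_nil; rewrite big_nil mean_cst.
by under eq_fun do rewrite big_cons; rewrite big_cons meanD ?IH//; exact: bounded_measurable_sum.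
Qed.

Lemma probE A : measurable A -> P A = (prob A)%:E.
Proof. by move=> mA; rewrite /prob fineK// fin_num_measure. Qed.

Lemma prob_ge0 A : 0 <= prob A.
Proof. exact: fine_ge0. Qed.

Lemma prob_le A B : measurable A -> measurable B -> A `<=` B -> prob A <= prob B.
Proof.
by move=> mA mB AB; rewrite -lee_fin -!probE// le_measure// inE.
Qed.

Lemma prob_le1 A : measurable A -> prob A <= 1.
Proof. by move=> mA; rewrite -lee_fin -probE// probability_le1. Qed.

Lemma probC A : measurable A -> prob (~` A) = 1 - prob A.
Proof.
by move=> mA; apply: EFin_inj; rewrite EFinB -!probE ?probability_setC//; exact: measurableC.
Qed.

End bounded_mean.

(** * Reduction of weak convergence to finite grids *)

Section weak_convergence_criterion.
Variable R : realType.

Section measurability.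
Context {d : measure_display} {T : measurableType d}.

(** Counts take countably many values, so every function of them is measurable once
    their level sets are. *)
Lemma measurable_countable_range (D : countType) (c : T -> D) (g : D -> R) :
  (forall v, measurable [set w | c w = v]) -> measurable_fun setT (g \o c).
Proof.
move=> mc _ B mB; rewrite setTI.
rewrite (_ : _ @^-1` _ = \bigcup_k (if (unpickle k : option D) is Some v then
   (if g v \in B then [set w | c w = v] else set0) else set0)).
  apply: bigcupT_measurable => k; case: (unpickle k) => // v.
  by case: ifP.
apply/seteqP; split=> w /=.
  by move=> Bw; exists (pickle (c w)) => //; rewrite pickleK mem_set.
by move=> [k _]; case: (unpickle k) => // v; case: ifPn => [/set_mem + cv|//]; rewrite -cv.
Qed.

Definition measurable_masses (X : T -> Mp R) := forall (dl : R) n h k,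
  0 <= dl -> (1 < n)%N -> measurable_fun setT (fun w => X w (cell dl n h k)).

Lemma measurable_counts (X : T -> Mp R) n v : (1 < n)%N -> measurable_masses X ->
  measurable [set w | counts n (X w) = v].
Proof.
move=> n1 mX.
rewrite (_ : mkset _ = \bigcap_(p in [set: grid n])
    ((fun w => X w (gcell p)) @^-1` [set (v p)%:R%:E])).
  apply: fin_bigcap_measurable; first exact: finite_finset.
  move=> p _; rewrite -[X in measurable X]setTI.
  by apply: mX; rewrite ?invr_ge0//; exact: emeasurable_set1.
apply/seteqP; split=> w /=.
  by move=> <- p _ /=; rewrite ffunE /gcell mass_cell.
move=> H; apply/ffunP => p; rewrite ffunE; have := H p I.
by rewrite /= /gcell mass_cell// => -[] /eqP; rewrite eqr_nat => /eqP.
Qed.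

(** [F] is the pointwise limit of its infima over the fibres of the counts. *)
Lemma measurable_functional (F : Mp R -> R) (X : T -> Mp R) (M : R) :
  continuous F -> (forall m, `|F m| <= M) -> measurable_masses X ->
  measurable_fun setT (F \o X).
Proof.
move=> cF FM mX.
apply: (@measurable_fun_cvg _ _ _ _ (fun n w => lower F (counts n.+2 (X w)))).
  move=> n; apply: (measurable_countable_range (c := fun w => counts n.+2 (X w))).
  by move=> v; exact: measurable_counts.
move=> w _; have := @lower_cvg _ F (X w) M cF FM; rewrite -(cvg_shiftn 2) /=.
by under eq_fun do rewrite addn2.
Qed.

End measurability.

Context {dT : measure_display} {T : measurableType dT} {P : probability T R}.
Context {dT' : measure_display} {T' : measurableType dT'} {Q : probability T' R}.

(** A one-sided bound on functions of the counts of one grid at a time is enough: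
    [lower F] bounds [F] from below under the first law and approximates it under
    the limit law, and the reverse inequality is the same bound for [M - F]. *)
Lemma cvg_in_distribution_counts (X : R -> T -> Mp R) (Z : T' -> Mp R) :
  (\forall t \near +oo, measurable_masses (X t)) -> measurable_masses Z ->
  (forall n (g : {ffun grid n -> nat} -> R) (M e : R), (1 < n)%N ->
     (forall v, 0 <= g v <= M) -> 0 < e ->
     \forall t \near +oo,
       mean Q (fun w => g (counts n (Z w))) <=
       mean P (fun w => g (counts n (X t w))) + e) ->
  cvg_in_distribution P X Q Z.
Proof.
move=> mX mZ H.
(* The lower bound for nonnegative [F]; it is applied to [M + F] and [M - F] below. *)
have lowb (F : Mp R -> R) (M e : R) : continuous F -> (forall m, 0 <= F m <= M) ->
    0 < e -> \forall t \near +oo, mean Q (F \o Z) <= mean P (F \o X t) + e.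
  move=> cF FM e0.
  have FM' m : `|F m| <= M by have /andP[F0 F1] := FM m; rewrite ger0_norm.
  have bF d0 (T0 : measurableType d0) (X0 : T0 -> Mp R) : measurable_masses X0 ->
      bounded_measurable (F \o X0).
    move=> mX0; split; last by exists M => x; exact: FM'.
    exact: measurable_functional mX0.
  have bL d0 (T0 : measurableType d0) (X0 : T0 -> Mp R) n : (1 < n)%N ->
      measurable_masses X0 -> bounded_measurable (fun w => lower F (counts n (X0 w))).
    move=> n1 mX0; split; last first.
      exists M => x; have /andP[l0 l1] := lower_bounds (counts n (X0 x)) FM.
      by rewrite ger0_norm.
    apply: (measurable_countable_range (c := fun w => counts n (X0 w))).
    by move=> v; exact: measurable_counts.
  have : mean Q (fun w => lower F (counts n.+2 (Z w))) @[n --> \oo] --> mean Q (F \o Z).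
    have [] := @dominated_convergence _ _ R Q setT measurableT
      (fun n w => (lower F (counts n.+2 (Z w)))%:E) (fun w => (F (Z w))%:E) (fun=> M%:E).
    - by move=> n; apply/measurable_EFinP; have [] := bL _ _ Z n.+2 isT mZ.
    - by apply/measurable_EFinP; have [] := bF _ _ Z mZ.
    - apply: aeW => w _; apply/cvg_EFin; first exact: nearW.
      have := @lower_cvg _ F (Z w) M cF FM'; rewrite -(cvg_shiftn 2) /=.
      by under eq_fun do rewrite addn2.
    - exact: (bounded_integrable Q (bounded_measurable_cst M)).
    - apply: aeW => w n _; rewrite lee_fin.
      have /andP[l0 l1] := lower_bounds (counts n.+2 (Z w)) FM.
      by rewrite ger0_norm.
    have -> : (\int[Q]_w (F (Z w))%:E = (mean Q (F \o Z))%:E)%E.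
      by rewrite -meanE ?unlock//; exact: bF.
    move=> _ _ /fine_cvgP[_]; apply: cvg_trans; apply: near_eq_cvg.
    by apply: nearW => n /=; rewrite meanRE.
  have e20 : 0 < e / 2 by rewrite divr_gt0.
  move=> /cvgrPdist_le/(_ _ e20)/filter_ex[n nP].
  have := H n.+2 (@lower R F n.+2) M (e / 2) isT (fun v => lower_bounds v FM) e20.
  apply: filterS2 mX => t mXt Ht.
  move: nP; rewrite ler_norml => /andP[_ nP].
  have : mean P (fun w => lower F (counts n.+2 (X t w))) <= mean P (F \o X t).
    by apply: mean_le; [exact: bL|exact: bF|move=> w; exact: lower_le FM'].
  lra.
move=> F cF [M FM].
have bF d0 (T0 : measurableType d0) (X0 : T0 -> Mp R) : measurable_masses X0 ->
    bounded_measurable (F \o X0).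
  move=> mX0; split; last by exists M => x; exact: FM.
  exact: measurable_functional mX0.
rewrite (meanE _ (bF _ _ _ mZ)).
apply/fine_cvgP; split; first by apply: filterS mX => t mXt; rewrite meanE//; exact: bF.
apply/cvgrPdist_le => e e0.
have cFp : continuous (fun m => M + F m).
  by move=> m; apply: (cvgD (cvg_cst M) (cF m)).
have cFm : continuous (fun m => M - F m).
  by move=> m; apply: (cvgB (cvg_cst M) (cF m)).
have FMb m : - M <= F m <= M by rewrite -ler_norml.
have Fp m : 0 <= M + F m <= M + M by have /andP[] := FMb m; lra.
have Fm m : 0 <= M - F m <= M + M by have /andP[] := FMb m; lra.
apply: filterS3 (lowb _ _ _ cFp Fp e0) (lowb _ _ _ cFm Fm e0) mX => t.
have bMP := bounded_measurable_cst (T := T) M; have bMQ := bounded_measurable_cst (T := T') M.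
move=> + + mXt; rewrite /comp.
rewrite (meanD Q bMQ (bF _ _ _ mZ)) (meanB Q bMQ (bF _ _ _ mZ)) !mean_cst.
rewrite (meanD P bMP (bF _ _ _ mXt)) (meanB P bMP (bF _ _ _ mXt)) !mean_cst.
by rewrite ler_norml /mean/= => a b; apply/andP; split; lra.
Qed.

End weak_convergence_criterion.

(** * Asymptotics of tails and maxima *)

Lemma squeeze_eps (R : realType) (I : Type) (F : set_system I) (FF : Filter F)
    (f : I -> R) (l : R) :
  (forall e, 0 < e -> exists (g : I -> R) (l' : R),
     [/\ g x @[x --> F] --> l', l' < l + e & \forall x \near F, f x <= g x]) ->
  (forall e, 0 < e -> exists (g : I -> R) (l' : R),
     [/\ g x @[x --> F] --> l', l - e < l' & \forall x \near F, g x <= f x]) ->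
  f x @[x --> F] --> l.
Proof.
move=> up lo; apply/cvgrPdist_le => e e0.
have e20 : 0 < e / 2 by rewrite divr_gt0.
have [g [a [ga ale fg]]] := up _ e20; have [h [b [hb bge hf]]] := lo _ e20.
move: ga hb => /cvgrPdist_le/(_ _ e20) ga /cvgrPdist_le/(_ _ e20) hb.
near=> x; rewrite ler_norml.
have : `|a - g x| <= e / 2 by near: x.
have : `|b - h x| <= e / 2 by near: x.
have : f x <= g x by near: x.
have : h x <= f x by near: x.
by rewrite !ler_norml => ? ? /andP[? ?] /andP[? ?]; apply/andP; split; lra.
Unshelve. all: by end_near. Qed.

Section negative_power.
Variables (R : realType) (alpha : R).
Hypothesis alpha_gt0 : 0 < alpha.
Let phi (x : R) := x `^ (- alpha).

Lemma npow_anti x y : 0 < x -> x < y -> phi y < phi x.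
Proof.
move=> x0 xy; have y0 := lt_trans x0 xy.
rewrite /phi !powRN ltf_pV2 ?posrE ?powR_gt0//.
by apply: gt0_ltr_powR; rewrite ?nnegrE ?ltW.
Qed.

Lemma npow_cts x : 0 < x -> {for x, continuous phi}.
Proof.
move=> x0; apply: differentiable_continuous; apply/derivable1_diffP.
by apply: derivable_powR; rewrite in_itv/= x0.
Qed.

Lemma npow_scale x c : 0 < x -> 0 < c -> phi (x * c `^ (- alpha^-1)) = c * phi x.
Proof.
move=> x0 c0; rewrite /phi powRM ?powR_ge0 ?ltW// -powRrM mulrNN mulVf ?gt_eqF//.
by rewrite powRr1 ?ltW// mulrC.
Qed.

End negative_power.

Lemma near_below (R : realType) (f : R -> R) (x e : R) : 0 < x ->
  {for x, continuous f} -> 0 < e ->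
  exists y, [/\ 0 < y, y < x & `|f x - f y| < e].
Proof.
move=> x0 /cvgrPdist_lt/(_ e)/[apply] /nbhs_ballP[r /= r0 rP].
have m0 : 0 < Num.min (r / 2) (x / 2) by rewrite lt_min !divr_gt0.
have m1 : Num.min (r / 2) (x / 2) <= r / 2 by rewrite ge_min lexx.
have m2 : Num.min (r / 2) (x / 2) <= x / 2 by rewrite ge_min lexx orbT.
exists (x - Num.min (r / 2) (x / 2)); split; [lra|lra|].
by apply: rP; rewrite /ball/= ltr_norml; apply/andP; split; lra.
Qed.

Lemma near_above (R : realType) (f : R -> R) (x e : R) :
  {for x, continuous f} -> 0 < e ->
  exists y, x < y /\ `|f x - f y| < e.
Proof.
move=> /cvgrPdist_lt/(_ e)/[apply] /nbhs_ballP[r /= r0 rP].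
exists (x + r / 2); split; first by lra.
by apply: rP; rewrite /ball/= ltr_norml; apply/andP; split; lra.
Qed.

Section truncn_ratio.
Variables (R : realType) (u : R -> R).
Hypothesis uoo : u t @[t --> +oo] --> +oo.

Lemma near_gt (A : R) : \forall t \near +oo, A < u t.
Proof. by move: A; apply/cvgryPgt. Qed.

Lemma truncn_ratio (c : R) : 0 <= c ->
  (Num.truncn (c * u t))%:R / u t @[t --> +oo] --> c.
Proof.
move=> c0; apply/cvgrPdist_le => e e0; near=> t.
have ut : e^-1 < u t by near: t; exact: near_gt.
have u0 : 0 < u t by rewrite (lt_trans _ ut)// invr_gt0.
have /andP[h1 h2] := truncn_itv (mulr_ge0 c0 (ltW u0)).
have eu : 1 <= e * u t by rewrite -ler_pdivrMl// mulr1 ltW.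
rewrite -natr1 in h2.
have a : (Num.truncn (c * u t))%:R / u t <= c by rewrite ler_pdivrMr.
have b : c - e <= (Num.truncn (c * u t))%:R / u t.
  by rewrite ler_pdivlMr// mulrBl; lra.
by rewrite ler_norml; apply/andP; split; lra.
Unshelve. all: by end_near. Qed.

Lemma truncn_cvg_infty (m : R -> nat) (c : R) : 0 < c ->
  (m t)%:R / u t @[t --> +oo] --> c -> m t @[t --> +oo] --> \oo.
Proof.
move=> c0 mc; apply/cvgnyPge => A.
have c20 : 0 < c / 2 by rewrite divr_gt0.
move: mc => /cvgrPdist_le/(_ _ c20) mc; near=> t.
have : `|c - (m t)%:R / u t| <= c / 2 by near: t.
have : A%:R / (c / 2) < u t by near: t; exact: near_gt.
rewrite ltr_pdivrMr// => ut.
have u0 : 0 < u t by rewrite -(pmulr_lgt0 _ c20) (le_lt_trans _ ut).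
rewrite ler_norml => /andP[_ h].
have {h} : c / 2 <= (m t)%:R / u t by lra.
rewrite ler_pdivlMr// => h; rewrite -(ler_nat R); rewrite mulrC in h.
exact: le_trans (ltW ut) h.
Unshelve. all: by end_near. Qed.

End truncn_ratio.

Section inverse_asymptotics.
Variables (R : realType) (d : nat -> R) (dtilde : R -> R).
Hypothesis dtildeP : step_extension d (dtilde t) / t @[t --> +oo] --> (1 : R).

(** Where [dtilde t <= A], the value of [step_extension d] at [dtilde t] is one of
    finitely many, whereas it is equivalent to [t]. *)
Lemma dtilde_cvg_infty : dtilde t @[t --> +oo] --> +oo.
Proof.
apply/cvgryPge => A.
have half0 : 0 < 1 / 2 :> R by rewrite divr_gt0.
move: dtildeP => /cvgrPdist_le/(_ _ half0) ratio.
pose B := 1 + \sum_(k < (Num.truncn A).+1) `|d k|.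
near=> t; rewrite leNgt; apply/negP => uA.
have t0 : 0 < t by near: t; exact: nbhs_pinfty_gt (num_real _).
have tB : 2 * B < t by near: t; exact: nbhs_pinfty_gt (num_real _).
have : `|1 - step_extension d (dtilde t) / t| <= 1 / 2 by near: t.
rewrite ler_norml => /andP[_ h].
have {h} : 1 / 2 <= step_extension d (dtilde t) / t by lra.
rewrite ler_pdivlMr// => h.
have : step_extension d (dtilde t) <= B; last by lra.
have S0 : 0 <= \sum_(k < (Num.truncn A).+1) `|d k| by apply: sumr_ge0.
rewrite /step_extension; case E : (Num.truncn (dtilde t)) => [|n]; first by rewrite lerDl.
have nA : (n.+1 < (Num.truncn A).+1)%N by rewrite ltnS -E le_truncn// ltW.
rewrite /B (bigD1 (Ordinal nA))//= (le_trans (ler_norm _))//.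
have : 0 <= \sum_(i < (Num.truncn A).+1 | i != Ordinal nA) `|d i| by apply: sumr_ge0.
by lra.
Unshelve. all: by end_near. Qed.

Lemma step_extension_dtilde : \forall t \near +oo,
  step_extension d (dtilde t) = d (Num.truncn (dtilde t)).
Proof.
have := near_gt dtilde_cvg_infty 1; apply: filterS => t t1.
rewrite /step_extension; have := ltW t1; rewrite -truncn_gt0.
by case: (Num.truncn _).
Qed.

Lemma d_truncn_dtilde : d (Num.truncn (dtilde t)) / t @[t --> +oo] --> (1 : R).
Proof.
apply: cvg_trans dtildeP; apply: near_eq_cvg.
by have := step_extension_dtilde; apply: filterS => t ->.
Qed.

End inverse_asymptotics.

Section tail_of_process.
Variables (R : realType) (dT : measure_display) (T : measurableType dT).
Variables (P : probability T R) (Y : nat -> {RV P >-> R}).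

Definition tail (x : R) : R := prob P [set w | x < Y 1 w].

Definition max_cdf (n : nat) (x : R) : R := prob P [set w | partial_max Y n w <= x].

Lemma measurable_gt_RV i (x : R) : measurable [set w | x < Y i w].
Proof.
rewrite (_ : mkset _ = Y i @^-1` `]x, +oo[%classic).
  by rewrite -[X in measurable X]setTI; exact: measurable_funP.
by apply/seteqP; split=> w /=; rewrite in_itv/= andbT.
Qed.

Lemma tail_anti x y : x <= y -> tail y <= tail x.
Proof.
move=> xy; apply: prob_le; try exact: measurable_gt_RV.
by move=> w /=; exact: le_lt_trans.
Qed.

Lemma tail_ltP x y : tail y < tail x -> x < y.
Proof. by move=> h; rewrite ltNge; apply/negP => /tail_anti; rewrite leNgt h. Qed.

Lemma partial_max_le n w x : (0 < n)%N ->
  (partial_max Y n w <= x) <-> (forall i, (0 < i <= n)%N -> Y i w <= x).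
Proof.
move=> n0; rewrite /partial_max; split => [h i i_n|h].
  apply: le_trans h; have : i \in index_iota 1 n.+1 by rewrite mem_index_iota ltnS.
  elim: (index_iota _ _) => [//|j s IH]; rewrite inE big_cons le_max.
  by move=> /predU1P[->|/IH ->]; rewrite ?lexx ?orbT.
rewrite big_nat; apply: bigmax_le; first exact: h.
by move=> i; rewrite ltnS => i_n; exact: h.
Qed.

Lemma measurable_max n x : measurable [set w | partial_max Y n w <= x].
Proof.
have [->|n0] := posnP n.
  rewrite (_ : mkset _ = ~` [set w | x < Y 1 w]).
    by apply: measurableC; exact: measurable_gt_RV.
  apply/seteqP; split=> w /=; rewrite /partial_max big_geq// leNgt => /negP//.
rewrite (_ : mkset _ = \bigcap_(i in [set i | (0 < i <= n)%N]) ~` [set w | x < Y i w]).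
  apply: bigcap_measurableType => i _; apply: measurableC; exact: measurable_gt_RV.
apply/seteqP; split=> w /=.
  by move=> /(partial_max_le _ _ n0) h i /= /h; rewrite leNgt => /negP.
by move=> h; apply/(partial_max_le _ _ n0) => i /h /= /negP; rewrite leNgt.
Qed.

Lemma max_cdf_mono n x y : x <= y -> max_cdf n x <= max_cdf n y.
Proof.
move=> xy; apply: prob_le; try exact: measurable_max.
by move=> w /= h; exact: le_trans xy.
Qed.

Lemma max_cdf_anti m n x : (0 < m)%N -> (m <= n)%N -> max_cdf n x <= max_cdf m x.
Proof.
move=> m0 mn; apply: prob_le; try exact: measurable_max.
move=> w /= /(partial_max_le _ _ (leq_trans m0 mn)) h.
apply/(partial_max_le _ _ m0) => i /andP[i0 im]; apply: h.
by rewrite i0 (leq_trans im).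
Qed.

Section scaling.
Variables (alpha : R) (d : nat -> R) (dtilde : R -> R).
Hypothesis alpha_gt0 : 0 < alpha.
Hypothesis reg : regularly_varying Y alpha d.
Hypothesis dtildeP : asymptotic_inverse (step_extension d) dtilde.

Lemma reg_tail x : 0 < x ->
  n%:R * tail (d n * x) @[n --> \oo] --> x `^ (- alpha).
Proof.
move=> x0; have [_ /(_ _ x0)] := reg; move=> /fine_cvgP[_].
apply: cvg_trans; apply: near_eq_cvg; apply: nearW => n /=.
by rewrite fineM// fin_num_measure//; exact: measurable_gt_RV.
Qed.

Let uoo : dtilde t @[t --> +oo] --> +oo := dtilde_cvg_infty dtildeP.1.

Let n_ratio : (Num.truncn (dtilde t))%:R / dtilde t @[t --> +oo] --> (1 : R).
Proof. by have := truncn_ratio uoo (@ler01 R); under eq_fun do rewrite mul1r. Qed.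

Let n_oo : Num.truncn (dtilde t) @[t --> +oo] --> \oo.
Proof. exact (truncn_cvg_infty uoo ltr01 n_ratio). Qed.

(** [d] at the integer part of [dtilde t] is equivalent to [t], so [t * x] lies between
    two levels of the form [d n * y] with [y] close to [x]; monotonicity of the tail
    and continuity of the power conclude. *)
Lemma tail_scaling x : 0 < x ->
  dtilde t * tail (t * x) @[t --> +oo] --> x `^ (- alpha).
Proof.
move=> x0.
pose g y t := (dtilde t / (Num.truncn (dtilde t))%:R) *
   ((Num.truncn (dtilde t))%:R * tail (d (Num.truncn (dtilde t)) * y)).
have gcvg y : 0 < y -> g y t @[t --> +oo] --> y `^ (- alpha).
  move=> y0; have h1 : dtilde t / (Num.truncn (dtilde t))%:R @[t --> +oo] --> (1 : R).
    have : ((Num.truncn (dtilde t))%:R / dtilde t)^-1 @[t --> +oo] --> (1 : R)^-1.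
      by apply: cvgV; [exact: oner_neq0|exact: n_ratio].
    by rewrite invr1; under eq_fun do rewrite invf_div.
  have h2 := cvg_comp _ _ n_oo (reg_tail y0).
  by rewrite -[X in _ --> X]mul1r; exact: cvgM h1 h2.
have gE y : \forall t \near +oo, g y t = dtilde t * tail (d (Num.truncn (dtilde t)) * y).
  have := near_gt uoo 1; apply: filterS => t t1; rewrite /g mulrA divfK//.
  by rewrite pnatr_eq0 -lt0n truncn_gt0 ltW.
have dt := d_truncn_dtilde dtildeP.1.
apply: squeeze_eps => e e0.
  have [y [y0 yx]] := near_below x0 (@npow_cts R alpha x x0) e0.
  rewrite ltr_norml => /andP[ye _]; exists (g y), (y `^ (- alpha)); split.
  - exact: gcvg.
  - lra.
  have xy1 : 1 < x / y by rewrite ltr_pdivlMr// mul1r.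
  have /cvgr_lt/(_ _ xy1) dlt := dt.
  near=> t; rewrite (near (gE y) t)// ler_wpM2l//.
    by near: t; have := near_gt uoo 0; apply: filterS => t /ltW.
  apply: tail_anti; have t0 : 0 < t by near: t; exact: nbhs_pinfty_gt (num_real _).
  have : d (Num.truncn (dtilde t)) / t < x / y by near: t.
  by rewrite ltr_pdivrMr// mulrAC ltr_pdivlMr// [x * t]mulrC => /ltW.
have [y [xy]] := near_above (@npow_cts R alpha x x0) e0.
rewrite ltr_norml => /andP[_ ye]; exists (g y), (y `^ (- alpha)).
have y0 := lt_trans x0 xy; split.
- exact: gcvg.
- lra.
have xy1 : x / y < 1 by rewrite ltr_pdivrMr// mul1r.
have /cvgr_gt/(_ _ xy1) dgt := dt.
near=> t; rewrite (near (gE y) t)// ler_wpM2l//.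
  by near: t; have := near_gt uoo 0; apply: filterS => t /ltW.
apply: tail_anti; have t0 : 0 < t by near: t; exact: nbhs_pinfty_gt (num_real _).
have : x / y < d (Num.truncn (dtilde t)) / t by near: t.
by rewrite ltr_pdivlMr// mulrAC ltr_pdivrMr// [x * t]mulrC => /ltW.
Unshelve. all: by end_near. Qed.

Hypothesis EI : extremal_index_one Y alpha d.

Lemma EI_max x : 0 < x -> max_cdf n (d n * x) @[n --> \oo] --> expR (- x `^ (- alpha)).
Proof. by move=> x0; have := EI x0; move=> /fine_cvgP[_]. Qed.

(** The extremal index hypothesis speaks of the levels [d n * x] only; a sandwich
    between such levels transfers it to the maximum of any number [m t] of terms
    proportional to [dtilde t]. *)
Lemma max_scaling (m : R -> nat) (c x : R) : 0 < c -> 0 < x ->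
  (m t)%:R / dtilde t @[t --> +oo] --> c ->
  max_cdf (m t) (t * x) @[t --> +oo] --> expR (- (c * x `^ (- alpha))).
Proof.
move=> c0 x0 mc.
(* [z] is the level for which [m t] terms have as many exceedances of [d (m t) * z]
   as of [t * x] on average. *)
pose z := x * c `^ (- alpha^-1).
have z0 : 0 < z by rewrite mulr_gt0// powR_gt0.
have zE : z `^ (- alpha) = c * x `^ (- alpha) by exact: npow_scale.
have moo := truncn_cvg_infty uoo c0 mc.
have lim_t : (m t)%:R * tail (t * x) @[t --> +oo] --> z `^ (- alpha).
  have h : (m t)%:R / dtilde t * (dtilde t * tail (t * x)) @[t --> +oo] -->
      c * x `^ (- alpha) by exact: cvgM mc (tail_scaling x0).
  rewrite zE; apply: cvg_trans h; apply: near_eq_cvg.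
  have := near_gt uoo 0; apply: filterS => t t0; rewrite mulrA divfK ?gt_eqF//.
have lim_d y : 0 < y -> (m t)%:R * tail (d (m t) * y) @[t --> +oo] --> y `^ (- alpha).
  by move=> y0; exact: (cvg_comp _ _ moo (reg_tail y0)).
have lim_max y : 0 < y ->
    max_cdf (m t) (d (m t) * y) @[t --> +oo] --> expR (- y `^ (- alpha)).
  by move=> y0; exact: (cvg_comp _ _ moo (EI_max y0)).
have fcts : {for z, continuous (fun y => expR (- y `^ (- alpha)))}.
  apply: continuous_comp; last exact: continuous_expR.
  by apply: continuousN; exact: npow_cts.
rewrite -zE; apply: squeeze_eps => e e0.
  have [y [zy]] := near_above fcts e0.
  rewrite ltr_norml => /andP[ye _].
  exists (fun t => max_cdf (m t) (d (m t) * y)), (expR (- y `^ (- alpha))).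
  have y0 := lt_trans z0 zy; split; [exact: lim_max|by rewrite -ltrBlDl -opprB ltrNl|].
  have zy' := npow_anti alpha_gt0 z0 zy.
  have [ky kz] := midf_lt zy'; pose k := (y `^ (- alpha) + z `^ (- alpha)) / 2.
  have /cvgr_gt/(_ k) H1 := lim_t; have /cvgr_lt/(_ k) H2 := lim_d _ y0.
  near=> t; apply: max_cdf_mono; apply/ltW/tail_ltP.
  have m0 : 0 < (m t)%:R :> R by rewrite ltr0n; near: t; move: moo => /cvgnyPgt.
  rewrite -(ltr_pM2l m0); apply: (@lt_trans _ _ k).
    by near: t; exact: H2.
  by near: t; exact: H1.
have [y [y0 yz]] := near_below z0 fcts e0.
rewrite ltr_norml => /andP[_ ye].
exists (fun t => max_cdf (m t) (d (m t) * y)), (expR (- y `^ (- alpha))).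
split; [exact: lim_max|by rewrite ltrBlDr -ltrBlDl|].
have zy' := npow_anti alpha_gt0 y0 yz.
have [kz ky] := midf_lt zy'; pose k := (z `^ (- alpha) + y `^ (- alpha)) / 2.
have /cvgr_lt/(_ k) H1 := lim_t; have /cvgr_gt/(_ k) H2 := lim_d _ y0.
near=> t; apply: max_cdf_mono; apply/ltW/tail_ltP.
have m0 : 0 < (m t)%:R :> R by rewrite ltr0n; near: t; move: moo => /cvgnyPgt.
rewrite -(ltr_pM2l m0); apply: (@lt_trans _ _ k).
  by near: t; exact: H1.
by near: t; exact: H2.
Unshelve. all: by end_near. Qed.

End scaling.

End tail_of_process.

(** * Cell counts of the scaled point processes *)

Section block_counts.
Variable R : realType.

Definition hit (n : nat) (t : R) (k : nat) (y : R) : bool :=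
  `[< space_cell n k (y / t)%:E >].

Definition block_count n t k (a b : nat) (y : nat -> R) : nat :=
  (\sum_(a <= i < b) hit n t k (y i.+1))%N.

Lemma scaled_Mp_cell (u t dl : R) (y : nat -> R) n h k :
  0 < u -> 0 <= dl -> (1 < n)%N ->
  scaled_Mp u t y (cell dl n h k) =
  (block_count n t k (Num.truncn (h%:R * dl * u)) (Num.truncn (h.+1%:R * dl * u)) y)%:R%:E.
Proof.
move=> u0 dl0 n1; set a := Num.truncn _; set b := Num.truncn _.
have hdl (j : nat) : 0 <= j%:R * dl * u by rewrite !mulr_ge0// ltW.
have timeE i : (0 < i)%N -> `[< time_cell dl h (i%:R / u) >] = (a < i <= b)%N.
  move=> i0; apply/asboolP/andP => [[_ ih hi]|[ai ib]]; split.
  - case: (posnP h) => [h0|/hi hi'].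
      by rewrite /a h0 !mul0r truncn0.
    by rewrite ltnNge truncn_ge_nat// -ltNge -ltr_pdivlMr.
  - by rewrite truncn_ge_nat// -ler_pdivrMr.
  - by rewrite divr_ge0// ltW.
  - by rewrite ler_pdivrMr// -truncn_ge_nat.
  - move=> h0; rewrite ltr_pdivlMr// ltNge; apply/negP => le.
    by move: ai; rewrite ltnNge truncn_ge_nat// le.
pose v i := ((a < i <= b)%N && hit n t k (y i)) : nat.
rewrite [LHS](scaled_measureE u t y (cell dl n h k)).
transitivity (\sum_(0 <= i <oo) (v i)%:R%:E : \bar R)%E.
  rewrite [LHS]eseries_mkcond; apply: eq_eseriesr => i _.
  rewrite /v; case: (posnP i) => [->|i0]; first by rewrite /scaled_index/= ?ltn0.
  rewrite -timeE//; case: ifPn => [_|].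
    rewrite diracE; congr (_%:R%:E); congr (nat_of_bool _); apply/idP/andP.
      by rewrite inE => -[c1 c2]; split; apply/asboolP.
    by move=> [/asboolP c1 /asboolP c2]; rewrite inE.
  rewrite /scaled_index/= i0 u0 => /asboolPn ns.
  case: andP => // -[/asboolP c1 /asboolP c2]; case: ns.
  exact: (@cell_state R dl n h k n1 (scaled_point u t y i) (conj c1 c2)).
rewrite (@nneseries_split _ _ 0 b.+1)//.
rewrite [X in (_ + X)%E]eseries0; last first.
  by move=> i; rewrite add0n => bi _; rewrite /v [(i <= b)%N]leqNgt bi andbF.
rewrite adde0 add0n.
rewrite sumEFin -natr_sum /block_count; congr (_%:R%:E).
rewrite big_nat_recl// [X in (X + _)%N]/v ltn0 add0n.
have [ab|ba] := leqP a b; last first.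
  rewrite [RHS]big_geq ?(ltnW ba)//; rewrite big_nat big1// => i /andP[_ ib].
  by rewrite /v ltnS leqNgt (leq_trans ib (ltnW ba)).
rewrite (big_cat_nat (leq0n a) ab)/= big_nat big1 ?add0n; last first.
  by move=> i /andP[_ ia]; rewrite /v ltnS leqNgt ia.
by apply: eq_big_nat => i /andP[ai ib]; rewrite /v ltnS ai ib.
Qed.

End block_counts.

(** * States of a block of indices *)

Section block_states.
Variable R : realType.
Implicit Types (n k a b : nat) (t : R) (y : nat -> R).

Definition level n j : R := fine (expand (j%:R / n%:R : R)).

Lemma levelE n j : (j < n)%N -> expand (j%:R / n%:R : R) = (level n j)%:E.
Proof.
move=> jn; have n0 : 0 < n%:R :> R by rewrite ltr0n (leq_ltn_trans _ jn).
by rewrite /level fine_expand// ger0_norm ?divr_ge0 ?(ltW n0)// ltr_pdivrMr// mul1r ltr_nat.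
Qed.

Lemma level_gt0 n j : (0 < j < n)%N -> 0 < level n j.
Proof.
move=> /andP[j0 jn]; have n0 : 0 < n%:R :> R by rewrite ltr0n (leq_ltn_trans _ jn).
rewrite -lte_fin -levelE// lt_expandRL; first by rewrite contract0 divr_gt0// ltr0n.
  by [].
rewrite inE ger0_norm ?divr_ge0 ?(ltW n0)// ler_pdivrMr// mul1r ler_nat; exact: ltnW.
Qed.

Lemma contract_gt_level n j t (y : R) : 0 < t -> (j < n)%N ->
  (j%:R / n%:R < contract (y / t)%:E) = (t * level n j < y).
Proof.
move=> t0 jn; have n0 : 0 < n%:R :> R by rewrite ltr0n (leq_ltn_trans _ jn).
rewrite -lt_expandLR//; last first.
  by rewrite inE ger0_norm ?divr_ge0 ?(ltW n0)// ler_pdivrMr// mul1r ler_nat ltnW.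
by rewrite levelE// lte_fin ltr_pdivlMr// mulrC.
Qed.

Lemma sum_hit n t (y : R) : 0 < t -> (1 < n)%N ->
  (\sum_(k < n.-1) hit n t k y)%N = (t * level n 1 < y).
Proof.
move=> t0 n1; have n0 := ltnW n1.
have [cy|cy] := boolP (t * level n 1 < y); last first.
  rewrite big1// => k _; apply/eqP; rewrite eqb0; apply/asboolPn => /andP[ck _].
  move/negP : cy; apply; rewrite -contract_gt_level//.
  by rewrite (le_lt_trans _ ck)// ler_wpM2r ?invr_ge0// ler_nat.
have [|k kn yk] := @space_cell_cover R n (y / t)%:E n1.
  by have := @contract_gt_level n 1 t y t0 n1; rewrite mulr1n div1r => ->.
rewrite (bigD1 (Ordinal kn))//= /hit asboolT// big1// => i ik.
apply/eqP; rewrite eqb0; apply/asboolPn => yi; move/eqP : ik; apply.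
by apply: val_inj => /=; exact: space_cell_inj n0 yi yk.
Qed.

(** [None] stands for a block without points, [Some k] for a block with a single
    point, in the space cell [k].  Blocks with several points have no state: they are
    rare enough to be discarded. *)
Definition block_state n t a b (s : option 'I_n.-1) y : bool :=
  [forall k : 'I_n.-1, block_count n t k a b y == (s == Some k)].

Definition exceedances n t a b y : nat := (\sum_(a <= i < b) (t * level n 1 < y i.+1)%R)%N.

Lemma sum_block_count n t a b y : 0 < t -> (1 < n)%N ->
  (\sum_(k < n.-1) block_count n t k a b y)%N = exceedances n t a b y.
Proof.
by move=> t0 n1; rewrite exchange_big; apply: eq_bigr => i _; exact: sum_hit.
Qed.

Lemma block_state_None n t a b y : 0 < t -> (1 < n)%N ->
  block_state (n := n) t a b None y = (exceedances n t a b y == 0)%N.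
Proof.
move=> t0 n1; rewrite -sum_block_count// sum_nat_eq0.
by apply: eq_forallb => k.
Qed.

(** A block with [m] exceedances fails to isolate its points only if [m >= 2],
    and then [m - 2 (m - 1) <= 0]. *)
Lemma block_state_Some n t a b y (k : 'I_n.-1) : 0 < t -> (1 < n)%N ->
  (block_count n t k a b y)%:R - 2 * ((exceedances n t a b y)%:R -
     (exceedances n t a b y != 0%N)%:R) <= (block_state t a b (Some k) y)%:R :> R.
Proof.
move=> t0 n1; have := sum_block_count a b y t0 n1; rewrite (bigD1 k)//=.
set m := exceedances _ _ _ _ _; set c := block_count _ _ k _ _ _.
set r := (\sum_(i < n.-1 | i != k) _)%N => crm.
have [m0|m0] := posnP m.
  have c0 : c = 0%N by apply/eqP; rewrite -leqn0 -m0 -crm leq_addr.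
  by rewrite m0 c0 /= subrr mulr0 subr0 ler0n.
have [m1|m1] := eqVneq m 1%N.
  rewrite m1/= subrr mulr0 subr0.
  have [c0|c0] := posnP c; first by rewrite c0.
  have c1 : c = 1%N by apply/eqP; rewrite eqn_leq c0 andbT -m1 -crm leq_addr.
  have r0 : r = 0%N by move: crm; rewrite c1 m1 => -[].
  rewrite c1; have -> // : block_state t a b (Some k) y.
  apply/forallP => i; have [->|ik] := eqVneq i k; first by rewrite eqxx -/c c1.
  have /eqP := r0; rewrite sum_nat_eq0 => /forall_inP/(_ i ik)/eqP ->.
  suff -> : (Some k == Some i) = false by [].
  by apply/eqP => -[ki]; rewrite ki eqxx in ik.
have cm : c%:R <= m%:R :> R by rewrite ler_nat -crm leq_addr.
have m2 : 2 <= m%:R :> R.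
  by rewrite ler_nat; case: m m0 m1 {crm cm} => [|[]].
apply: (@le_trans _ _ 0); last exact: ler0n.
rewrite /=; lra.
Qed.

End block_states.

Section block_measurability.
Context {R : realType} {d : measure_display} {T : measurableType d}.
Variables (X : nat -> T -> R) (n : nat) (t : R) (a b : nat).
Hypothesis mX : forall i, (a <= i < b)%N -> measurable_fun setT (X i.+1).

Lemma measurable_hit (f : T -> R) k : measurable_fun setT f ->
  measurable [set w | hit n t k (f w)].
Proof.
move=> mf; rewrite (_ : mkset _ = (fun w => (f w / t)%:E) @^-1` (space_cell n k)).
  rewrite -[X in measurable X]setTI.
  have mft : measurable_fun setT (fun w => (f w / t)%:E).
    by apply/measurable_EFinP; exact: measurable_funM.
  by apply: mft => //; exact: measurable_slab.
by apply/seteqP; split=> w /asboolP.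
Qed.

Lemma measurable_block_count k : measurable_fun setT
  (fun w => (block_count n t k a b (X ^~ w))%:R : R).
Proof.
rewrite (_ : (fun _ => _) = (fun w => \sum_(a <= i < b)
    \1_[set w | (a <= i < b)%N /\ hit n t k (X i.+1 w)] w)).
  apply: measurable_sum => i; apply: measurable_indic.
  have [iab|iab] := boolP (a <= i < b)%N.
    rewrite (_ : mkset _ = [set w | hit n t k (X i.+1 w)]).
      by apply: measurable_hit; exact: mX.
    by apply/seteqP; split=> w /= => [[]//|].
  rewrite (_ : mkset _ = set0)//.
  by apply/seteqP; split=> w /= => [[]//|].
apply/funext => w; rewrite /block_count natr_sum; apply: eq_big_nat => i iab.
rewrite indicE; congr (nat_of_bool _)%:R.
by apply/idP/idP; rewrite inE /=; [split|case].
Qed.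

Lemma measurable_block_state (s : option 'I_n.-1) :
  measurable [set w | block_state t a b s (X ^~ w)].
Proof.
rewrite (_ : mkset _ = \bigcap_(k in [set: 'I_n.-1])
    (fun w => (block_count n t k a b (X ^~ w))%:R : R) @^-1` [set (s == Some k)%:R]).
  apply: fin_bigcap_measurable; first exact: finite_finset.
  by move=> k _; rewrite -[X in measurable X]setTI; exact: measurable_block_count.
apply/seteqP; split=> w /=.
  by move=> /forallP H k _ /=; rewrite (eqP (H k)).
by move=> H; apply/forallP => k; rewrite -(eqr_nat R); apply/eqP; exact: H.
Qed.

End block_measurability.

Section stationary_blocks.
Context {R : realType} {dT : measure_display} {T : measurableType dT}.
Variables (P : probability T R) (Y : nat -> {RV P >-> R}).
Hypothesis hstat : stationary Y.

Lemma stationary_marginal j (A : set R) : measurable A ->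
  prob P (Y j.+1 @^-1` A) = prob P (Y 1 @^-1` A).
Proof.
move=> mA; rewrite /prob; congr (fine _).
pose B : set (1.-tuple R) := (tnth (T := R))^~ ord0 @^-1` A.
have mB : measurable B by rewrite -[B]setTI; exact: measurable_tnth.
have := hstat j mB; rewrite /pushforward.
have -> : (fun w => [tuple Y (j + i).+1 w | i < 1]) @^-1` B = Y j.+1 @^-1` A.
  by apply/seteqP; split=> w; rewrite /B/= tnth_mktuple addn0.
have -> // : (fun w => [tuple Y i.+1 w | i < 1]) @^-1` B = Y 1 @^-1` A.
by apply/seteqP; split=> w; rewrite /B/= tnth_mktuple.
Qed.

Lemma stationary_max a b (x : R) : (a < b)%N ->
  prob P [set w | forall i, (a <= i < b)%N -> Y i.+1 w <= x] = max_cdf Y (b - a) x.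
Proof.
move=> ab; rewrite /max_cdf /prob; congr (fine _).
pose B : set ((b - a).-tuple R) :=
  \bigcap_(i in [set: 'I_(b - a)]) (tnth (T := R))^~ i @^-1` `]-oo, x]%classic.
have mB : measurable B.
  apply: fin_bigcap_measurable; first exact: finite_finset.
  by move=> i _; rewrite -[X in measurable X]setTI; exact: measurable_tnth.
have := hstat a mB; rewrite /pushforward.
have -> : (fun w => [tuple Y (a + i).+1 w | i < b - a]) @^-1` B =
    [set w | forall i, (a <= i < b)%N -> Y i.+1 w <= x].
  apply/seteqP; split=> w; rewrite /B/= => H i.
    move=> /andP[ai ib]; have iab : (i - a < b - a)%N by rewrite ltn_sub2r.
    by have := H (Ordinal iab) I; rewrite /= in_itv/= tnth_mktuple/= subnKC.
  by move=> _ /=; rewrite in_itv/= tnth_mktuple; apply: H; rewrite leq_addr -ltn_subRL ltn_ord.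
have -> // : (fun w => [tuple Y i.+1 w | i < b - a]) @^-1` B =
    [set w | partial_max Y (b - a) w <= x].
have ba0 : (0 < b - a)%N by rewrite subn_gt0.
apply/seteqP; split=> w; rewrite /B/=.
  move=> H; apply/(partial_max_le Y w x ba0) => -[//|i] /andP[_ ib].
  by have := H (Ordinal ib) I; rewrite /= in_itv/= tnth_mktuple.
move=> /(partial_max_le Y w x ba0) H i _ /=; rewrite in_itv/= tnth_mktuple.
by apply: H => /=; exact: ltn_ord.
Qed.

Lemma stationary_tail j x : prob P [set w | x < Y j.+1 w] = tail Y x.
Proof.
have := @stationary_marginal j `]x, +oo[%classic (measurable_itv _).
rewrite /tail; set A := _ @^-1` _; set B := _ @^-1` _.
rewrite (_ : A = [set w | x < Y j.+1 w]) 1?(_ : B = [set w | x < Y 1 w])//.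
  by apply/seteqP; split=> w; rewrite /B/= in_itv/= andbT.
by apply/seteqP; split=> w; rewrite /A/= in_itv/= andbT.
Qed.

Definition hit_prob n t k : R := prob P [set w | hit n t k (Y 1 w)].

Lemma stationary_hit n t k j : prob P [set w | hit n t k (Y j.+1 w)] = hit_prob n t k.
Proof.
rewrite /hit_prob; apply: (@stationary_marginal j [set y | hit n t k y]).
exact: (@measurable_hit R _ (measurableTypeR R) n t id k (@measurable_id _ _ _)).
Qed.

Lemma exceedances_eq0 n t a b w : exceedances n t a b (Y ^~ w) = 0%N <->
  (forall i, (a <= i < b)%N -> Y i.+1 w <= t * level R n 1).
Proof.
rewrite /exceedances; split=> [/eqP|H].
  rewrite sum_nat_seq_eq0 => /allP H i iab.
  by have := H i; rewrite mem_index_iota iab => /(_ isT)/=; rewrite eqb0 -leNgt.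
by apply: big1_seq => i; rewrite mem_index_iota => /andP[_ /H]; rewrite leNgt => /negbTE ->.
Qed.

Let mY a b (i : nat) : (a <= i < b)%N -> measurable_fun setT (Y i.+1).
Proof. by []. Qed.

Lemma prob_block_None n t a b : 0 < t -> (1 < n)%N -> (a < b)%N ->
  prob P [set w | block_state (n := n) t a b None (Y ^~ w)] =
  max_cdf Y (b - a) (t * level R n 1).
Proof.
move=> t0 n1 ab; rewrite -stationary_max//; congr (prob P _).
apply/seteqP; split=> w /=; rewrite block_state_None//.
  by move=> /eqP/exceedances_eq0.
by move=> /exceedances_eq0/eqP.
Qed.

Lemma mean_sum_indic a b (A : nat -> set T) p : (forall i, measurable (A i)) ->
  (forall i, prob P (A i) = p) ->
  mean P (fun w => \sum_(a <= i < b) \1_(A i) w) = (b - a)%:R * p.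
Proof.
move=> mA pA; rewrite mean_sum; last by move=> i; exact (bounded_measurable_indic (mA i)).
under eq_bigr do rewrite mean_indic// pA.
by rewrite sumr_const_nat mulr_natl.
Qed.

(** The expectation of [block_state_Some]; the only feature of the joint law that it
    involves is the law of the maximum of the block. *)
Lemma prob_block_Some n t a b (k : 'I_n.-1) : 0 < t -> (1 < n)%N -> (a < b)%N ->
  (b - a)%:R * hit_prob n t k - 2 * ((b - a)%:R * tail Y (t * level R n 1) -
     (1 - max_cdf Y (b - a) (t * level R n 1))) <=
  prob P [set w | block_state t a b (Some k) (Y ^~ w)].
Proof.
move=> t0 n1 ab.
have mS s := @measurable_block_state R _ T Y n t a b (mY (a := a) (b := b)) s.
rewrite -(mean_indic P (mS (Some k))) -prob_block_None//.
rewrite -(probC P (mS None)).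
rewrite -(@mean_sum_indic a b (fun i => [set w | hit n t k (Y i.+1 w)])); first last.
- by move=> i; exact: stationary_hit.
- by move=> i; exact: measurable_hit.
rewrite -(@mean_sum_indic a b (fun i => [set w | t * level R n 1 < Y i.+1 w])); first last.
- by move=> i; exact: stationary_tail.
- by move=> i; exact: measurable_gt_RV.
rewrite -(mean_indic P (measurableC (mS None))).
have b1 : bounded_measurable (fun w => \sum_(a <= i < b) \1_[set w | hit n t k (Y i.+1 w)] w : R).
  by apply: bounded_measurable_sum => i; apply: bounded_measurable_indic; exact: measurable_hit.
have b2 : bounded_measurable
    (fun w => \sum_(a <= i < b) \1_[set w | t * level R n 1 < Y i.+1 w] w : R).
  by apply: bounded_measurable_sum => i; apply: bounded_measurable_indic; exact: measurable_gt_RV.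
have b3 := bounded_measurable_indic (R := R) (measurableC (mS None)).
rewrite -meanB// -meanZ; last exact: bounded_measurableB.
rewrite -meanB//; last by apply: bounded_measurableZ; exact: bounded_measurableB.
apply: mean_le.
- by apply: bounded_measurableB => //; apply: bounded_measurableZ; exact: bounded_measurableB.
- exact: bounded_measurable_indic.
move=> w; have := block_state_Some a b (Y ^~ w) k t0 n1.
rewrite /block_count /exceedances !natr_sum !indicE in_setC.
rewrite (_ : (w \in [set w | block_state t a b (Some k) (Y ^~ w)]) =
  block_state t a b (Some k) (Y ^~ w)); last by apply/idP/idP; rewrite inE.
rewrite (_ : (w \in [set w | block_state t a b None (Y ^~ w)]) =
  block_state (n := n) t a b None (Y ^~ w)); last by apply/idP/idP; rewrite inE.
rewrite block_state_None//.
have indicRE (E : pred T) : \1_[set x | E x] w = (E w)%:R :> R.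
  by rewrite indicE; congr (nat_of_bool _)%:R; apply/idP/idP; rewrite inE.
under [X in _ -> X - _ <= _]eq_bigr do rewrite indicRE.
under [X in _ -> _ - _ * (X - _) <= _]eq_bigr do rewrite indicRE.
by [].
Qed.

End stationary_blocks.

(** * Mixing *)

Section mixing.
Context {R : realType} {dT : measure_display} {T : measurableType dT}.
Variables (P : probability T R) (Y : nat -> {RV P >-> R}).

Lemma sigma_gen_mono (J K : set nat) : J `<=` K -> sigma_gen Y J `<=` sigma_gen Y K.
Proof.
move=> JK; apply: smallest_sub; first exact: smallest_sigma_algebra.
by move=> A [j Jj Aj]; apply: sub_sigma_algebra; exists j => //; exact: JK.
Qed.

Lemma sigma_gen_measurable J A : sigma_gen Y J A -> measurable A.
Proof.
suff : sigma_gen Y J `<=` measurable by exact.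
apply: smallest_sub; first exact: sigma_algebra_measurable.
move=> B [j _ [C mC <-]]; rewrite setTI -[X in measurable X]setTI.
by apply: measurable_funP.
Qed.

Lemma sigma_genT J : sigma_gen Y J setT.
Proof. exact: (@measurableT _ (g_sigma_algebraType _)). Qed.

Lemma sigma_genI J A B : sigma_gen Y J A -> sigma_gen Y J B -> sigma_gen Y J (A `&` B).
Proof. exact: (@measurableI _ (g_sigma_algebraType _)). Qed.

Lemma sigma_gen_block_state n t a b (s : option 'I_n.-1) :
  sigma_gen Y [set j | (a < j <= b)%N] [set w | block_state t a b s (Y ^~ w)].
Proof.
pose G := \bigcup_(j in [set j | (a < j <= b)%N]) g_sigma_algebra_preimage (Y j).
apply: (@measurable_block_state R _ (g_sigma_algebraType G) (fun i => Y i : T -> R)).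
move=> i iab _ B mB; apply: sub_sigma_algebra; exists i.+1; first by rewrite /= ltnS.
by exists B.
Qed.

Lemma mixing_le g (eps : R) k (A B : set T) : (mixing_coef Y g <= eps%:E)%E ->
  (0 < k)%N -> sigma_gen Y [set j | (1 <= j <= k)%N] A ->
  sigma_gen Y [set j | (k + g <= j)%N] B ->
  `|prob P (A `&` B) - prob P A * prob P B| <= eps.
Proof.
move=> geps k0 sA sB.
have mA := sigma_gen_measurable sA; have mB := sigma_gen_measurable sB.
rewrite -lee_fin.
have -> : `|prob P (A `&` B) - prob P A * prob P B|%:E =
    `|P (A `&` B) - P A * P B|%E by rewrite !probE//; exact: measurableI.
apply: le_trans geps; apply: ereal_sup_ubound; exists k, A, B; split => //.
Qed.

(** The mixing inequality is used once per block, between this block and the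
    intersection of all the preceding ones. *)
Lemma mixing_prod g (eps : R) (E : nat -> set T) (b : nat -> nat) H : 0 <= eps ->
  (mixing_coef Y g <= eps%:E)%E ->
  (forall h, (h < H)%N -> (0 < b h)%N) ->
  {homo b : h k / (h <= k)%N} ->
  (forall h, (h < H)%N -> sigma_gen Y [set j | (1 <= j <= b h)%N] (E h)) ->
  (forall h, (h.+1 < H)%N -> sigma_gen Y [set j | (b h + g <= j)%N] (E h.+1)) ->
  `|prob P (\big[setI/setT]_(h < H) E h) - \prod_(h < H) prob P (E h)| <= H%:R * eps.
Proof.
move=> eps0 geps; elim: H => [|H IH] b0 bmono past future.
  by rewrite !big_ord0 /prob probability_setT/= subrr normr0 mul0r.
have {}IH := IH (fun h hH => b0 h (ltnW hH)) bmono
  (fun h hH => past h (ltnW hH)) (fun h hH => future h (ltnW hH)).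
rewrite !big_ord_recr/=.
have mE : measurable (E H) by exact: sigma_gen_measurable (past H (ltnSn H)).
set A := \big[setI/setT]_(h < H) E h; set p := \prod_(h < H) _.
have pE : `|prob P (E H)| <= 1 by rewrite ger0_norm ?prob_ge0// prob_le1.
have mix : `|prob P (A `&` E H) - prob P A * prob P (E H)| <= eps.
  case: H {IH p} @A b0 bmono past future mE pE => [|H] A b0 bmono past future mE pE.
    by rewrite /A big_ord0 setTI /prob probability_setT/= mul1r subrr normr0.
  apply: (mixing_le geps (b0 H (ltnW (ltnSn _)))); last exact: future.
  rewrite /A; elim/big_ind : _; [exact: sigma_genT|exact: sigma_genI|].
  move=> h _; apply: sigma_gen_mono (past _ (ltnW (ltn_ord h))) => j /= /andP[-> /=].
  move=> jb; apply: (leq_trans jb).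
  by apply: bmono; rewrite -ltnS ltn_ord.
rewrite (_ : _ - _ = (prob P (A `&` E H) - prob P A * prob P (E H)) +
  (prob P A - p) * prob P (E H)); last by ring.
have -> : H.+1%:R * eps = eps + H%:R * eps by rewrite -[H.+1%:R]natr1; ring.
rewrite (le_trans (ler_normD _ _))// lerD//.
by rewrite normrM (le_trans _ IH)// ler_piMr.
Qed.

End mixing.

(** * Lower bounds for the block configurations of the sequence *)

Section config_lower_bound.
Context {R : realType} {dT : measure_display} {T : measurableType dT}.
Variables (P : probability T R) (Y : nat -> {RV P >-> R}).
Variables (alpha : R) (d : nat -> R) (dtilde : R -> R).
Variable mu : {measure set (\bar R) -> \bar R}.
Hypothesis halpha : 0 < alpha.
Hypothesis hstat : stationary Y.
Hypothesis hmix : strongly_mixing Y.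
Hypothesis hreg : regularly_varying Y alpha d.
Hypothesis hdtilde : asymptotic_inverse (step_extension d) dtilde.
Hypothesis hmu : forall x : R, 0 < x ->
  mu [set y : \bar R | (x%:E < y)%E] = (x `^ (- alpha))%:E.
Hypothesis EI : extremal_index_one Y alpha d.

Let uoo : dtilde t @[t --> +oo] --> +oo := dtilde_cvg_infty hdtilde.1.

Definition upper (n j : nat) : set (\bar R) := [set y | j%:R / n%:R < contract y].

Lemma upper_top n : (0 < n)%N -> upper n n = set0.
Proof.
move=> n0; apply/seteqP; split=> y //; rewrite /upper/= divff ?pnatr_eq0 -?lt0n//.
by rewrite ltNge (le_trans (ler_norm _) (contract_le1 y)).
Qed.

Lemma upper_level n j : (0 < j < n)%N -> upper n j = [set y | ((level R n j)%:E < y)%E].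
Proof.
move=> /andP[j0 jn]; have n0 : 0 < n%:R :> R by rewrite ltr0n (leq_ltn_trans _ jn).
rewrite /upper -levelE//; apply/seteqP; split=> y /=; rewrite lt_expandLR//;
  by rewrite inE ger0_norm ?divr_ge0 ?(ltW n0)// ler_pdivrMr// mul1r ler_nat ltnW.
Qed.

Definition level_mass n j : R := fine (mu (upper n j)).
Definition cell_mass n k : R := fine (mu (space_cell n k)).

Lemma mu_upper n j : (1 < n)%N -> (0 < j <= n)%N -> mu (upper n j) = (level_mass n j)%:E.
Proof.
move=> n1 /andP[j0]; rewrite leq_eqVlt => /orP[/eqP->|jn].
  by rewrite /level_mass upper_top ?measure0// ltnW.
by rewrite /level_mass upper_level ?j0// hmu// level_gt0// j0.
Qed.

Lemma space_cellE n k : space_cell n k = upper n k.+1 `\` upper n k.+2.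
Proof. exact: slabE. Qed.

Lemma upperS n j : upper n j.+1 `<=` upper n j.
Proof.
by move=> y; apply: le_lt_trans; rewrite ler_wpM2r ?invr_ge0// ler_nat.
Qed.

Lemma measurable_upper n j : measurable (upper n j).
Proof. exact: measurable_contract_gt. Qed.

Lemma cell_massE n k : (k < n.-1)%N ->
  mu (space_cell n k) = (cell_mass n k)%:E /\
  cell_mass n k = level_mass n k.+1 - level_mass n k.+2.
Proof.
move=> kn; have n1 : (1 < n)%N by case: n kn => [|[]].
have kn2 : (k.+2 <= n)%N by case: n kn n1 => [|[]].
have E : mu (space_cell n k) = (level_mass n k.+1 - level_mass n k.+2)%:E.
  have fin : (mu (upper n k.+1) < +oo)%E by rewrite mu_upper ?ltry//= (ltnW kn2).
  have [m1 m2] := (measurable_upper n k.+1, measurable_upper n k.+2).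
  have D : (mu (upper n k.+1 `\` upper n k.+2) =
      mu (upper n k.+1) - mu (upper n k.+1 `&` upper n k.+2))%E by exact: measureD.
  rewrite space_cellE D setIidr; last exact: upperS.
  by rewrite !mu_upper//= (ltnW kn2).
by rewrite /cell_mass E.
Qed.

Lemma cell_mass_ge0 n k : 0 <= cell_mass n k.
Proof. exact: fine_ge0. Qed.

Lemma sum_cell_mass n : (1 < n)%N -> \sum_(k < n.-1) cell_mass n k = level_mass n 1.
Proof.
move=> n1; under eq_bigr do rewrite (cell_massE (ltn_ord _)).2.
rewrite -(big_mkord xpredT (fun k => level_mass n k.+1 - level_mass n k.+2)).
have := telescope_sumr (fun k => - level_mass n k.+1) (leq0n n.-1).
have Ln : level_mass n n = 0 by rewrite /level_mass upper_top ?measure0// ltnW.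
rewrite prednK ?(ltnW n1)// Ln oppr0 add0r opprK => <-.
by apply: eq_bigr => k _; rewrite opprK addrC.
Qed.

Lemma upper_scaling n j : (1 < n)%N -> (0 < j <= n)%N ->
  dtilde t * prob P [set w | upper n j (Y 1 w / t)%:E] @[t --> +oo] --> level_mass n j.
Proof.
move=> n1 /andP[j0]; rewrite leq_eqVlt => /orP[/eqP->|jn].
  rewrite /level_mass upper_top ?(ltnW n1)// measure0/=.
  under eq_fun do rewrite (_ : mkset _ = set0)// /prob measure0/= mulr0.
  exact: cvg_cst.
have l0 : 0 < level R n j by rewrite level_gt0// j0.
rewrite /level_mass upper_level ?j0// hmu//=.
apply: cvg_trans (tail_scaling hreg hdtilde l0); apply: near_eq_cvg.
near=> t; congr (_ * prob P _).
have t0 : 0 < t by near: t; exact: nbhs_pinfty_gt (num_real _).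
by apply/seteqP; split=> w /=; rewrite lte_fin ltr_pdivlMr// mulrC.
Unshelve. all: by end_near. Qed.

Lemma measurable_upper_Y n j t : measurable [set w | upper n j (Y 1 w / t)%:E].
Proof.
rewrite (_ : mkset _ = (fun w => (Y 1 w / t)%:E) @^-1` (upper n j))//.
rewrite -[X in measurable X]setTI.
have mf : measurable_fun setT (fun w => (Y 1 w / t)%:E).
  by apply/measurable_EFinP; exact: measurable_funM.
by apply: mf => //; exact: measurable_upper.
Qed.

Lemma hit_scaling n k : (k < n.-1)%N ->
  dtilde t * hit_prob Y n t k @[t --> +oo] --> cell_mass n k.
Proof.
move=> kn; have n1 : (1 < n)%N by case: n kn => [|[]].
have kn2 : (k.+2 <= n)%N by case: n kn n1 => [|[]].
rewrite (cell_massE kn).2.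
have E t : dtilde t * hit_prob Y n t k =
    dtilde t * prob P [set w | upper n k.+1 (Y 1 w / t)%:E] -
    dtilde t * prob P [set w | upper n k.+2 (Y 1 w / t)%:E].
  rewrite -mulrBr; congr (_ * _).
  have -> : hit_prob Y n t k = prob P ([set w | upper n k.+1 (Y 1 w / t)%:E] `\`
      [set w | upper n k.+2 (Y 1 w / t)%:E]).
    rewrite /hit_prob; congr (prob P _); apply/seteqP; split=> w /=.
      by move=> /asboolP; rewrite space_cellE.
    by move=> H; apply/asboolP; rewrite space_cellE.
  apply: EFin_inj; rewrite EFinB -!probE; try exact: measurable_upper_Y; last first.
    by apply: measurableD; exact: measurable_upper_Y.
  have [m1 m2] := (measurable_upper_Y n k.+1 t, measurable_upper_Y n k.+2 t).
  have fin : (P [set w | upper n k.+1 (Y 1 w / t)%:E] < +oo)%E.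
    by rewrite ltey_eq fin_num_measure.
  by rewrite measureD// setIidr// => w /=; exact: upperS.
under eq_fun do rewrite E.
by apply: cvgB; apply: upper_scaling => //; exact: ltnW.
Qed.

(** End points of the blocks of indices [i] with [i / dtilde t] in the [h]-th time
    cell of length [dl]; the last [g] indices of each block are given up. *)
Definition block_start dl t h := Num.truncn (h%:R * dl * dtilde t).
Definition block_stop dl g t h := (block_start dl t h.+1 - g)%N.

Lemma block_start_ratio dl h : 0 <= dl ->
  (block_start dl t h)%:R / dtilde t @[t --> +oo] --> h%:R * dl.
Proof. by move=> dl0; apply: truncn_ratio => //; rewrite mulr_ge0. Qed.

Lemma block_gap dl g h : 0 < dl ->
  \forall t \near +oo, (block_start dl t h + g < block_start dl t h.+1)%N.
Proof.
move=> dl0; near=> t.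
have ut : (g%:R + 2) / dl < dtilde t by near: t; exact: near_gt.
rewrite ltr_pdivrMr// in ut.
have u0 : 0 < dtilde t by near: t; exact: near_gt.
rewrite /block_start truncn_gt_nat.
have : (Num.truncn (h%:R * dl * dtilde t))%:R <= h%:R * dl * dtilde t.
  by rewrite truncn_le !mulr_ge0// ltW.
rewrite -[h.+1]addn1 -[X in X%:R <= _ -> _]addn0 -addnS !natrD !mulrDl !mul1r.
lra.
Unshelve. all: by end_near. Qed.

Lemma block_length_ratio dl g h : 0 < dl ->
  (block_stop dl g t h - block_start dl t h)%:R / dtilde t @[t --> +oo] --> dl.
Proof.
move=> dl0.
have c1 : (block_start dl t h.+1)%:R / dtilde t @[t --> +oo] --> h.+1%:R * dl.
  exact: block_start_ratio (ltW dl0).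
have c0 : (block_start dl t h)%:R / dtilde t @[t --> +oo] --> h%:R * dl.
  exact: block_start_ratio (ltW dl0).
have cg : g%:R / dtilde t @[t --> +oo] --> (0 : R).
  rewrite -[X in _ --> X](mulr0 g%:R); apply: cvgMr.
  by apply/gtr0_cvgV0; [exact: near_gt|exact: uoo].
have : (block_start dl t h.+1)%:R / dtilde t - (block_start dl t h)%:R / dtilde t -
    g%:R / dtilde t @[t --> +oo] --> h.+1%:R * dl - h%:R * dl - 0.
  by apply: cvgB => //; exact: cvgB.
rewrite subr0 -mulrBl -natrB// subSnn mul1r; apply: cvg_trans; apply: near_eq_cvg.
have := block_gap g h dl0; apply: filterS => t gap.
rewrite /block_stop -subnDA natrB; last by rewrite addnC ltnW.
by rewrite natrD -!mulrBl; congr (_ / _); ring.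
Qed.

Let lam n := level_mass n 1.

Lemma level_mass1 n : (1 < n)%N -> lam n = level R n 1 `^ (- alpha).
Proof. by move=> n1; rewrite /lam /level_mass upper_level// hmu// level_gt0. Qed.

(** For [Some k] this is the limit of the lower bound of [prob_block_Some], which
    differs from the limit law by a term of order [dl ^+ 2]. *)
Definition block_limit n dl (s : option 'I_n.-1) : R :=
  if s is Some k then dl * cell_mass n k - 2 * (dl * lam n - (1 - expR (- (dl * lam n))))
  else expR (- (dl * lam n)).

(** This is where the extremal index is used: it gives the limit of the probability
    that a block has no exceedance. *)
Lemma block_prob_ge n dl g h (s : option 'I_n.-1) (e : R) :
  (1 < n)%N -> 0 < dl -> 0 < e -> \forall t \near +oo,
    block_limit dl s - e <=
    prob P [set w | block_state t (block_start dl t h) (block_stop dl g t h) s (Y ^~ w)].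
Proof.
move=> n1 dl0 e0.
have l0 : 0 < level R n 1 by exact: level_gt0.
have len := block_length_ratio g h dl0.
have cmax : max_cdf Y (block_stop dl g t h - block_start dl t h) (t * level R n 1)
    @[t --> +oo] --> expR (- (dl * lam n)).
  by rewrite level_mass1//; exact: (max_scaling halpha hreg hdtilde EI dl0 l0 len).
have cvg_len (f : R -> R) l : dtilde t * f t @[t --> +oo] --> l ->
    (block_stop dl g t h - block_start dl t h)%:R * f t @[t --> +oo] --> dl * l.
  move=> fl; have : (block_stop dl g t h - block_start dl t h)%:R / dtilde t *
    (dtilde t * f t) @[t --> +oo] --> dl * l by exact: cvgM len fl.
  apply: cvg_trans; apply: near_eq_cvg.
  by have := near_gt uoo 0; apply: filterS => t u0; rewrite mulrA divfK ?gt_eqF.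
have gap0 := block_gap g h dl0.
case: s => [k|].
  have ctail := cvg_len _ _ (tail_scaling hreg hdtilde l0).
  rewrite -level_mass1// in ctail.
  have chit := cvg_len _ _ (hit_scaling (ltn_ord k)).
  pose len_ t := (block_stop dl g t h - block_start dl t h)%N.
  have : (len_ t)%:R * hit_prob Y n t k - 2 * ((len_ t)%:R * tail Y (t * level R n 1) -
      (1 - max_cdf Y (len_ t) (t * level R n 1))) @[t --> +oo] -->
      block_limit dl (Some k).
    apply: cvgB => //; apply: cvgM; first exact: cvg_cst.
    by apply: cvgB => //; apply: cvgB => //; exact: cvg_cst.
  move=> /cvgrPdist_le/(_ _ e0) C; near=> t.
  have t0 : 0 < t by near: t; exact: nbhs_pinfty_gt (num_real _).
  have ab : (block_start dl t h < block_stop dl g t h)%N.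
    by rewrite /block_stop ltn_subRL addnC; near: t.
  apply: le_trans (prob_block_Some hstat k t0 n1 ab).
  have := near C t; rewrite ler_norml => /(_ _)/andP[//|_].
  by rewrite lerBlDr -lerBlDl.
have /cvgrPdist_le/(_ _ e0) C := cmax.
near=> t.
have t0 : 0 < t by near: t; exact: nbhs_pinfty_gt (num_real _).
have ab : (block_start dl t h < block_stop dl g t h)%N.
  by rewrite /block_stop ltn_subRL addnC; near: t.
rewrite prob_block_None//.
have := near C t; rewrite ler_norml => /(_ _)/andP[//|_].
by rewrite lerBlDr -lerBlDl.
Unshelve. all: by end_near. Qed.

End config_lower_bound.

Section independent_configurations.
Context {R : realType} {dT : measure_display} {T : measurableType dT}.
Variables (P : probability T R) (Y : nat -> {RV P >-> R}).
Variables (alpha : R) (d : nat -> R) (dtilde : R -> R).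
Variable mu : {measure set (\bar R) -> \bar R}.
Hypothesis halpha : 0 < alpha.
Hypothesis hstat : stationary Y.
Hypothesis hmix : strongly_mixing Y.
Hypothesis hreg : regularly_varying Y alpha d.
Hypothesis hdtilde : asymptotic_inverse (step_extension d) dtilde.
Hypothesis hmu : forall x : R, 0 < x ->
  mu [set y : \bar R | (x%:E < y)%E] = (x `^ (- alpha))%:E.
Hypothesis EI : extremal_index_one Y alpha d.

Let uoo : dtilde t @[t --> +oo] --> +oo := dtilde_cvg_infty hdtilde.1.

Lemma block_start_mono dl t : 0 <= dl -> 0 <= dtilde t ->
  {homo block_start dtilde dl t : h k / (h <= k)%N}.
Proof.
by move=> dl0 u0 h k hk; apply: le_truncn; rewrite !ler_wpM2r// ler_nat.
Qed.

Lemma exists_gap (eps : R) : 0 < eps -> exists g, (mixing_coef Y g <= eps%:E)%E.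
Proof.
move=> eps0; have /fine_cvgP[fin /cvgrPdist_le/(_ _ eps0) small] := hmix.
have [g []] := filter_ex (filterI fin small).
rewrite /= sub0r normrN => gfin gle; exists g.
by rewrite -(fineK gfin) lee_fin (le_trans (ler_norm _)).
Qed.

(** The blocks [block_start t h, block_start t h.+1) can be cut short by a gap [g]
    unless one of the discarded indices carries an exceedance. *)
Lemma config_cut n dl g H t (s : 'I_H -> option 'I_n.-1) : 0 < t -> (1 < n)%N ->
  (forall h, (h < H)%N ->
     (block_start dtilde dl t h + g < block_start dtilde dl t h.+1)%N) ->
  prob P (\bigcap_(h in [set: 'I_H]) [set w | block_state t (block_start dtilde dl t h)
     (block_stop dtilde dl g t h) (s h) (Y ^~ w)])
  - H%:R * (g%:R * tail Y (t * level R n 1)) <=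
  prob P [set w | forall h : 'I_H, block_state t (block_start dtilde dl t h)
     (block_start dtilde dl t h.+1) (s h) (Y ^~ w)].
Proof.
move=> t0 n1 gap.
set A := \bigcap_(_ in _) _; set C := [set w | _].
have mS a b s' : measurable [set w | block_state (n := n) t a b s' (Y ^~ w)].
  by apply: (@measurable_block_state R _ T (fun i => Y i : T -> R)) => i _.
have mA : measurable A.
  by apply: fin_bigcap_measurable; [exact: finite_finset|move=> h _; exact: mS].
have mC : measurable C.
  rewrite (_ : C = \bigcap_(h in [set: 'I_H]) [set w | block_state t
     (block_start dtilde dl t h) (block_start dtilde dl t h.+1) (s h) (Y ^~ w)]).
    by apply: fin_bigcap_measurable; [exact: finite_finset|move=> h _; exact: mS].
  by apply/seteqP; split=> w /= => [Hw h _|Hw h]; [exact: Hw|exact: Hw h I].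
pose E i := [set w | t * level R n 1 < Y i.+1 w].
have mE i : measurable (E i) by exact: measurable_gt_RV.
pose G (w : T) : R := \sum_(h < H)
  \sum_(block_stop dtilde dl g t h <= i < block_start dtilde dl t h.+1) \1_(E i) w.
have bG : bounded_measurable G.
  apply: bounded_measurable_sum => h; apply: bounded_measurable_sum => i.
  exact: bounded_measurable_indic.
have meanG : mean P G = H%:R * (g%:R * tail Y (t * level R n 1)).
  rewrite /G mean_sum; last first.
    move=> h; apply: bounded_measurable_sum => i; exact: bounded_measurable_indic.
  rewrite (eq_bigr (fun=> g%:R * tail Y (t * level R n 1))) => [|h _].
    by rewrite sumr_const card_ord [RHS]mulr_natl.
  rewrite (@mean_sum_indic _ _ _ P _ _ E (tail Y (t * level R n 1)))//.
    congr (_%:R * _); rewrite /block_stop subKn//.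
    by apply: ltnW; apply: leq_ltn_trans (gap _ (ltn_ord h)); rewrite leq_addl.
  by move=> i; exact: stationary_tail.
rewrite -meanG -(mean_indic P mA) -(mean_indic P mC) -meanB//; last first.
  exact: bounded_measurable_indic.
apply: mean_le.
- by apply: bounded_measurableB => //; exact: bounded_measurable_indic.
- exact: bounded_measurable_indic.
move=> w; have G0 h : 0 <= \sum_(block_stop dtilde dl g t h <= i <
    block_start dtilde dl t h.+1) \1_(E i) w :> R by apply: sumr_ge0.
rewrite indicE; case: (boolP (w \in A)) => [/set_mem wA|_] /=; last first.
  by rewrite sub0r (@le_trans _ _ 0)// oppr_le0; apply: sumr_ge0.
have [[h [i [hi Ei]]]|noE] := pselect (exists h : 'I_H, exists i,
   (block_stop dtilde dl g t h <= i < block_start dtilde dl t h.+1)%N /\ E i w).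
  apply: (@le_trans _ _ 0) => //; rewrite subr_le0 /G (bigD1 h)//=.
  rewrite -[leLHS]addr0 lerD//; last by apply: sumr_ge0.
  have iin : i \in index_iota (block_stop dtilde dl g t h) (block_start dtilde dl t h.+1).
    by rewrite mem_index_iota.
  rewrite (bigD1_seq i)//= ?iota_uniq// indicE mem_set// lerDl.
  by apply: sumr_ge0.
have wC : C w.
  move=> h; apply/forallP => k; have /forallP/(_ k)/eqP <- := wA h I.
  apply/eqP; rewrite /block_count.
  have st : (block_start dtilde dl t h <= block_stop dtilde dl g t h)%N.
    by rewrite /block_stop leq_subRL; [rewrite addnC ltnW// gap|
      rewrite ltnW// (leq_ltn_trans (leq_addl _ _) (gap _ (ltn_ord h)))].
  rewrite (big_cat_nat st)/= ?leq_subr// -[RHS]addn0; congr (_ + _)%N.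
  apply: big1_seq => i; rewrite mem_index_iota => /andP[_ iab].
  have nE : ~ E i w by move=> Ei; apply: noE; exists h, i.
  have := @sum_hit R n t (Y i.+1 w) t0 n1; move/negP : nE => /negbTE ->.
  by move=> /eqP; rewrite sum_nat_eq0 => /forallP/(_ k)/eqP.
by rewrite indicE mem_set// lerBlDr lerDl; apply: sumr_ge0.
Qed.

Lemma tail_cvg0 (x : R) : 0 < x -> tail Y (t * x) @[t --> +oo] --> (0 : R).
Proof.
move=> x0; have u1 : (dtilde t)^-1 @[t --> +oo] --> (0 : R).
  by apply/gtr0_cvgV0; [exact: near_gt|exact: uoo].
have : (dtilde t)^-1 * (dtilde t * tail Y (t * x)) @[t --> +oo] --> 0 * x `^ (- alpha).
  exact: cvgM u1 (tail_scaling hreg hdtilde x0).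
rewrite mul0r; apply: cvg_trans; apply: near_eq_cvg.
by have := near_gt uoo 0; apply: filterS => t u0; rewrite mulKf ?gt_eqF.
Qed.

(** The number [H] of blocks is fixed while their length tends to infinity.  So a gap
    of fixed length [g], chosen first to make the mixing error small, costs nothing in
    the limit: the expected number of exceedances in the gaps tends to 0. *)
Lemma config_prob_ge n dl H (s : 'I_H -> option 'I_n.-1) (r : option 'I_n.-1 -> R)
    (e : R) : (1 < n)%N -> 0 < dl -> 0 < e ->
  (forall x, r x = 0 \/ 0 <= r x < block_limit mu dl x) ->
  \forall t \near +oo, \prod_(h < H) r (s h) - e <=
    prob P [set w | forall h : 'I_H, block_state t (block_start dtilde dl t h)
     (block_start dtilde dl t h.+1) (s h) (Y ^~ w)].
Proof.
move=> n1 dl0 e0 rP; have l0 : 0 < level R n 1 by exact: level_gt0.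
have r0 x : 0 <= r x by case: (rP x) => [->//|/andP[]].
have H1 : 0 < 2 * (H%:R + 1) :> R by rewrite mulr_gt0// ltr_wpDl.
pose eps := e / (2 * (H%:R + 1)).
have eps0 : 0 < eps by rewrite divr_gt0.
have Heps : H%:R * eps <= e / 2.
  have H0 : 0 < H%:R + 1 :> R by rewrite ltr_wpDl.
  have -> : H%:R * eps = (e / 2) * (H%:R / (H%:R + 1)).
    by rewrite /eps; field; rewrite gt_eqF.
  by rewrite ler_piMr ?divr_ge0 ?(ltW e0)// ler_pdivrMr// mul1r lerDl.
have [g geps] := exists_gap eps0.
have gap_h (h : 'I_H) : \forall t \near +oo,
    (block_start dtilde dl t h + g < block_start dtilde dl t h.+1)%N.
  exact (block_gap hdtilde g h dl0).
have block_h (h : 'I_H) : \forall t \near +oo, r (s h) <= prob P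
   [set w | block_state t (block_start dtilde dl t h) (block_stop dtilde dl g t h) (s h) (Y ^~ w)].
  case: (rP (s h)) => [->|/andP[_ rl]]; first by apply: nearW => t; exact: prob_ge0.
  have e'0 : 0 < block_limit mu dl (s h) - r (s h) by rewrite subr_gt0.
  have := block_prob_ge halpha hstat hreg hdtilde hmu EI g h (s h) n1 dl0 e'0.
  by apply: filterS => t; rewrite subKr.
have gaps : \forall t \near +oo, forall h : 'I_H,
    (block_start dtilde dl t h + g < block_start dtilde dl t h.+1)%N.
  exact: (filter_forall _ gap_h).
have blocks : \forall t \near +oo, forall h : 'I_H, r (s h) <= prob P [set w |
    block_state t (block_start dtilde dl t h) (block_stop dtilde dl g t h) (s h) (Y ^~ w)].
  exact: (filter_forall _ block_h).
have e20 : 0 < e / 2 by rewrite divr_gt0.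
have small : \forall t \near +oo, H%:R * (g%:R * tail Y (t * level R n 1)) <= e / 2.
  have : H%:R * (g%:R * tail Y (t * level R n 1)) @[t --> +oo] -->
      (H%:R * (g%:R * 0) : R).
    by apply: cvgM; [exact: cvg_cst|apply: cvgM; [exact: cvg_cst|exact: tail_cvg0]].
  by rewrite !mulr0 => /cvgr_le; apply.
near=> t.
have t0 : 0 < t by near: t; exact: nbhs_pinfty_gt (num_real _).
have u0 : 0 < dtilde t by near: t; exact: near_gt.
have gap : forall h : 'I_H, (block_start dtilde dl t h + g < block_start dtilde dl t h.+1)%N.
  by near: t.
have block : forall h : 'I_H, r (s h) <= prob P [set w | block_state t
    (block_start dtilde dl t h) (block_stop dtilde dl g t h) (s h) (Y ^~ w)] by near: t.
have tl : H%:R * (g%:R * tail Y (t * level R n 1)) <= e / 2 by near: t.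
have gap' h : (h < H)%N -> (block_start dtilde dl t h + g < block_start dtilde dl t h.+1)%N.
  by move=> hH; exact: gap (Ordinal hH).
apply: le_trans (config_cut s t0 n1 gap').
pose s' h := if insub h is Some i then s i else None.
pose E h := [set w | block_state t (block_start dtilde dl t h)
  (block_stop dtilde dl g t h) (s' h) (Y ^~ w)].
have s'E (h : 'I_H) : s' h = s h by rewrite /s' valK.
have -> : \bigcap_(h in [set: 'I_H]) [set w | block_state t (block_start dtilde dl t h)
     (block_stop dtilde dl g t h) (s h) (Y ^~ w)] = \big[setI/setT]_(h < H) E h.
  rewrite -bigcap_mkord; apply/seteqP; split=> w Hw h /=.
    by move=> hH; have := Hw (Ordinal hH) I; rewrite /E/= -(s'E (Ordinal hH)).
  by move=> _; have := Hw h (ltn_ord h); rewrite /E/= s'E.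
have bmono : {homo (fun h => block_stop dtilde dl g t h) : h k / (h <= k)%N}.
  by move=> h k hk; apply: leq_sub2r; apply: block_start_mono; rewrite ?ltW.
have stop_pos h : (h < H)%N -> (0 < block_stop dtilde dl g t h)%N.
  by move=> /gap' hg; rewrite /block_stop subn_gt0 (leq_ltn_trans (leq_addl _ _) hg).
have past h : (h < H)%N -> sigma_gen Y [set j | (1 <= j <= block_stop dtilde dl g t h)%N] (E h).
  move=> hH; apply: sigma_gen_mono (@sigma_gen_block_state _ _ _ _ Y n t _ _ (s' h)).
  by move=> j /= /andP[aj ->]; rewrite andbT (leq_ltn_trans (leq0n _) aj).
have future h : (h.+1 < H)%N ->
    sigma_gen Y [set j | (block_stop dtilde dl g t h + g <= j)%N] (E h.+1).
  move=> hH; apply: sigma_gen_mono (@sigma_gen_block_state _ _ _ _ Y n t _ _ (s' h.+1)).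
  move=> j /= /andP[aj _]; rewrite /block_stop subnK ?(ltnW aj)//.
  exact: leq_trans (leq_addl _ _) (ltnW (gap' h (ltnW hH))).
have := mixing_prod (ltW eps0) geps stop_pos bmono past future.
rewrite ler_norml => /andP[mix _].
have : \prod_(h < H) r (s h) <= \prod_(h < H) prob P (E h).
  by apply: ler_prod => h _; rewrite r0 /E s'E block.
lra.
Unshelve. all: by end_near. Qed.

End independent_configurations.

(** * Block configurations of the Poisson random measure *)

Section poisson_configurations.
Context {R : realType} {d' : measure_display} {T' : measurableType d'}.
Variables (Q : probability T' R) (N : T' -> Mp R).
Variables (alpha : R) (mu : {measure set (\bar R) -> \bar R}).
Hypothesis hmu : forall x : R, 0 < x ->
  mu [set y : \bar R | (x%:E < y)%E] = (x `^ (- alpha))%:E.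
Hypothesis hN : poisson_random_measure Q N (@lebesgue_measure R \x mu)%E.

Lemma product_measure_rectangle (A : set R) (B : set (\bar R)) (a b : R) :
  measurable A -> (lebesgue_measure A = a%:E) -> mu B = b%:E ->
  (@lebesgue_measure R \x mu)%E (A `*` B) = (a * b)%:E.
Proof.
move=> mA lA mB; rewrite /product_measure1.
transitivity (\int[@lebesgue_measure R]_x (b%:E * (\1_A x)%:E))%E.
  apply: eq_integral => x _ /=; rewrite indicE; have [xA|xA] := boolP (x \in A).
    by rewrite in_xsectionX// mB mule1.
  by rewrite notin_xsectionX// measure0 mule0.
rewrite ge0_integralZl//.
- by rewrite integral_indic// setIT muleC EFinM -lA.
- by apply/measurable_EFinP; exact: measurable_indic.
- by rewrite -mB measure_ge0.
Qed.

Lemma intensity_cell dl n h k : 0 <= dl -> (k < n.-1)%N ->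
  (@lebesgue_measure R \x mu)%E (cell dl n h k) = (dl * cell_mass mu n k)%:E.
Proof.
move=> dl0 kn; apply: product_measure_rectangle.
- exact: measurable_time_cell.
- exact: lebesgue_time_cell.
- exact: (cell_massE hmu kn).1.
Qed.

Definition config_event n dl H (s : 'I_H -> option 'I_n.-1) (m : Mp R) : Prop :=
  forall (h : 'I_H) (k : 'I_n.-1), npoints m (cell dl n h k) = (s h == Some k).

Definition block_poisson n dl (s : option 'I_n.-1) : R :=
  expR (- (dl * level_mass mu n 1)) * (if s is Some k then dl * cell_mass mu n k else 1).

(** The cells are disjoint, so the counts are independent Poisson variables, and the
    exponential factors of the space cells of one block multiply to that of their
    union. *)
Lemma poisson_config n dl H (s : 'I_H -> option 'I_n.-1) : (1 < n)%N -> 0 <= dl ->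
  prob Q [set w | config_event dl s (N w)] = \prod_(h < H) block_poisson dl (s h).
Proof.
move=> n1 dl0; have [_ pmf _ indep] := hN.
pose J := ('I_H * 'I_n.-1)%type.
pose A (i : 'I_#|{: J}|) := cell dl n (enum_val i).1 (enum_val i).2.
pose v (p : J) : nat := s p.1 == Some p.2.
have mA i : measurable (A i) /\ A i `<=` @state_space R.
  by split; [exact: measurable_cell|exact: cell_state].
have tA : trivIset setT A.
  apply/trivIsetP => i j _ _ ij; apply/seteqP; split=> // z [[zi1 zi2] [zj1 zj2]].
  case/negP: ij; apply/eqP/enum_val_inj.
  case: (enum_val i) (enum_val j) zi1 zi2 zj1 zj2 => [a b] [c e]/= ac be ca eb.
  congr (_, _); apply: val_inj => /=; first exact: time_cell_inj ac ca.
  by apply: space_cell_inj be eb; exact: ltnW.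
have mB (i : 'I_#|{: J}|) : measurable [set (v (enum_val i))%:R%:E : \bar R].
  exact: emeasurable_set1.
have := indep _ A mA tA _ mB.
have -> : \bigcap_i [set w | [set (v (enum_val i))%:R%:E] (N w (A i))] =
    [set w | config_event dl s (N w)].
  apply/seteqP; split=> w /= Hw.
    move=> h k; have := Hw (enum_rank (h, k)) I; rewrite /A /= enum_rankK/= mass_cell//.
    by move=> -[] /eqP; rewrite eqr_nat => /eqP.
  by move=> i _ /=; rewrite /A mass_cell// Hw.
rewrite /prob => ->.
have E i : Q [set w | [set (v (enum_val i))%:R%:E] (N w (A i))] =
    (expR (- (dl * cell_mass mu n (enum_val i).2)) *
     (if v (enum_val i) is 0%N then 1 else dl * cell_mass mu n (enum_val i).2))%:E.
  have Ai : (@lebesgue_measure R \x mu)%E (A i) = (dl * cell_mass mu n (enum_val i).2)%:E.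
    exact: intensity_cell.
  rewrite /= (pmf _ (mA i).1 (mA i).2) Ai ?ltry//=.
  by rewrite /v; case: (_ == _); rewrite ?expr1 ?expr0 /= divr1.
under eq_bigr do rewrite E.
rewrite prodEFin/= -(big_enum_val (fun p : J => expR (- (dl * cell_mass mu n p.2)) *
  (if v p is 0%N then 1 else dl * cell_mass mu n p.2))) /=.
rewrite -(pair_bigA _ (fun (h : 'I_H) (k : 'I_n.-1) => expR (- (dl * cell_mass mu n k)) *
  (if v (h, k) is 0%N then 1 else dl * cell_mass mu n k))) /=.
apply: eq_bigr => h _; rewrite big_split/= /block_poisson; congr (_ * _).
  rewrite -expR_sum; congr expR.
  by rewrite -(sum_cell_mass hmu n1) mulr_sumr sumrN.
rewrite /v /=; case: (s h) => [k|]; last by rewrite big1.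
by rewrite (bigD1 k)//= eqxx big1 ?mulr1// => i ik; rewrite eqE /= eq_sym (negbTE ik).
Qed.

End poisson_configurations.

(** * Comparison of the two laws on a grid *)

Section refinement.
Variable R : realType.

Lemma time_cell_split (dl : R) B L l s : 0 <= dl -> (0 < B)%N -> (l < L)%N ->
  time_cell (B%:R * dl) l s <->
  exists2 h : 'I_(L * B), (h %/ B)%N = l & time_cell dl h s.
Proof.
move=> dl0 B0 lL; split=> [[s0 sl ls]|[h hl [s0 sh hs]]].
  rewrite mulrA -natrM in sl.
  have [|h hlB hs] := time_cell_cover s0 _ sl; first by rewrite muln_gt0.
  have hLB : (h < L * B)%N by rewrite (leq_trans hlB)// leq_mul2r lL orbT.
  exists (Ordinal hLB) => //=.
  apply/eqP; rewrite eqn_leq -ltnS ltn_divLR// hlB/= leq_divRL// leqNgt.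
  apply/negP => hl; have l0 : (0 < l)%N by case: l hl {lL sl ls hlB}.
  have := ls l0; rewrite mulrA -natrM ltNge => /negP; apply.
  by case: hs => _ sh _; apply: (le_trans sh); rewrite ler_wpM2r// ler_nat.
have lB : (l * B <= h)%N by rewrite -leq_divRL// hl.
have hB : (h < l.+1 * B)%N by rewrite -ltn_divLR// hl.
split => //.
  by rewrite mulrA -natrM (le_trans sh)// ler_wpM2r// ler_nat.
move=> l0; rewrite mulrA -natrM.
have h0 : (0 < h)%N by rewrite (leq_trans _ lB)// muln_gt0 l0.
by apply: le_lt_trans (hs h0); rewrite ler_wpM2r// ler_nat.
Qed.

Lemma npoints_split (m : Mp R) (dl : R) n B L l k : 0 <= dl -> (0 < B)%N -> (1 < n)%N ->
  (l < L)%N -> npoints m (cell (B%:R * dl) n l k) =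
  (\sum_(h < L * B | (h %/ B)%N == l) npoints m (cell dl n h k))%N.
Proof.
move=> dl0 B0 n1 lL; apply/eqP; rewrite -(eqr_nat R) natr_sum -eqe; apply/eqP.
rewrite -sumEFin -mass_cell//; under eq_bigr do rewrite -mass_cell//.
have -> : cell (B%:R * dl) n l k =
    \big[setU/set0]_(h < L * B | (h %/ B)%N == l) cell dl n h k.
  rewrite -bigcup_seq_cond; apply/seteqP; split=> [[a y]|[a y] [h /= /andP[_ /eqP hl]]].
    move=> [/= /(time_cell_split _ dl0 B0 lL)[h hl ha] yk]; exists h => //=.
    by rewrite mem_index_enum hl eqxx.
  by move=> [ha yk]; split => //=; apply/(time_cell_split _ dl0 B0 lL); exists h.
apply: measure_bigsetU_ord => [h|]; first exact: measurable_cell.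
apply/trivIsetP => i j _ _ ij; apply/seteqP; split=> // z [[zi _] [zj _]].
by case/negP: ij; apply/eqP/val_inj; exact: time_cell_inj zi zj.
Qed.

(** Counts on the grid of mesh [1 / n] when each of the shorter time cells, of length
    [1 / (n * B)], has the state given by [s]. *)
Definition merge_blocks n B (s : 'I_(n ^ 2 * B) -> option 'I_n.-1) : {ffun grid n -> nat} :=
  [ffun p : grid n => \sum_(h < n ^ 2 * B | (h %/ B)%N == p.1) (s h == Some p.2)]%N.

Lemma config_counts n B (s : 'I_(n ^ 2 * B) -> option 'I_n.-1) (m : Mp R) :
  (1 < n)%N -> (0 < B)%N ->
  config_event ((n%:R * B%:R)^-1) s m -> counts n m = merge_blocks s.
Proof.
move=> n1 B0 sm; apply/ffunP => -[l k]; rewrite !ffunE /gcell/=.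
have nR : n%:R != 0 :> R by rewrite pnatr_eq0 -lt0n ltnW.
have BR : B%:R != 0 :> R by rewrite pnatr_eq0 -lt0n.
have -> : n%:R^-1 = B%:R * (n%:R * B%:R)^-1 :> R by rewrite invfM mulrCA divff// mulr1.
rewrite (@npoints_split m _ n B (n ^ 2))// ?invr_ge0 ?mulr_ge0//.
by apply: eq_bigr => h _; rewrite sm.
Qed.

Lemma config_inj n dl H (s s' : {ffun 'I_H -> option 'I_n.-1}) (m : Mp R) :
  config_event dl s m -> config_event dl s' m -> s = s'.
Proof.
move=> sm s'm; apply/ffunP => h.
have E k : (s h == Some k) = (s' h == Some k).
  by have := sm h k; rewrite s'm; do 2 case: (_ == _).
case sh : (s h) => [k|]; first by have := E k; rewrite sh eqxx => /esym/eqP.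
by case s'h : (s' h) => [k|//]; have := E k; rewrite s'h eqxx => /eqP <-.
Qed.

(** The configurations describe disjoint events. *)
Lemma sum_config n dl H (c : {ffun 'I_H -> option 'I_n.-1} -> R) (m : Mp R) :
  (exists2 s : {ffun 'I_H -> option 'I_n.-1}, config_event dl s m &
     \sum_(s : {ffun 'I_H -> option 'I_n.-1}) c s * (`[< config_event dl s m >])%:R = c s)
  \/ \sum_(s : {ffun 'I_H -> option 'I_n.-1}) c s * (`[< config_event dl s m >])%:R = 0.
Proof.
have [[s sm]|nos] := pselect (exists s : {ffun 'I_H -> option 'I_n.-1}, config_event dl s m).
  left; exists s => //; rewrite (bigD1 s)//= asboolT// mulr1 big1 ?addr0// => s' ss'.
  rewrite asboolF ?mulr0// => s'm; move/eqP: ss'; apply.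
  exact: config_inj s'm sm.
by right; rewrite big1// => s _; rewrite asboolF ?mulr0// => sm; apply: nos; exists s.
Qed.

Lemma bernoulli_le (x : R) H : 0 <= x -> 1 - H%:R * (1 - x) <= x ^+ H.
Proof.
move=> x0; elim: H => [|H IH]; first by rewrite mul0r subr0 expr0.
rewrite exprS (le_trans _ (ler_wpM2l x0 IH))// -subr_ge0 -[H.+1%:R]natr1.
have -> : x * (1 - H%:R * (1 - x)) - (1 - (H%:R + 1) * (1 - x)) = H%:R * (1 - x) ^+ 2 by ring.
by rewrite mulr_ge0// sqr_ge0.
Qed.

Lemma expRN_le (x : R) : 0 <= x -> expR (- x) <= 1 - x + x ^+ 2.
Proof.
move=> x0; have x1 : 0 < 1 + x by rewrite ltr_pwDl.
rewrite expRN (@le_trans _ _ (1 + x)^-1)//.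
  by rewrite lef_pV2 ?posrE ?expR_gt0// expR_ge1Dx.
rewrite -div1r ler_pdivrMr// -subr_ge0.
have -> : (1 - x + x ^+ 2) * (1 + x) - 1 = x ^+ 3 by ring.
exact: exprn_ge0.
Qed.

Lemma sum_option (I : finType) (F : option I -> R) :
  \sum_(x : option I) F x = F None + \sum_(i : I) F (Some i).
Proof.
rewrite (bigD1 None)//=; congr (_ + _); rewrite (reindex_omap Some id)/=; last by case.
by apply: eq_bigl => i; rewrite eqxx.
Qed.

End refinement.

Section grid_comparison.
Context {R : realType} {dT : measure_display} {T : measurableType dT}.
Variables (P : probability T R) (Y : nat -> {RV P >-> R}).
Variables (alpha : R) (d : nat -> R) (dtilde : R -> R).
Variable mu : {measure set (\bar R) -> \bar R}.
Hypothesis halpha : 0 < alpha.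
Hypothesis hstat : stationary Y.
Hypothesis hmix : strongly_mixing Y.
Hypothesis hreg : regularly_varying Y alpha d.
Hypothesis hdtilde : asymptotic_inverse (step_extension d) dtilde.
Hypothesis hmu : forall x : R, 0 < x ->
  mu [set y : \bar R | (x%:E < y)%E] = (x `^ (- alpha))%:E.
Hypothesis EI : extremal_index_one Y alpha d.

Context {dT' : measure_display} {T' : measurableType dT'}.
Variables (Q : probability T' R) (N : T' -> Mp R).
Hypothesis hN : poisson_random_measure Q N (@lebesgue_measure R \x mu)%E.

Let X t w := scaled_Mp (dtilde t) t (fun i => Y i w).

Lemma config_scaled n dl H (s : 'I_H -> option 'I_n.-1) t w : 0 < t -> 0 < dtilde t ->
  0 <= dl -> (1 < n)%N ->
  config_event dl s (X t w) <-> forall h : 'I_H,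
    block_state t (block_start dtilde dl t h) (block_start dtilde dl t h.+1) (s h) (Y ^~ w).
Proof.
move=> t0 u0 dl0 n1.
have E h k : npoints (X t w) (cell dl n h k) =
    block_count n t k (block_start dtilde dl t h) (block_start dtilde dl t h.+1) (Y ^~ w).
  by rewrite /npoints scaled_Mp_cell//= natrK.
split=> [sX h|sX h k]; first by apply/forallP => k; rewrite -E sX.
by rewrite E; have /forallP/(_ k)/eqP := sX h.
Qed.

Lemma measurable_masses_scaled t : 0 < t -> 0 < dtilde t -> measurable_masses (X t).
Proof.
move=> t0 u0 dl n h k dl0 n1.
under eq_fun do rewrite scaled_Mp_cell//.
apply/measurable_EFinP.
by apply: (@measurable_block_count R _ T (fun i => Y i : T -> R)).
Qed.

Lemma measurable_masses_poisson : measurable_masses N.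
Proof.
move=> dl n h k dl0 n1; have [mN _ _ _] := hN.
by apply: mN; [exact: measurable_cell|exact: cell_state].
Qed.

End grid_comparison.

Section grid_limit.
Context {R : realType} {dT : measure_display} {T : measurableType dT}.
Variables (P : probability T R) (Y : nat -> {RV P >-> R}).
Variables (alpha : R) (d : nat -> R) (dtilde : R -> R).
Variable mu : {measure set (\bar R) -> \bar R}.
Hypothesis halpha : 0 < alpha.
Hypothesis hstat : stationary Y.
Hypothesis hmix : strongly_mixing Y.
Hypothesis hreg : regularly_varying Y alpha d.
Hypothesis hdtilde : asymptotic_inverse (step_extension d) dtilde.
Hypothesis hmu : forall x : R, 0 < x ->
  mu [set y : \bar R | (x%:E < y)%E] = (x `^ (- alpha))%:E.
Hypothesis EI : extremal_index_one Y alpha d.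

Context {dT' : measure_display} {T' : measurableType dT'}.
Variables (Q : probability T' R) (N : T' -> Mp R).
Hypothesis hN : poisson_random_measure Q N (@lebesgue_measure R \x mu)%E.

Lemma measurable_config d0 (T0 : measurableType d0) (X0 : T0 -> Mp R) n dl H
    (s : 'I_H -> option 'I_n.-1) : (1 < n)%N -> 0 <= dl -> measurable_masses X0 ->
  measurable [set w | config_event dl s (X0 w)].
Proof.
move=> n1 dl0 mX0.
rewrite (_ : mkset _ = \bigcap_(p in [set: 'I_H * 'I_n.-1])
    (fun w => X0 w (cell dl n p.1 p.2)) @^-1` [set (s p.1 == Some p.2)%:R%:E]).
  apply: fin_bigcap_measurable; first exact: finite_finset.
  move=> p _; rewrite -[X in measurable X]setTI.
  by apply: mX0 => //; exact: emeasurable_set1.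
apply/seteqP; split=> w /=.
  by move=> sw [h k] _ /=; rewrite mass_cell// sw.
move=> H0 h k; have := H0 (h, k) I; rewrite /= mass_cell// => -[] /eqP.
by rewrite eqr_nat => /eqP.
Qed.

(** A lower bound for the probability of each state of a block of length [dl], valid
    under both laws; what it misses of the total mass 1 is of order [dl ^+ 2]. *)
Definition minorant n dl (s : option 'I_n.-1) : R :=
  Num.max 0 (if s is Some k
    then dl * cell_mass mu n k - 2 * (dl * level_mass mu n 1) ^+ 2 - dl ^+ 2
    else 1 - dl * level_mass mu n 1 - dl ^+ 2).

Lemma minorant_ge0 n dl (s : option 'I_n.-1) : 0 <= minorant dl s.
Proof. by rewrite /minorant le_max lexx. Qed.

Let level_mass_ge0 n : 0 <= level_mass mu n 1.
Proof. exact: fine_ge0. Qed.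

Lemma minorant_block_limit n dl (s : option 'I_n.-1) : 0 < dl ->
  minorant dl s = 0 \/ 0 <= minorant dl s < block_limit mu dl s.
Proof.
move=> dl0; rewrite /minorant; set q := (if s is Some _ then _ else _).
have [q0|q0] := leP q 0; first by left.
right; rewrite ltW//= /q /block_limit.
have x0 : 0 <= dl * level_mass mu n 1 by rewrite mulr_ge0// ltW.
have d2 : 0 < dl ^+ 2 by rewrite exprn_gt0.
have := expRN_le x0; have := expR_ge1Dx (- (dl * level_mass mu n 1)).
by case: s {q q0} => [k|]; lra.
Qed.

Lemma cell_mass_le n (k : 'I_n.-1) : cell_mass mu n k <= level_mass mu n 1.
Proof.
have n1 : (1 < n)%N by case: n k => [|[|//]] [].
rewrite -(sum_cell_mass hmu n1) (bigD1 k)//= lerDl.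
by apply: sumr_ge0 => i _; exact: cell_mass_ge0.
Qed.

Lemma minorant_block_poisson n dl (s : option 'I_n.-1) : 0 < dl ->
  minorant dl s <= block_poisson mu dl s.
Proof.
move=> dl0; rewrite /minorant /block_poisson ge_max; apply/andP; split.
  rewrite mulr_ge0 ?expR_ge0//; case: s => // k.
  by rewrite mulr_ge0 ?cell_mass_ge0// ltW.
have x0 : 0 <= dl * level_mass mu n 1 by rewrite mulr_ge0// ltW.
have d2 : 0 < dl ^+ 2 by rewrite exprn_gt0.
have e1 := expR_ge1Dx (- (dl * level_mass mu n 1)).
case: s => [k|]; last by lra.
have c0 : 0 <= dl * cell_mass mu n k by rewrite mulr_ge0 ?cell_mass_ge0// ltW.
have cl : dl * cell_mass mu n k <= dl * level_mass mu n 1.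
  by rewrite ler_wpM2l ?(ltW dl0)// cell_mass_le.
have := ler_wpM2r c0 e1.
have : dl * level_mass mu n 1 * (dl * cell_mass mu n k) <= (dl * level_mass mu n 1) ^+ 2.
  by rewrite expr2 ler_wpM2l.
have := sqr_ge0 (dl * level_mass mu n 1).
by rewrite mulrDl mul1r mulNr; lra.
Qed.

Definition minorant_loss n : R := 2 * n.-1%:R * level_mass mu n 1 ^+ 2 + n.-1%:R + 1.

Lemma sum_minorant n dl : (1 < n)%N -> 0 < dl ->
  1 - minorant_loss n * dl ^+ 2 <= \sum_(s : option 'I_n.-1) minorant dl s.
Proof.
move=> n1 dl0; rewrite sum_option.
have H0 : 1 - dl * level_mass mu n 1 - dl ^+ 2 <= @minorant n dl None.
  by rewrite /minorant le_max lexx orbT.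
have : \sum_(k < n.-1) (dl * cell_mass mu n k - (2 * (dl * level_mass mu n 1) ^+ 2 + dl ^+ 2))
    <= \sum_(k < n.-1) minorant dl (Some k).
  by apply: ler_sum => k _; rewrite /minorant opprD addrA le_max lexx orbT.
rewrite sumrB -mulr_sumr (sum_cell_mass hmu n1) sumr_const card_ord -mulr_natl => H1.
apply: le_trans (lerD H0 H1); rewrite -subr_ge0 /minorant_loss.
rewrite (_ : _ - _ = 0)//; ring.
Qed.

(** Each cell in time is cut into [B] blocks, [H] in all.  Under both laws every
    configuration of states of the blocks has at least the product [r] of the
    minorants as asymptotic probability, and the counts are the same on it.  So the
    expectation for the Poisson measure exceeds the other one by at most [M] times
    the missing mass [1 - \sum_s r s].  By the inequality of Bernoulli this mass is
    at most [H] times the loss of one block, that is [minorant_loss n / B]. *)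
Lemma counts_limit n (g : {ffun grid n -> nat} -> R) (M e : R) : (1 < n)%N ->
  (forall v, 0 <= g v <= M) -> 0 < e -> \forall t \near +oo,
    mean Q (fun w => g (counts n (N w))) <=
    mean P (fun w => g (counts n (scaled_Mp (dtilde t) t (fun i => Y i w)))) + e.
Proof.
move=> n1 gM e0.
have M0 : 0 <= M by have /andP[/le_trans h1 /h1] := gM [ffun=> 0%N].
have n0 : 0 < n%:R :> R by rewrite ltr0n ltnW.
have loss0 : 0 <= minorant_loss n.
  by rewrite /minorant_loss !addr_ge0// !mulr_ge0// sqr_ge0.
pose B := (Num.truncn (2 * M * minorant_loss n / e)).+1.
have B0 : 0 < B%:R :> R by rewrite ltr0n.
pose dl : R := (n%:R * B%:R)^-1.
have dl0 : 0 < dl by rewrite invr_gt0 mulr_gt0.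
pose H := (n ^ 2 * B)%N.
pose cfg := {ffun 'I_H -> option 'I_n.-1}.
pose r (s : cfg) := \prod_(h < H) minorant dl (s h).
have r0 s : 0 <= r s by apply: prodr_ge0 => h _; exact: minorant_ge0.
(* [B] was chosen for this bound: [H * dl ^+ 2 = 1 / B]. *)
have loss : M * (1 - \sum_s r s) <= e / 2.
  have -> : \sum_s r s = (\sum_(s : option 'I_n.-1) minorant dl s) ^+ H.
    by rewrite -[in RHS](card_ord H) -prodr_const bigA_distr_bigA.
  set rho := \sum_(s : option _) _.
  have rho0 : 0 <= rho by apply: sumr_ge0 => s _; exact: minorant_ge0.
  have rho1 : 1 - rho <= minorant_loss n * dl ^+ 2.
    by rewrite lerBlDr addrC -lerBlDr; exact: sum_minorant.
  have h1 : 1 - rho ^+ H <= H%:R * (minorant_loss n * dl ^+ 2).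
    rewrite lerBlDr addrC -lerBlDr; apply: le_trans (bernoulli_le H rho0).
    by rewrite lerD2l lerN2 ler_wpM2l.
  apply: (le_trans (ler_wpM2l M0 h1)).
  have -> : M * (H%:R * (minorant_loss n * dl ^+ 2)) = M * minorant_loss n / B%:R.
    rewrite /H /dl natrM natrX; field.
    by rewrite !gt_eqF.
  rewrite ler_pdivrMr// mulrAC ler_pdivlMr//.
  have : 2 * M * minorant_loss n / e < B%:R by exact: truncnS_gt.
  by rewrite ltr_pdivrMr// => /ltW; rewrite [e * _]mulrC; apply: le_trans; lra.
pose K : R := #|{: cfg}|%:R.
have K0 : 0 <= K by [].
have MK0 : 0 < 2 * (M * K + 1) by rewrite mulr_gt0// ltr_wpDl// mulr_ge0.
pose e' := e / (2 * (M * K + 1)).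
have e'0 : 0 < e' by rewrite divr_gt0.
have prob_s (s : cfg) : \forall t \near +oo, r s - e' <= prob P [set w |
    forall h : 'I_H, block_state t (block_start dtilde dl t h)
     (block_start dtilde dl t h.+1) (s h) (Y ^~ w)].
  exact: (config_prob_ge halpha hstat hmix hreg hdtilde hmu EI s n1 dl0 e'0
    (fun x => minorant_block_limit x dl0)).
have probs : \forall t \near +oo, forall s : cfg, r s - e' <= prob P [set w |
    forall h : 'I_H, block_state t (block_start dtilde dl t h)
     (block_start dtilde dl t h.+1) (s h) (Y ^~ w)].
  exact: (filter_forall _ prob_s).
near=> t.
have t0 : 0 < t by near: t; exact: nbhs_pinfty_gt (num_real _).
have u0 : 0 < dtilde t by near: t; exact: near_gt (dtilde_cvg_infty hdtilde.1) 0.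
have probs' : forall s : cfg, r s - e' <= prob P [set w |
    forall h : 'I_H, block_state t (block_start dtilde dl t h)
     (block_start dtilde dl t h.+1) (s h) (Y ^~ w)] by near: t.
pose X w := scaled_Mp (dtilde t) t (fun i => Y i w).
have mX : measurable_masses X by exact: measurable_masses_scaled.
have mN : measurable_masses N by exact: measurable_masses_poisson hN.
have bg d0 (T0 : measurableType d0) (X0 : T0 -> Mp R) : measurable_masses X0 ->
    bounded_measurable (fun w => g (counts n (X0 w))).
  move=> mX0; split.
    apply: (measurable_countable_range (c := fun w => counts n (X0 w))).
    by move=> v; exact: measurable_counts mX0.
  by exists M => w; have /andP[g0 g1] := gM (counts n (X0 w)); rewrite ger0_norm.
have mcfg d0 (T0 : measurableType d0) (X0 : T0 -> Mp R) (s : cfg) :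
    measurable_masses X0 -> measurable [set w | config_event dl s (X0 w)].
  by move=> mX0; apply: measurable_config => //; exact: ltW.
have cfgE d0 (T0 : measurableType d0) (X0 : T0 -> Mp R) (s : cfg) (a : R) :
    (fun w => a * (`[< config_event dl s (X0 w) >])%:R) =
    (fun w => a * \1_[set w | config_event dl s (X0 w)] w).
  apply/funext => w; rewrite indicE; congr (a * (nat_of_bool _)%:R).
have bcfg d0 (T0 : measurableType d0) (X0 : T0 -> Mp R) (s : cfg) (a : R) :
    measurable_masses X0 ->
    bounded_measurable (fun w => a * (`[< config_event dl s (X0 w) >])%:R).
  move=> mX0; rewrite cfgE; apply: bounded_measurableZ.
  by apply: bounded_measurable_indic; exact: mcfg.
have mean_cfg d0 (T0 : measurableType d0) (P0 : probability T0 R) (X0 : T0 -> Mp R)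
    (s : cfg) (a : R) : measurable_masses X0 ->
    mean P0 (fun w => a * (`[< config_event dl s (X0 w) >])%:R) =
    a * prob P0 [set w | config_event dl s (X0 w)].
  move=> mX0; have mC := mcfg _ _ _ s mX0.
  by rewrite cfgE meanZ ?mean_indic//; exact: bounded_measurable_indic.
have g0 v : 0 <= g v by case/andP: (gM v).
have gM1 v : g v <= M by case/andP: (gM v).
have lowP : \sum_(s : cfg) g (merge_blocks s) * (r s - e') <= mean P (fun w => g (counts n (X w))).
  apply: (@le_trans _ _ (\sum_(s : cfg) g (merge_blocks s) * prob P [set w | config_event dl s (X w)])).
    apply: ler_sum => s _; rewrite ler_wpM2l//; apply: (le_trans (probs' s)).
    rewrite le_eqVlt; apply/orP; left; apply/eqP; congr (prob P _).
    by apply/seteqP; split=> w /(config_scaled _ _ _ t0 u0 (ltW dl0) n1).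
  under eq_bigr do rewrite -mean_cfg//.
  rewrite -mean_sum; last by move=> s; exact: bcfg.
  apply: mean_le; [by apply: bounded_measurable_sum => s; exact: bcfg|exact: bg|].
  move=> w; have [[s sw ->]|->//] := sum_config dl (fun s : cfg => g (merge_blocks s)) (X w).
  by rewrite -(config_counts n1 _ sw).
(* Discarding mass is harmless for this upper bound because [g - M <= 0]. *)
have upQ : mean Q (fun w => g (counts n (N w))) <= M + \sum_(s : cfg) (g (merge_blocks s) - M) * r s.
  apply: (@le_trans _ _ (M + \sum_(s : cfg) (g (merge_blocks s) - M) *
      prob Q [set w | config_event dl s (N w)])).
    under eq_bigr do rewrite -mean_cfg//.
    rewrite -{1}(mean_cst Q M) -mean_sum; last by move=> s; exact: bcfg.
    rewrite -meanD; [|exact: bounded_measurable_cst|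
      by apply: bounded_measurable_sum => s; exact: bcfg].
    apply: mean_le; first exact: bg.
      apply: bounded_measurableD; first exact: bounded_measurable_cst.
      by apply: bounded_measurable_sum => s; exact: bcfg.
    move=> w /=; have [[s sw ->]|->] := sum_config dl (fun s : cfg => g (merge_blocks s) - M) (N w).
      by rewrite (config_counts n1 _ sw)// addrC subrK.
    by rewrite addr0.
  rewrite lerD2l; apply: ler_sum => s _; rewrite ler_wnM2l ?subr_le0//.
  rewrite (poisson_config hmu hN)// ?(ltW dl0)//; apply: ler_prod => h _.
  by rewrite minorant_ge0 minorant_block_poisson.
have E1 : \sum_(s : cfg) (g (merge_blocks s) - M) * r s =
    \sum_(s : cfg) g (merge_blocks s) * r s - M * \sum_s r s.
  by rewrite mulr_sumr -sumrB; apply: eq_bigr => s _; rewrite mulrBl.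
have E2 : \sum_(s : cfg) g (merge_blocks s) * (r s - e') =
    \sum_(s : cfg) g (merge_blocks s) * r s - (\sum_(s : cfg) g (merge_blocks s)) * e'.
  by rewrite mulr_suml -sumrB; apply: eq_bigr => s _; rewrite mulrBr.
have E3 : (\sum_(s : cfg) g (merge_blocks s)) * e' <= e / 2.
  apply: (@le_trans _ _ ((M * K) * e')).
    rewrite ler_wpM2r ?(ltW e'0)// (@le_trans _ _ (\sum_(s : cfg) M))//.
      by apply: ler_sum.
    by rewrite sumr_const mulr_natr.
  have -> : M * K * e' = (e / 2) * (M * K / (M * K + 1)).
    by rewrite /e'; field; rewrite gt_eqF// ltr_wpDl// mulr_ge0.
  rewrite ler_piMr ?divr_ge0 ?(ltW e0)// ler_pdivrMr ?mul1r ?lerDl//.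
  by rewrite ltr_wpDl// mulr_ge0.
move: loss; rewrite mulrBr mulr1 => loss.
rewrite E1 in upQ; rewrite E2 in lowP.
change (mean Q (fun w => g (counts n (N w))) <= mean P (fun w => g (counts n (X w))) + e).
lra.
Unshelve. all: by end_near. Qed.

End grid_limit.

(** * From point process convergence to the extremal index *)

Section bump_functional.
Variable R : realType.

Definition rectangle (c x : R) : set (ambient R) :=
  [set s | 0 <= s <= c] `*` [set y | (x%:E < y)%E].

Lemma rectangle_state c x : 0 < x -> rectangle c x `<=` @state_space R.
Proof.
by move=> x0 [s y] [/= /andP[s0 _] xy]; split=> //=; apply: lt_trans xy; rewrite lte_fin.
Qed.

Lemma measurable_rectangle c x : measurable (rectangle c x).
Proof.
apply: measurableX.
  rewrite (_ : mkset _ = `[0, c]%classic); first exact: measurable_itv.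
  by apply/seteqP; split=> s /=; rewrite in_itv.
rewrite (_ : mkset _ = [set` `]x%:E, +oo%E]]); first exact: emeasurable_itv.
by apply/seteqP; split=> y /=; rewrite in_itv/= leey andbT.
Qed.

Definition ramp (a b r : R) : R := Num.min 1 (Num.max 0 ((r - a) / (b - a))).

Lemma ramp_ge0 a b r : 0 <= ramp a b r.
Proof. by rewrite /ramp le_min ler01 le_max lexx. Qed.

Lemma ramp_le1 a b r : ramp a b r <= 1.
Proof. by rewrite /ramp ge_min lexx. Qed.

Lemma ramp0 a b r : a < b -> r <= a -> ramp a b r = 0.
Proof.
move=> ab ra; rewrite /ramp max_l ?min_r// pmulr_lle0 ?subr_le0//.
by rewrite invr_gt0 subr_gt0.
Qed.

Lemma ramp1 a b r : a < b -> b <= r -> ramp a b r = 1.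
Proof.
move=> ab br; rewrite /ramp min_l// le_max; apply/orP; right.
by rewrite ler_pdivlMr ?subr_gt0// mul1r lerD2r.
Qed.

Lemma ramp_continuous a b : continuous (ramp a b).
Proof.
move=> r; have h1 : {for r, continuous (fun r : R => (r - a) / (b - a) : R^o)}.
  apply: cvgM; last exact: cvg_cst.
  by apply: cvgB; [exact: cvg_id|exact: cvg_cst].
have c (k : R) : {for r, continuous (fun=> k : R^o)} by exact: cvg_cst.
have h3 := continuous_min (c 1) (continuous_max (c 0) h1).
suff -> : ramp a b = Order.min_fun (fun=> 1) (Order.max_fun (fun=> 0) (fun r => (r - a) / (b - a))).
  exact: h3.
by apply/funext => s.
Qed.

(** A product of two ramps, equal to 1 on [rectangle s0 x1] and vanishing off
    [rectangle s1 x0]; the cut-off in time decreases, whence the signs. *)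
Definition bump (s0 s1 x0 x1 : R) (z : ambient R) : R :=
  ramp (- s1) (- s0) (- z.1) * ramp (contract x0%:E) (contract x1%:E) (contract z.2).

Lemma closed_box (J th : R) : closed (box J th).
Proof.
rewrite (_ : box J th = fst @^-1` `[0, J]%classic `&`
    (@contract R \o snd) @^-1` [set r | th <= r]).
  apply: closedI.
    apply: (iffLR (continuous_closedP _)); last exact: itv_closed.
    by move=> z; exact: cvg_fst.
  apply: (iffLR (continuous_closedP _)); last exact: closed_ge.
  move=> z; apply: continuous_comp; [exact: cvg_snd|exact: contract_continuous].
by apply/seteqP; split=> -[s y] /=; rewrite in_itv.
Qed.

Section bump.
Variables s0 s1 x0 x1 : R.
Hypotheses (s01 : s0 < s1) (x00 : 0 < x0) (x01 : x0 < x1).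
Let f := bump s0 s1 x0 x1.
Let cx01 : contract x0%:E < contract x1%:E.
Proof. by rewrite lt_contract lte_fin. Qed.

Lemma bump_ge0 z : 0 <= f z.
Proof. by rewrite mulr_ge0 ?ramp_ge0. Qed.

Lemma bump_inner z : \1_(rectangle s0 x1) z <= f z.
Proof.
rewrite indicE; case: (boolP (z \in _)) => [/set_mem[/= /andP[_ zs] zx]|_]; last exact: bump_ge0.
rewrite /f /bump ramp1 ?ramp1 ?mulr1 ?ltrN2 ?lerN2//.
by rewrite le_contract ltW.
Qed.

Lemma bump_outer z : state_space z -> f z <= \1_(rectangle s1 x0) z.
Proof.
move=> [z0 _]; rewrite indicE; case: (boolP (z \in _)) => [_|].
  by rewrite mulr_ile1 ?ramp_ge0 ?ramp_le1.
move=> /negP nz; have [zs|zs] := leP z.1 s1; last first.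
  by rewrite /f /bump ramp0 ?mul0r ?ltrN2 ?lerN2// ltW.
have [xz|zx] := ltP x0%:E z.2.
  by exfalso; apply: nz; apply/mem_set; split => //=; rewrite z0.
by rewrite /f /bump [X in _ * X]ramp0 ?mulr0// le_contract.
Qed.

Lemma bump_continuous : continuous f.
Proof.
move=> z.
have H1 : ramp (- s1) (- s0) (- w.1) @[w --> z] --> ramp (- s1) (- s0) (- z.1).
  apply: (@continuous_cvg _ _ _ (nbhs z)); first exact: ramp_continuous.
  by apply: cvgN; exact: cvg_fst.
have H2 : contract w.2 @[w --> z] --> contract z.2.
  apply: (@continuous_cvg _ _ _ (nbhs z)); first exact: contract_continuous.
  exact: cvg_snd.
have H3 : ramp (contract x0%:E) (contract x1%:E) (contract w.2) @[w --> z] -->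
    ramp (contract x0%:E) (contract x1%:E) (contract z.2).
  by apply: (@continuous_cvg _ _ _ (nbhs z)); first exact: ramp_continuous.
exact: cvgM H1 H3.
Qed.

Lemma bump_CKplus : CKplus f.
Proof.
split; [by move=> z _; exact: bump_ge0|exact: continuous_subspaceT bump_continuous|].
have c0 : 0 < contract x0%:E by rewrite contract_gt0 lte_fin.
set K := _ `&` _.
have Kb : closure (@state_space R `&` [set z | f z != 0]) `<=` box s1 (contract x0%:E).
  have -> : box s1 (contract x0%:E) = closure (box s1 (contract x0%:E)).
    by apply/closure_id; exact: closed_box.
  apply: closureS => z [zs fz]; have := bump_outer zs.
  rewrite indicE; case: (boolP (z \in _)) => [/set_mem[/= zt zx] _|_ /=].
    have cz : contract x0%:E <= contract z.2 by rewrite le_contract ltW.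
    by split.
  by rewrite le_eqVlt ltNge bump_ge0 orbF (negbTE fz).
rewrite (_ : K = closure (@state_space R `&` [set z | f z != 0])).
  apply: (@subclosed_compact _ _ (box s1 (contract x0%:E))); [exact: closed_closure|exact: compact_box|exact: Kb].
by apply/seteqP; split=> [z []//|z zK]; split=> //; exact: box_state c0 _ (Kb _ zK).
Qed.

(** A continuous substitute for the indicator of the measures without points in a
    rectangle, lying between the indicators for a larger and a smaller rectangle.
    One point where [bump] is 1 makes the integral at least 1, which is where the
    ramp saturates; [contract] makes it a continuous function of a possibly
    infinite integral. *)
Definition void_functional (m : Mp R) : R :=
  1 - ramp 0 (contract 1%:E) (contract (vague_eval m (SigSub (mem_set bump_CKplus)))).

Let vague_bump (m : Mp R) : vague_eval m (SigSub (mem_set bump_CKplus)) =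
  (\int[m]_(z in @state_space R) (f z)%:E)%E.
Proof. by []. Qed.

Let c1 : 0 < contract 1%:E :> R.
Proof. by rewrite contract_gt0 lte_fin. Qed.

Lemma void_functional_continuous : continuous void_functional.
Proof.
move=> m.
have H1 : vague_eval m' (SigSub (mem_set bump_CKplus)) @[m' --> m] -->
    vague_eval m (SigSub (mem_set bump_CKplus)).
  have H0 : vague_eval m' @[m' --> m] --> vague_eval m.
    exact: (@initial_continuous _ _ (@vague_eval R) m).
  move=> B nB; refine (H0 (proj (SigSub (mem_set bump_CKplus)) @^-1` B) _).
  exact (@proj_continuous (set_type (@CKplus R)) (fun=> \bar R)
    (SigSub (mem_set bump_CKplus)) (vague_eval m) B nB).
have H2 : contract (vague_eval m' (SigSub (mem_set bump_CKplus))) @[m' --> m] -->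
    contract (vague_eval m (SigSub (mem_set bump_CKplus))).
  by apply: (@continuous_cvg _ _ _ (nbhs m)); first exact: contract_continuous.
have H3 : ramp 0 (contract 1%:E) (contract (vague_eval m' (SigSub (mem_set bump_CKplus))))
    @[m' --> m] --> ramp 0 (contract 1%:E) (contract (vague_eval m (SigSub (mem_set bump_CKplus)))).
  by apply: (@continuous_cvg _ _ _ (nbhs m)); first exact: ramp_continuous.
exact: (cvgB (cvg_cst (1 : R)) H3).
Qed.

Lemma void_functional_bounds (m : Mp R) : 0 <= void_functional m <= 1.
Proof.
by rewrite /void_functional subr_ge0 ramp_le1 lerBlDr lerDl ramp_ge0.
Qed.

Let mf : measurable_fun (@state_space R) (EFin \o f).
Proof. by apply/measurable_EFinP; apply: CKplus_measurable; exact: bump_CKplus. Qed.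

Let m1 c x : measurable_fun (@state_space R) (EFin \o (\1_(rectangle c x) : ambient R -> R)).
Proof.
by apply/measurable_EFinP; apply: measurable_indic; exact: measurable_rectangle.
Qed.

Lemma void_functional_inner (m : Mp R) : m (rectangle s0 x1) != 0%E -> void_functional m = 0.
Proof.
move=> mr; have [/eqP|m1r] := mass_eq0Vge1 m (rectangle s0 x1); first by rewrite (negbTE mr).
apply/eqP; rewrite /void_functional subr_eq0 eq_sym; apply/eqP; apply: ramp1 => //.
rewrite le_contract vague_bump (le_trans m1r)//.
rewrite -(setIidl (@rectangle_state s0 x1 (lt_trans x00 x01))).
rewrite -(integral_indic _ (@measurable_state_space R)); last exact: measurable_rectangle.
apply: ge0_le_integral => //; first exact: (@measurable_state_space R).
  exact: m1.
by move=> z _; rewrite lee_fin; exact: bump_inner.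
Qed.

Lemma void_functional_outer (m : Mp R) : m (rectangle s1 x0) = 0%E -> void_functional m = 1.
Proof.
move=> m0; suff I0 : vague_eval m (SigSub (mem_set bump_CKplus)) = 0%E.
  by rewrite /void_functional I0 contract0 ramp0// subr0.
apply/eqP; rewrite eq_le vague_bump; apply/andP; split; last first.
  by apply: integral_ge0 => z _; rewrite lee_fin bump_ge0.
rewrite -m0 -(setIidl (@rectangle_state s1 x0 x00)).
rewrite -(integral_indic _ (@measurable_state_space R)); last exact: measurable_rectangle.
apply: ge0_le_integral => //; first exact: (@measurable_state_space R).
  by move=> z _; rewrite lee_fin bump_ge0.
  exact: m1.
by move=> z zs; rewrite lee_fin; exact: bump_outer.
Qed.

End bump.
End bump_functional.

Section void_probabilities.
Context {R : realType} {dT : measure_display} {T : measurableType dT}.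
Variables (P : probability T R) (Y : nat -> {RV P >-> R}).
Variables (alpha : R) (d : nat -> R) (dtilde : R -> R).
Variable mu : {measure set (\bar R) -> \bar R}.
Hypothesis halpha : 0 < alpha.
Hypothesis hreg : regularly_varying Y alpha d.
Hypothesis hdtilde : asymptotic_inverse (step_extension d) dtilde.
Hypothesis hmu : forall x : R, 0 < x ->
  mu [set y : \bar R | (x%:E < y)%E] = (x `^ (- alpha))%:E.

Context {dT' : measure_display} {T' : measurableType dT'}.
Variables (Q : probability T' R) (N : T' -> Mp R).
Hypothesis hN : poisson_random_measure Q N (@lebesgue_measure R \x mu)%E.

Let uoo : dtilde t @[t --> +oo] --> +oo := dtilde_cvg_infty hdtilde.1.
Let X t w := scaled_Mp (dtilde t) t (fun i => Y i w).

Lemma scaled_Mp_void (u t c x : R) (y : nat -> R) : 0 < u -> 0 < t -> 0 <= c -> 0 < x ->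
  scaled_Mp u t y (rectangle c x) = 0%E <->
  forall i, (0 < i <= Num.truncn (c * u))%N -> y i <= t * x.
Proof.
move=> u0 t0 c0 x0.
have E : scaled_Mp u t y (rectangle c x) =
    (\sum_(0 <= i <oo | scaled_index u t y i) \d_(scaled_point u t y i) (rectangle c x))%E.
  exact: (scaled_measureE u t y (rectangle c x)).
have inE' i : (0 < i)%N -> rectangle c x (scaled_point u t y i) <->
    (i <= Num.truncn (c * u))%N /\ t * x < y i.
  move=> i0; rewrite truncn_ge_nat ?mulr_ge0 ?(ltW u0)// /rectangle/=.
  rewrite divr_ge0 ?(ltW u0)//= ler_pdivrMr// lte_fin ltr_pdivlMr// [x * t]mulrC.
  by split.
split=> [m0 i /andP[i0 ic]|yle].
  rewrite leNgt; apply/negP => xy.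
  have ri : rectangle c x (scaled_point u t y i) by apply/(inE' _ i0).
  have idx : scaled_index u t y i.
    by rewrite /scaled_index/= i0 u0; apply/asboolP; exact: rectangle_state x0 _ ri.
  have : (\d_(scaled_point u t y i) (rectangle c x) <= scaled_Mp u t y (rectangle c x))%E.
    rewrite E; apply: le_trans (nneseries_lim_ge i.+1 _) => //.
    rewrite big_mkcond big_nat_recr//= idx leeDr//.
    by apply: sume_ge0 => j _; case: ifP.
  by rewrite m0 diracE mem_set// lee_fin ler10.
rewrite E eseries0// => i _ /and3P[i0 _ _]; rewrite diracE memNset// => /(inE' _ i0)[ic].
by rewrite ltNge yle// i0.
Qed.

Lemma prob_scaled_void (t c x : R) : 0 < dtilde t -> 0 < t -> 0 < c -> 0 < x ->
  (0 < Num.truncn (c * dtilde t))%N ->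
  [set w | X t w (rectangle c x) = 0%E] =
  [set w | partial_max Y (Num.truncn (c * dtilde t)) w <= t * x].
Proof.
move=> u0 t0 c0 x0 n0; apply/seteqP; split=> w /=.
  by move=> /(scaled_Mp_void _ u0 t0 (ltW c0) x0) H; apply/(partial_max_le Y w _ n0).
by move=> /(partial_max_le Y w _ n0) H; apply/(scaled_Mp_void _ u0 t0 (ltW c0) x0).
Qed.

Lemma measurable_poisson_void c x : 0 < x -> measurable [set w | N w (rectangle c x) = 0%E].
Proof.
move=> x0; have [mN _ _ _] := hN.
rewrite (_ : mkset _ = (fun w => N w (rectangle c x)) @^-1` [set 0%E])//.
rewrite -[X in measurable X]setTI; apply: mN; last exact: emeasurable_set1.
- exact: measurable_rectangle.
- exact: rectangle_state.
- exact: measurableT.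
Qed.

Lemma prob_poisson_void (c x : R) : 0 <= c -> 0 < x ->
  prob Q [set w | N w (rectangle c x) = 0%E] = expR (- (c * x `^ (- alpha))).
Proof.
move=> c0 x0; have [_ pmf _ _] := hN.
have E : (@lebesgue_measure R \x mu)%E (rectangle c x) = (c * x `^ (- alpha))%:E.
  apply: product_measure_rectangle; last exact: hmu.
    rewrite (_ : mkset _ = `[0, c]%classic); first exact: measurable_itv.
    by apply/seteqP; split=> s /=; rewrite in_itv.
  rewrite (_ : mkset _ = `[0, c]%classic); last first.
    by apply/seteqP; split=> s /=; rewrite in_itv.
  rewrite lebesgue_measure_itv/=; case: ltP => [_|]; first by rewrite oppr0 adde0.
  by rewrite lee_fin => c0'; congr EFin; apply/eqP; rewrite eq_le c0 c0'.
have := pmf _ (measurable_rectangle c x) (rectangle_state x0); rewrite E ltry => /(_ isT 0%N).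
by rewrite /prob => ->; rewrite /= expr0 fact0 divr1 mulr1.
Qed.

Hypothesis hcvg : cvg_in_distribution P X Q N.

Section sandwich.
Variables (s0 s1 x0 x1 : R).
Hypotheses (s00 : 0 < s0) (s01 : s0 < s1) (x00 : 0 < x0) (x01 : x0 < x1).
Let F := void_functional s01 x00 x01.

Let Fb m : `|F m| <= 1.
Proof. by have /andP[F0 F1] := void_functional_bounds s01 x00 x01 m; rewrite ger0_norm. Qed.

Let F_bounded d0 (T0 : measurableType d0) (X0 : T0 -> Mp R) : measurable_masses X0 ->
  bounded_measurable (F \o X0).
Proof.
move=> mX0; split; last by exists 1 => w; exact: Fb.
apply: measurable_functional mX0; last exact: Fb.
exact: void_functional_continuous.
Qed.

Lemma void_functional_cvg : mean P (F \o X t) @[t --> +oo] --> mean Q (F \o N).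
Proof.
have := hcvg (void_functional_continuous (s01 := s01) (x00 := x00) (x01 := x01))
  (ex_intro _ 1 Fb).
by rewrite (meanE Q (F_bounded (measurable_masses_poisson hN))) => /fine_cvgP[].
Qed.

Lemma mean_poisson_void :
  expR (- (s1 * x0 `^ (- alpha))) <= mean Q (F \o N) <= expR (- (s0 * x1 `^ (- alpha))).
Proof.
have x10 := lt_trans x00 x01; have s10 := lt_trans s00 s01.
have bF := F_bounded (measurable_masses_poisson hN).
rewrite -(prob_poisson_void (ltW s10) x00) -(prob_poisson_void (ltW s00) x10).
rewrite -(mean_indic Q (measurable_poisson_void s1 x00)).
rewrite -(mean_indic Q (measurable_poisson_void s0 x10)).
apply/andP; split; apply: mean_le => //;
  try by apply: bounded_measurable_indic; exact: measurable_poisson_void.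
- move=> w; rewrite indicE; case: (boolP (w \in _)) => [/set_mem wA|_] /=.
    by rewrite /F void_functional_outer.
  by case/andP: (void_functional_bounds s01 x00 x01 (N w)).
- move=> w; rewrite indicE; case: (boolP (w \in _)) => [_|nw] /=.
    by case/andP: (void_functional_bounds s01 x00 x01 (N w)).
  rewrite /F void_functional_inner//; apply/eqP => e; move/negP: nw; apply.
  exact/mem_set.
Qed.

Lemma mean_scaled_void : \forall t \near +oo,
  max_cdf Y (Num.truncn (s1 * dtilde t)) (t * x0) <= mean P (F \o X t) <=
  max_cdf Y (Num.truncn (s0 * dtilde t)) (t * x1).
Proof.
have x10 := lt_trans x00 x01; have s10 := lt_trans s00 s01.
near=> t.
have t0 : 0 < t by near: t; exact: nbhs_pinfty_gt (num_real _).
have u0 : 0 < dtilde t by near: t; exact: near_gt uoo 0.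
have n0 : (0 < Num.truncn (s0 * dtilde t))%N.
  rewrite truncn_gt0 -ler_pdivrMl// mulr1; apply: ltW; near: t; exact: near_gt.
have n1 : (0 < Num.truncn (s1 * dtilde t))%N.
  by apply: leq_trans n0 _; apply: le_truncn; rewrite ler_wpM2r ?ltW.
have bF := F_bounded (measurable_masses_scaled Y t0 u0).
have mM n x : measurable [set w | partial_max Y n w <= x] by exact: measurable_max.
rewrite /max_cdf -!(mean_indic P (mM _ _)).
apply/andP; split; apply: mean_le => //;
  try by apply: bounded_measurable_indic; exact: mM.
- move=> w; rewrite indicE; case: (boolP (w \in _)) => [/set_mem wA|_] /=.
    rewrite /F void_functional_outer//.
    by move: wA; rewrite -prob_scaled_void.
  by case/andP: (void_functional_bounds s01 x00 x01 (X t w)).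
- move=> w; rewrite indicE; case: (boolP (w \in _)) => [_|nw] /=.
    by case/andP: (void_functional_bounds s01 x00 x01 (X t w)).
  rewrite /F void_functional_inner//; apply/eqP => e; move/negP: nw; apply.
  by apply/mem_set; rewrite -prob_scaled_void.
Unshelve. all: by end_near. Qed.

End sandwich.

(** Both rectangles of the functional tend to the rectangle of sides [c] and [x] when
    the scaling factor [th] tends to 1. *)
Lemma max_cdf_cvg (c x : R) : 0 < c -> 0 < x ->
  max_cdf Y (Num.truncn (c * dtilde t)) (t * x) @[t --> +oo] -->
  expR (- (c * x `^ (- alpha))).
Proof.
move=> c0 x0.
pose h (th : R) : R := expR (- (c / th * (x * th) `^ (- alpha))).
have h1 : h 1 = expR (- (c * x `^ (- alpha))) by rewrite /h divr1 mulr1.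
have hc : {for (1 : R), continuous h}.
  have cinv : {for (1 : R), continuous (fun th : R => c / th)}.
    apply: cvgM; first exact: cvg_cst.
    by apply: cvgV; [exact: oner_neq0|exact: cvg_id].
  have cpow : {for (1 : R), continuous (fun th : R => (x * th) `^ (- alpha))}.
    apply: (@continuous_comp _ _ _ (fun th : R => x * th) (fun y => y `^ (- alpha))).
      by apply: cvgM; [exact: cvg_cst|exact: cvg_id].
    by apply: npow_cts; rewrite mulr1.
  have cprod : {for (1 : R), continuous (fun th : R => c / th * (x * th) `^ (- alpha))}.
    exact: cvgM cinv cpow.
  apply: (@continuous_comp _ _ _ (fun th : R => - (c / th * (x * th) `^ (- alpha))) expR).
    exact: cvgN cprod.
  exact: continuous_expR.
apply: squeeze_eps => e e0.
  have [th [th1]] := near_above hc e0; rewrite h1 ltr_norml => /andP[he _].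
  have th0 : 0 < th := lt_trans ltr01 th1.
  have s01 : c / th < c by rewrite ltr_pdivrMr// ltr_pMr.
  have s00 : 0 < c / th by rewrite divr_gt0.
  have x01 : x < x * th by rewrite ltr_pMr.
  have /andP[_ up] := mean_poisson_void s00 s01 x0 x01.
  exists (fun t => mean P (void_functional s01 x0 x01 \o X t)),
    (mean Q (void_functional s01 x0 x01 \o N)); split.
  - exact: void_functional_cvg.
  - by apply: (le_lt_trans up); rewrite -/(h th) -ltrBlDl -opprB ltrNl.
  - by have := mean_scaled_void s00 s01 x0 x01; apply: filterS => t /andP[].
have [th [th0 th1]] := near_below ltr01 hc e0; rewrite h1 ltr_norml => /andP[_ he].
have s01 : c < c / th by rewrite ltr_pdivlMr// gtr_pMr.
have x00 : 0 < x * th by rewrite mulr_gt0.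
have x01 : x * th < x by rewrite gtr_pMr.
have /andP[lo _] := mean_poisson_void c0 s01 x00 x01.
exists (fun t => mean P (void_functional s01 x00 x01 \o X t)),
  (mean Q (void_functional s01 x00 x01 \o N)); split.
- exact: void_functional_cvg.
- by apply: lt_le_trans lo; rewrite -/(h th) ltrBlDr -ltrBlDl.
- by have := mean_scaled_void c0 s01 x00 x01; apply: filterS => t /andP[].
Qed.

(** If [d n] stayed below some [A], the tails [tail (d n * x)], which vanish, would
    stay above [tail (A * x)], which is positive for small [x]. *)
Lemma norming_cvg_infty : d n @[n --> \oo] --> +oo.
Proof.
have [B B0 tB] : exists2 B : R, 0 < B & 0 < tail Y B.
  have := tail_scaling hreg hdtilde ltr01; rewrite powR1.
  move=> /cvgr_gt/(_ _ ltr01) H.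
  have [t [Ht [t0 u0]]] := filter_ex (filterI H
    (filterI (nbhs_pinfty_gt (num_real (0 : R))) (near_gt uoo 0))).
  by exists t => //; move: Ht; rewrite mulr1 pmulr_rgt0.
apply/cvgryPge => A; pose A' := Num.max A 1.
have A'0 : 0 < A' by rewrite lt_max ltr01 orbT.
have BA0 : 0 < B / A' by rewrite divr_gt0.
have reg := reg_tail hreg BA0.
pose l := (B / A') `^ (- alpha).
have lB : l < l + 1 by rewrite ltrDl.
have /cvgr_lt/(_ _ lB) reg1 := reg.
near=> n.
have n0 : 0 < n%:R :> R by rewrite ltr0n; near: n; exact: nbhs_infty_gt.
have nbig : (l + 1) / tail Y B < n%:R by near: n; exact: nbhs_infty_gtr.
have nl : n%:R * tail Y (d n * (B / A')) < l + 1 by near: n.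
have : tail Y (d n * (B / A')) < tail Y B.
  by rewrite -(ltr_pM2l n0) (lt_trans nl)// -ltr_pdivrMr.
move=> /tail_ltP; rewrite mulrA ltr_pdivlMr// mulrC ltr_pM2r// => /ltW.
by apply: le_trans; rewrite le_max lexx.
Unshelve. all: by end_near. Qed.

(** The choice [t = d n] turns [t * x] into the level [d n * x], and
    [dtilde (d n) ~ n] turns the number of terms into one between the integer parts of
    [c * dtilde (d n)] for [c < 1] and [c > 1]. *)
Lemma extremal_index_of_cvg : extremal_index_one Y alpha d.
Proof.
move=> x x0; have doo := norming_cvg_infty.
have ratio : dtilde (d n) / n%:R @[n --> \oo] --> (1 : R).
  have := cvg_comp _ _ (@cvgr_idn R) hdtilde.2.
  apply: cvg_trans; apply: near_eq_cvg; exists 1%N => // n /= n1.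
  by rewrite /step_extension natrK; case: n n1.
pose f c n := max_cdf Y (Num.truncn (c * dtilde (d n))) (d n * x).
have fcvg c : 0 < c -> f c n @[n --> \oo] --> expR (- (c * x `^ (- alpha))).
  by move=> c0; exact: (cvg_comp _ _ doo (max_cdf_cvg c0 x0)).
pose h (c : R) : R := expR (- (c * x `^ (- alpha))).
have hc : {for (1 : R), continuous h}.
  apply: (@continuous_comp _ _ _ (fun c : R => - (c * x `^ (- alpha))) expR).
    by apply: cvgN; apply: cvgM; [exact: cvg_id|exact: cvg_cst].
  exact: continuous_expR.
have h1 : h 1 = expR (- x `^ (- alpha)) by rewrite /h mul1r.
apply/fine_cvgP; split.
  by apply: nearW => n; rewrite fin_num_measure//; exact: measurable_max.
rewrite -h1; apply: squeeze_eps => e e0.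
  have [c [c0 c1]] := near_below ltr01 hc e0; rewrite ltr_norml => /andP[he _].
  exists (f c), (h c); split; [exact: fcvg|by rewrite -ltrBlDl -opprB ltrNl|].
  have c1' : 1 < c^-1 by rewrite invf_gt1.
  have /cvgr_lt/(_ _ c1') rlt := ratio.
  have ugt : \forall n \near \oo, c^-1 < dtilde (d n).
    exact: (cvgryPgt _).1 (cvg_comp _ _ doo uoo) _.
  near=> n.
  have n0 : 0 < n%:R :> R by rewrite ltr0n; near: n; exact: nbhs_infty_gt.
  have un : dtilde (d n) / n%:R < c^-1 by near: n.
  apply: max_cdf_anti.
    rewrite truncn_gt0 -ler_pdivrMl// mulr1; apply: ltW; near: n; exact: ugt.
  rewrite ltr_pdivrMr// -ltr_pdivrMl ?invr_gt0// invrK in un.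
  by rewrite -(ler_nat R) (le_trans _ (ltW un))// truncn_le mulr_ge0 ?(ltW c0)// ltW//; near: n; have := ugt; apply: filterS => m; apply: lt_trans; rewrite invr_gt0.
have [c [c1]] := near_above hc e0; rewrite ltr_norml => /andP[_ he].
have c0 : 0 < c := lt_trans ltr01 c1.
exists (f c), (h c); split; [exact: fcvg|by rewrite ltrBlDr -ltrBlDl|].
have c1' : c^-1 < 1 by rewrite invf_lt1.
have /cvgr_gt/(_ _ c1') rgt := ratio.
near=> n.
have n0 : 0 < n%:R :> R by rewrite ltr0n; near: n; exact: nbhs_infty_gt.
have un : c^-1 < dtilde (d n) / n%:R by near: n.
rewrite ltr_pdivlMr// -ltr_pdivlMl ?invr_gt0// invrK in un.
apply: max_cdf_anti; first by rewrite -(ltr_nat R).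
by rewrite truncn_ge_nat ?(ltW un)// (le_trans _ (ltW un)).
Unshelve. all: by end_near. Qed.

End void_probabilities.

(** * The equivalence *)

Unset Implicit Arguments.

Theorem theorem2p1 (R : realType)
    (dT : measure_display) (T : measurableType dT) (P : probability T R)
    (Y : nat -> {RV P >-> R}) (alpha : R) (d : nat -> R) (dtilde : R -> R)
    (mu : {measure set (\bar R) -> \bar R})
    (dT' : measure_display) (T' : measurableType dT') (Q : probability T' R)
    (N : T' -> Mp R)
    (halpha : 0 < alpha)
    (hY0 : forall n w, (1 <= n)%N -> 0 <= Y n w)
    (hstat : stationary Y)
    (hmix : strongly_mixing Y)
    (hreg : regularly_varying Y alpha d)
    (hdtilde : asymptotic_inverse (step_extension d) dtilde)
    (hmu : forall x : R, 0 < x ->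
      mu [set y : \bar R | (x%:E < y)%E] = (x `^ (- alpha))%:E)
    (hN : poisson_random_measure Q N (@lebesgue_measure R \x mu)%E) :
  cvg_in_distribution P (fun t w => scaled_Mp (dtilde t) t (fun i => Y i w))
    Q N
  <-> extremal_index_one Y alpha d.
Proof.
have uoo := dtilde_cvg_infty hdtilde.1.
split=> [hcvg|EI].
  exact: (extremal_index_of_cvg hreg hdtilde hmu hN hcvg).
apply: cvg_in_distribution_counts.
- have := near_gt uoo 0; apply: filterS2 (nbhs_pinfty_gt (num_real (0 : R))) => t t0 u0.
  exact: measurable_masses_scaled.
- exact: measurable_masses_poisson hN.
- move=> n g M e n1 gM e0.
  exact: (counts_limit halpha hstat hmix hreg hdtilde hmu EI hN n1 gM e0).
Qed.
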